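(* Let $p\in[1,\infty)$ and let $\mu$ be a positive measure on $\mathbb{C}_{1/2}$. If $\mu$ is a Carleson measure for $\mathscr{H}^p$, then $\mu$ is a Carleson measure for $H^p(\mathbb{C}_{1/2})$.
   Context: Write $s=\sigma+\mathrm{i}t$ and $\mathbb{C}_{1/2}=\{s\in\mathbb{C}:\sigma>1/2\}$. For $p\in[1,\infty)$ the Dirichlet-Hardy space $\mathscr{H}^p$ is the closure (completion) of the finite Dirichlet polynomials $\sum a_nn^{-s}$ in the norm $$\lim_{T\to\infty}\Big(\frac1{2T}\int_{-T}^T\Big|\sum a_nn^{-\mathrm{i}t}\Big|^p\,dt\Big)^{1/p};$$ its elements are Dirichlet series defining analytic functions on $\mathbb{C}_{1/2}$. $H^p(\mathbb{C}_{1/2})$ is the space of analytic functions $f$ on $\mathbb{C}_{1/2}$ with $\|f\|_{H^p(\mathbb{C}_{1/2})}=\sup_{\sigma>1/2}\big(\int_{\mathbb{R}}|f(\sigma+\mathrm{i}t)|^p\,dt\big)^{1/p}<\infty$. For $X=\mathscr{H}^p$ or $X=H^p(\mathbb{C}_{1/2})$, a positive measure $\mu$ on $\mathbb{C}_{1/2}$ is a Carleson measure for $X$ if there is a constant $C>0$ with $\int_{\mathbb{C}_{1/2}}|f(s)|^p\,d\mu(s)\le C\|f\|_X^p$ for all $f\in X$. *)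

(* Defs.v *)
From HB Require Import structures.
From mathcomp Require Import all_boot all_order all_algebra.
From mathcomp Require Import all_classical all_reals all_analysis.
From mathcomp Require Import complex.

Set Implicit Arguments.
Unset Strict Implicit.
Unset Printing Implicit Defensive.

Import Order.TTheory GRing.Theory Num.Theory.
Import numFieldNormedType.Exports Normc.

Local Open Scope classical_set_scope.
Local Open Scope complex_scope.
Local Open Scope ring_scope.

(* The metric topology of the modulus. *)
HB.instance Definition _ (R : realType) := NormedModule.copy R[i] R[i]^o.

(* A positive measure on the half-plane is given as a Borel measure on the whole
   plane, integrated over the half-plane only; any Borel measure on the
   half-plane extends by 0. *)
Definition borelC (R : realType) := g_sigma_algebraType (@open R[i]).

Definition halfplane (R : realType) : set R[i] := [set s | 2^-1 < complex.Re s].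

Definition cexp (R : realType) (z : R[i]) : R[i] :=
  (expR (complex.Re z))%:C * (cos (complex.Im z) +i* sin (complex.Im z)).

(* n ^ (-s), for n >= 1 *)
Definition dpow (R : realType) (n : nat) (s : R[i]) : R[i] :=
  cexp (- s * (ln n%:R)%:C).

(* Coefficient sequences are shifted: a i is the coefficient of (i+1)^(-s). *)
Definition dirichlet_sum (R : realType) (a : nat -> R[i]) (n : nat) (s : R[i])
    : R[i] :=
  \sum_(i < n) a i * dpow i.+1 s.

(* A polynomial P encodes the finite Dirichlet polynomial
   P`_0 + P`_1 * 2^(-s) + P`_2 * 3^(-s) + ... *)
Definition dirichlet_poly (R : realType) (P : {poly R[i]}) (s : R[i]) : R[i] :=
  dirichlet_sum (fun i => P`_i) (size P) s.

(* The mean over [-T, T] converges, |P(i t)| being almost periodic, so that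
   [lim] is a genuine limit. *)
Definition dirichlet_poly_norm (R : realType) (p : R) (P : {poly R[i]}) : R :=
  lim (((2 * T)^-1 *
        \int[lebesgue_measure]_(t in `[- T, T])
           normc (dirichlet_poly P (0 +i* t)) `^ p) `^ p^-1 @[T --> +oo]).

Definition dirichlet_cauchy (R : realType) (p : R) (P_ : nat -> {poly R[i]})
    : Prop :=
  forall e : R, 0 < e -> exists M : nat, forall k l : nat,
    (M <= k)%N -> (M <= l)%N -> dirichlet_poly_norm p (P_ k - P_ l) < e.

(* A normed space of functions on the half-plane is given by the relation
   "f belongs to X and N is its norm"; values of f off the half-plane are
   irrelevant. *)

(* The completion of the Dirichlet polynomials: an element is the class of a
   Cauchy sequence P_, its norm N is the limit of the norms, its Dirichlet
   series has the limit coefficients a, and f is the sum of that series.  For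
   1 <= p the coefficients are bounded by the norm and the series converges on
   the half-plane, so the last two clauses exclude no Cauchy sequence. *)
Definition dirichlet_hardy (R : realType) (p : R) (f : R[i] -> R[i]) (N : R)
    : Prop :=
  exists (P_ : nat -> {poly R[i]}) (a : nat -> R[i]),
    [/\ dirichlet_cauchy p P_,
        dirichlet_poly_norm p (P_ k) @[k --> \oo] --> N,
        forall i : nat, (P_ k)`_i @[k --> \oo] --> a i
      & forall s : R[i], halfplane s ->
          dirichlet_sum a n s @[n --> \oo] --> f s].

Definition hardy_halfplane_norm (R : realType) (p : R) (f : R[i] -> R[i])
    : \bar R :=
  ereal_sup [set ((\int[lebesgue_measure]_t
                    (normc (f (sigma +i* t)) `^ p)%:E) `^ p^-1)%E
            | sigma in [set sigma : R | 2^-1 < sigma]].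

Definition analytic_halfplane (R : realType) (f : R[i] -> R[i]) : Prop :=
  forall s : R[i], halfplane s -> derivable f s 1.

Definition hardy_halfplane (R : realType) (p : R) (f : R[i] -> R[i]) (N : R)
    : Prop :=
  analytic_halfplane f /\ hardy_halfplane_norm p f = N%:E.

Definition carleson (R : realType) (p : R)
    (X : (R[i] -> R[i]) -> R -> Prop)
    (mu : {measure set (borelC R) -> \bar R}) : Prop :=
  exists2 C : R, 0 < C & forall (f : R[i] -> R[i]) (N : R), X f N ->
    (\int[mu]_(s in @halfplane R) (normc (f s) `^ p)%:E <= (C * N `^ p)%:E)%E.

(* Main.v *)
Require Import Defs.
From mathcomp Require Import all_boot all_order all_algebra.
From mathcomp Require Import all_classical all_reals all_analysis.
From mathcomp Require Import measurable_realfun complex ring lra zify.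

(** Write [x = Im s] and [y = Re s - 1/2] for [s] in the half-plane.  The
    theorem factors through the Carleson squares
    [Q = {t <= x < t + h, 0 < y < h}]: a Carleson measure for the
    Dirichlet-Hardy space satisfies [mu Q <= Cm h] for all [t] and [h]
    ([carleson_square_bound]), and such a measure embeds the Hardy space of the
    half-plane ([carleson_square_embedding]).

    Necessity of the square condition.  The functions of the Hardy space that
    peak on [Q] are powers [2 / p] of the reproducing kernel; for Dirichlet
    series the kernel is a translate of zeta, so the test function is a
    truncated Euler product
      [P(s) = prod_q (1 + (2/p) q^(-1/2) q^(i t) q^(-s))]
    over the primes [64^2 <= q <= e^(1/h)].  On the imaginary axis [|P|^p] is
    bounded by a product of trigonometric polynomials in the angles
    [(x - t) ln q] ([factor_powR_le]); by unique factorisation the mean of the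
    product is the product of the means ([mean_tends_prod]), so the [p]-th
    power of the norm of [P] is [O(exp S)] with [S] the sum of [1/q].  On [Q]
    no angle [(x - t) ln q] exceeds [1] and [|P|^p] is at least [c exp (2 S)]
    ([test_factor_ge]).  Hence [mu Q = O(exp (- S))], and [exp (- S) = O(h)] by
    Euler's product for the harmonic series ([ln_le_exp_sum_primes]).  The
    Chebyshev type bound [sum_ln_div_prime] controls the error terms.

    Sufficiency of the square condition.  Let [f] be in the Hardy space and
    [eps > 0].  The function [|f|^(p/2)] is subharmonic, so that on [y >= eps]
    it is dominated by the Poisson sum of bounds [c_j] for it on the cells of
    length [eps] of the line [y = eps] ([hardy_majorant]).  The proof of
    [max_principle] avoids contour integrals other than over squares: Goursat's
    theorem gives a Cauchy estimate with a lossy constant, and applying it to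
    powers removes the loss.  The averaged estimate [area_estimate] shows that
    [eps sum c_j^2] is controlled by the Hardy norm to the power [p].  On a
    Whitney box the Poisson sum is a weighted sum of dyadic averages of [c]
    ([sum_kern_le]), and the Carleson embedding theorem for dyadic averages
    ([dyadic_embedding], by a Bellman function) sums their squares against
    [mu] ([whitney_embedding]).  It remains to exhaust the half-plane. *)

Set Implicit Arguments.
Unset Strict Implicit.
Unset Printing Implicit Defensive.

Import Order.TTheory GRing.Theory Num.Theory.
Import numFieldNormedType.Exports Normc.

Local Open Scope classical_set_scope.
Local Open Scope complex_scope.
Local Open Scope ring_scope.

(** * Taylor bounds for the logarithm and the exponential *)

Section RealTaylor.
Variable R : realType.
Implicit Types (x y a b : R).

Lemma le_derive (f df : R -> R) a b : a <= b ->
  (forall t, a <= t <= b -> is_derive t 1 f (df t)) ->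
  (forall t, a <= t <= b -> 0 <= df t) -> f a <= f b.
Proof.
move=> ab hf df0.
have hin t : t \in `]a, b[ -> is_derive t 1 f (df t).
  by rewrite in_itv/= => /andP[/ltW at_ /ltW tb]; apply: hf; rewrite at_.
have hcont : {within `[a, b], continuous f}.
  apply: derivable_within_continuous => t; rewrite in_itv/= => tab.
  exact: (@ex_derive _ _ _ _ _ _ _ (hf t tab)).
have [c cab h] := @MVT_segment R f df a b ab hin hcont.
rewrite -subr_ge0 h mulr_ge0 ?subr_ge0// df0//.
Qed.

Lemma le_derive_through0 (f df : R -> R) a : 0 <= a -> f 0 = 0 ->
  (forall t, - a <= t <= a -> is_derive t 1 f (df t)) ->
  (forall t, - a <= t <= a -> 0 <= df t) ->
  forall x, - a <= x <= a -> (0 <= x -> 0 <= f x) /\ (x <= 0 -> f x <= 0).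
Proof.
move=> a0 f0 hf df0 x xa; split => x0.
- rewrite -f0; apply: (@le_derive f df) => // t /andP[? ?]; [apply: hf|apply: df0]; lra.
- rewrite -f0; apply: (@le_derive f df) => // t /andP[? ?]; [apply: hf|apply: df0]; lra.
Qed.

Lemma is_derive_ln1D x : 0 < 1 + x ->
  is_derive x 1 (fun x : R => ln (1 + x)) ((1 + x)^-1).
Proof.
move=> x1; have h1 : is_derive x 1 (fun x : R => 1 + x) (0 + 1).
  exact: (@is_deriveD _ R R (cst 1) id x 1 0 1 _ _).
rewrite -[_^-1]mulr1 -[X in _ * X]add0r.
exact: (@is_derive1_comp R (@ln R) (fun x => 1 + x) x _ _ (is_derive1_ln x1) h1).
Qed.

Lemma is_derive_cubic (a b c d x : R) :
  is_derive x 1 (fun x : R => a + b * x + c * x ^+ 2 + d * x ^+ 3)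
    (b + 2 * c * x + 3 * d * x ^+ 2).
Proof.
have := is_derive_poly (a%:P + b *: 'X + c *: 'X^2 + d *: 'X^3) x.
have -> : horner (a%:P + b *: 'X + c *: 'X^2 + d *: 'X^3)
          = (fun x => a + b * x + c * x ^+ 2 + d * x ^+ 3).
  by apply/funext => y; rewrite !hornerE.
move=> h; apply: (is_derive_eq h); rewrite !derivD derivC !derivZ derivX !derivXn !hornerE /=; ring.
Qed.

Lemma is_deriveB_fun (f g : R -> R) x a b : is_derive x 1 f a ->
  is_derive x 1 g b -> is_derive x 1 (fun x => f x - g x) (a - b).
Proof. by move=> h1 h2; exact: (@is_deriveB _ R R f g x 1 a b h1 h2). Qed.

(** The two differences with cubic polynomials are monotone on [[-1/2, 1/2]]. *)
Lemma ln_taylor x : `|x| <= 2^-1 ->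
  `|ln (1 + x) - (x - x ^+ 2 / 2)| <= `|x| ^+ 3.
Proof.
move=> hx; have := hx; rewrite ler_norml => hx2.
pose f1 x : R := ln (1 + x) - (0 + 1 * x + (- 2^-1) * x ^+ 2 + 0 * x ^+ 3).
pose f2 x : R := (0 + 1 * x + (- 2^-1) * x ^+ 2 + 1 * x ^+ 3) - ln (1 + x).
have d0 : 0 <= 2^-1 :> R by [].
have pos (t : R) : - 2^-1 <= t <= 2^-1 -> 0 < 1 + t by lra.
have h1 (t : R) : - 2^-1 <= t <= 2^-1 -> is_derive t 1 f1 (t ^+ 2 / (1 + t)).
  move=> /pos t1; apply: (is_derive_eq (is_deriveB_fun (is_derive_ln1D t1)
    (is_derive_cubic 0 1 (- 2^-1) 0 t))).
  by field; rewrite gt_eqF.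
have h2 (t : R) : - 2^-1 <= t <= 2^-1 -> is_derive t 1 f2 (t ^+ 2 * (3 - (1 + t)^-1)).
  move=> /pos t1; apply: (is_derive_eq (is_deriveB_fun
    (is_derive_cubic 0 1 (- 2^-1) 1 t) (is_derive_ln1D t1))).
  by field; rewrite gt_eqF.
have f10 : f1 0 = 0 by rewrite /f1 addr0 ln1; ring.
have f20 : f2 0 = 0 by rewrite /f2 addr0 ln1; ring.
have g1 (t : R) : - 2^-1 <= t <= 2^-1 -> 0 <= t ^+ 2 / (1 + t).
  by move=> /pos t1; rewrite divr_ge0 ?sqr_ge0// ltW.
have g2 (t : R) : - 2^-1 <= t <= 2^-1 -> 0 <= t ^+ 2 * (3 - (1 + t)^-1).
  move=> ht; have t1 := pos t ht; rewrite mulr_ge0 ?sqr_ge0// subr_ge0.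
  by rewrite invf_ple ?posrE//; lra.
have [p1 n1] := @le_derive_through0 f1 _ _ d0 f10 h1 g1 x hx2.
have [p2 n2] := @le_derive_through0 f2 _ _ d0 f20 h2 g2 x hx2.
move: p1 n1 p2 n2; rewrite /f1 /f2.
move: (ln (1 + x)) => l p1 n1 p2 n2.
have [x0|x0] := leP 0 x.
  have {}p1 := p1 x0; have {}p2 := p2 x0.
  by rewrite (ger0_norm x0) ler_norml; apply/andP; split; lra.
have {}n1 := n1 (ltW x0); have {}n2 := n2 (ltW x0).
have -> : `|x| ^+ 3 = - x ^+ 3 by rewrite ltr0_norm//; ring.
by rewrite ler_norml; apply/andP; split; lra.
Qed.

Lemma expR_le_1D2 x : 0 <= x <= 2^-1 -> expR x <= 1 + 2 * x.
Proof.
move=> hx; have x1 : 0 < 1 - x by lra.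
have := expR_ge1Dx (- x); rewrite expRN => h.
have : expR x <= (1 - x)^-1.
  by rewrite -[expR x]invrK lef_pV2// posrE// invr_gt0 expR_gt0.
move/le_trans; apply; rewrite -div1r ler_pdivrMr// -subr_ge0.
have -> : (1 + 2 * x) * (1 - x) - 1 = x * (1 - 2 * x) by ring.
by rewrite mulr_ge0//; lra.
Qed.

Lemma expR_taylor1 x : `|x| <= 2^-1 -> expR x - 1 - x <= x ^+ 2.
Proof.
rewrite ler_norml => hx.
pose g x : R := (1 + 1 * x + 1 * x ^+ 2 + 0 * x ^+ 3) - expR x.
have hg (u : R) : is_derive u 1 g (1 + 2 * u - expR u).
  apply: (is_derive_eq (is_deriveB_fun (is_derive_cubic 1 1 1 0 u)
    (is_derive_expR u))).
  by ring.
have g0 : g 0 = 0 by rewrite /g expR0; ring.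
suff : 0 <= g x by rewrite /g; lra.
have [x0|x0] := leP 0 x.
  rewrite -g0; apply: (@le_derive g (fun u => 1 + 2 * u - expR u)) => // u /andP[u0 ut].
  by rewrite subr_ge0 expR_le_1D2//; lra.
pose g' x : R := expR x - (1 + 1 * x + 1 * x ^+ 2 + 0 * x ^+ 3).
have hg' (u : R) : is_derive u 1 g' (expR u - (1 + 2 * u)).
  apply: (is_derive_eq (is_deriveB_fun (is_derive_expR u)
    (is_derive_cubic 1 1 1 0 u))).
  by ring.
have g'0 : g' 0 = 0 by rewrite /g' expR0; ring.
suff : g' x <= 0 by rewrite /g' /g; lra.
rewrite -g'0; apply: (@le_derive g' (fun u => expR u - (1 + 2 * u))) => //.
  exact: ltW.
by move=> u /andP[_ u0]; rewrite subr_ge0; have := expR_ge1Dx u; lra.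
Qed.

Lemma expR_taylor x : `|x| <= 2^-1 -> expR x <= 1 + x + x ^+ 2 / 2 + `|x| ^+ 3.
Proof.
move=> hx; have := hx; rewrite ler_norml => hx2.
have [x0|x0] := leP 0 x.
  pose g x : R := (1 + 1 * x + 2^-1 * x ^+ 2 + 1 * x ^+ 3) - expR x.
  have hg (u : R) : is_derive u 1 g (1 + u + 3 * u ^+ 2 - expR u).
    apply: (is_derive_eq (is_deriveB_fun (is_derive_cubic 1 1 2^-1 1 u)
      (is_derive_expR u))).
    by field.
  have g0 : g 0 = 0 by rewrite /g expR0; ring.
  suff : 0 <= g x by rewrite /g ger0_norm//; lra.
  rewrite -g0; apply: (@le_derive g (fun u => 1 + u + 3 * u ^+ 2 - expR u)) => //.
  move=> u /andP[u0 ux]; have u2 : `|u| <= 2^-1 by rewrite ger0_norm//; lra.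
  have := expR_taylor1 u2; have := sqr_ge0 u; lra.
pose g x : R := expR x - (1 + 1 * x + 2^-1 * x ^+ 2 + 0 * x ^+ 3).
have hg (u : R) : is_derive u 1 g (expR u - (1 + u)).
  apply: (is_derive_eq (is_deriveB_fun (is_derive_expR u)
    (is_derive_cubic 1 1 2^-1 0 u))).
  by field.
have g0 : g 0 = 0 by rewrite /g expR0; ring.
have : g x <= g 0.
  apply: (@le_derive g (fun u => expR u - (1 + u))) => //; first exact: ltW.
  by move=> u _; rewrite subr_ge0 expR_ge1Dx.
have x3 : 0 <= `|x| ^+ 3 by rewrite exprn_ge0.
rewrite g0 /g; lra.
Qed.

End RealTaylor.

(** * The dyadic Carleson embedding theorem *)

Section DyadicEmbedding.
Variable R : realFieldType.
Implicit Types (c : nat -> R) (beta : nat -> nat -> R) (k i : nat).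

(** A node [(k, i)] of the dyadic tree stands for the interval
    [[i 2^k, (i+1) 2^k)]; its children have generation [k - 1]. *)
Fixpoint avg c k i : R :=
  if k is k'.+1 then (avg c k' i.*2 + avg c k' i.*2.+1) / 2 else c i.

Fixpoint mass beta k i : R :=
  beta k i + (if k is k'.+1 then mass beta k' i.*2 + mass beta k' i.*2.+1 else 0).

Fixpoint wsum beta c k i : R := beta k i * avg c k i ^+ 2 +
  (if k is k'.+1 then wsum beta c k' i.*2 + wsum beta c k' i.*2.+1 else 0).

(** The function [(a, m) |-> a^2 / (1 + m)] is convex, which handles the two
    children; adding the mass [alpha] of the node itself decreases it by at
    least [alpha a^2 / 4], since both denominators are at most [2]. *)
Lemma bellman_step (a1 a2 m1 m2 alpha : R) :
  0 <= m1 -> 0 <= m2 -> 0 <= alpha -> (m1 + m2) / 2 + alpha <= 1 ->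
  ((a1 + a2) / 2) ^+ 2 / (1 + ((m1 + m2) / 2 + alpha))
    + alpha * ((a1 + a2) / 2) ^+ 2 / 4
  <= (a1 ^+ 2 / (1 + m1) + a2 ^+ 2 / (1 + m2)) / 2.
Proof.
move=> m10 m20 al0 m1'.
have x1 : 0 < 1 + m1 by rewrite ltr_pwDl.
have x2 : 0 < 1 + m2 by rewrite ltr_pwDl.
have h1 : ((a1 + a2) / 2) ^+ 2 / (1 + (m1 + m2) / 2)
    <= (a1 ^+ 2 / (1 + m1) + a2 ^+ 2 / (1 + m2)) / 2.
  have x12 : 0 < 1 + m1 + (1 + m2) by rewrite addr_gt0.
  rewrite -subr_ge0.
  have -> : (a1 ^+ 2 / (1 + m1) + a2 ^+ 2 / (1 + m2)) / 2
      - ((a1 + a2) / 2) ^+ 2 / (1 + (m1 + m2) / 2)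
     = (a1 * (1 + m2) - a2 * (1 + m1)) ^+ 2
       / (2 * (1 + m1) * (1 + m2) * (1 + m1 + (1 + m2))).
    have -> : 1 + (m1 + m2) / 2 = (1 + m1 + (1 + m2)) / 2 by field.
    move: (1 + m1) (1 + m2) x1 x2 x12 => u v u0 v0 uv0.
    by field; rewrite !gt_eqF.
  by rewrite divr_ge0 ?sqr_ge0// !mulr_ge0// ltW.
apply: le_trans h1.
have mb0 : 0 <= (m1 + m2) / 2 by rewrite divr_ge0// addr_ge0.
move: ((m1 + m2) / 2) mb0 m1' ((a1 + a2) / 2) => mb mb0 m1' a.
have xb : 0 < 1 + mb by rewrite ltr_pwDl.
have xm : 0 < 1 + (mb + alpha) by lra.
rewrite -lerBrDl.
have -> : a ^+ 2 / (1 + mb) - a ^+ 2 / (1 + (mb + alpha))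
        = alpha * a ^+ 2 / ((1 + mb) * (1 + (mb + alpha))).
  by field; rewrite !gt_eqF.
apply: ler_wpM2l; first by rewrite mulr_ge0 ?sqr_ge0.
rewrite lef_pV2 ?posrE ?mulr_gt0//.
have -> : (4 : R) = 2 * 2 by ring.
by apply: ler_pM; [exact: ltW|exact: ltW|lra|lra].
Qed.

Section Embedding.
Variables (beta : nat -> nat -> R) (c : nat -> R) (L : R).
Hypothesis L0 : 0 < L.
Hypothesis beta0 : forall k i, 0 <= beta k i.
Hypothesis carleson : forall k i, mass beta k i <= L * 2 ^+ k.

Lemma mass_ge0 k i : 0 <= mass beta k i.
Proof.
elim: k i => [|k IH] i /=; first by rewrite addr0.
by rewrite !addr_ge0.
Qed.

(** Bellman's induction: the subtracted term is what makes the bound pass from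
    the children to the parent. *)
Lemma bellman_wsum k i : wsum beta c k i <= 4 * L * 2 ^+ k *
  (avg (fun j => c j ^+ 2) k i
   - avg c k i ^+ 2 / (1 + mass beta k i / (L * 2 ^+ k))).
Proof.
elim: k i => [|k IH] i.
  rewrite /= !addr0 expr0 !mulr1.
  set m := beta 0 i / L; have bE : beta 0 i = m * L by rewrite divfK ?gt_eqF.
  have m0 : 0 <= m by rewrite divr_ge0// ltW.
  have m1 : m <= 1.
    by rewrite ler_pdivrMr// mul1r; have := carleson 0 i; rewrite /= addr0 expr0 mulr1.
  have x : 0 < 1 + m by rewrite ltr_pwDl.
  rewrite bE; have -> : 4 * L * (c i ^+ 2 - c i ^+ 2 / (1 + m))
     = L * c i ^+ 2 * (4 / (1 + m)) * m by field; rewrite gt_eqF.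
  have -> : m * L * c i ^+ 2 = L * c i ^+ 2 * 1 * m by ring.
  apply: ler_wpM2r => //; apply: ler_wpM2l; first by rewrite mulr_ge0 ?sqr_ge0 ?ltW.
  by rewrite ler_pdivlMr//; lra.
have massE : mass beta k.+1 i =
  beta k.+1 i + (mass beta k i.*2 + mass beta k i.*2.+1) by [].
have wsumE : wsum beta c k.+1 i = beta k.+1 i * avg c k.+1 i ^+ 2 +
  (wsum beta c k i.*2 + wsum beta c k i.*2.+1) by [].
have avgE (d : nat -> R) : avg d k.+1 i = (avg d k i.*2 + avg d k i.*2.+1) / 2 by [].
have cc := carleson k.+1 i; rewrite massE exprS in cc.
rewrite wsumE massE !avgE (exprS 2 k).
have := IH i.*2; have := IH i.*2.+1.
have := mass_ge0 k i.*2; have := mass_ge0 k i.*2.+1; have := beta0 k.+1 i.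
have P0 : 0 < L * 2 ^+ k by rewrite mulr_gt0// exprn_gt0.
have -> : 4 * L * 2 ^+ k = 4 * (L * 2 ^+ k) by ring.
have -> : 4 * L * (2 * 2 ^+ k) = 8 * (L * 2 ^+ k) by ring.
have e2 : L * (2 * 2 ^+ k) = 2 * (L * 2 ^+ k) by ring.
rewrite e2 in cc *; clear wsumE massE avgE IH.
move: (L * 2 ^+ k) P0 (beta k.+1 i) cc => P P0 b.
move: (mass beta k i.*2) (mass beta k i.*2.+1) => M1 M2 cc b0 M20 M10.
move: (wsum beta c k i.*2) (wsum beta c k i.*2.+1) => S1 S2.
move: (avg _ k i.*2) (avg _ k i.*2.+1) => F1 F2.
move: (avg c k i.*2) (avg c k i.*2.+1) => a1 a2 h2 h1.
have Pn : P != 0 by rewrite gt_eqF.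
have mE : (b + (M1 + M2)) / (2 * P) = (M1 / P + M2 / P) / 2 + b / (2 * P) by field.
have := @bellman_step a1 a2 (M1 / P) (M2 / P) (b / (2 * P)).
rewrite -mE !divr_ge0 ?mulr_ge0// ?(ltW P0)// ler_pdivrMr ?mulr_gt0// mul1r.
move=> /(_ isT isT isT cc).
have -> : b * ((a1 + a2) / 2) ^+ 2 =
  8 * P * (b / (2 * P) * ((a1 + a2) / 2) ^+ 2 / 4) by field.
move: (_ / (1 + M1 / P)) (_ / (1 + M2 / P)) h1 h2 => X1 X2 h1 h2.
move: (_ / (1 + (b + (M1 + M2)) / (2 * P))) (b / (2 * P) * _ / 4) => Y Z h3.
have : P * (Y + Z) <= P * ((X1 + X2) / 2) by rewrite ler_pM2l.
lra.
Qed.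

(** The dyadic Carleson embedding theorem: a mass distribution on the tree
    whose tents have mass [O(2^k)] sums the squares of the averages. *)
Lemma dyadic_embedding k i :
  wsum beta c k i <= 4 * L * 2 ^+ k * avg (fun j => c j ^+ 2) k i.
Proof.
apply: le_trans (bellman_wsum k i) _.
rewrite ler_wpM2l// ?mulr_ge0 ?exprn_ge0 ?(ltW L0)//.
rewrite gerBl divr_ge0 ?sqr_ge0// addr_ge0// divr_ge0 ?mass_ge0//.
by rewrite mulr_ge0 ?exprn_ge0// ltW.
Qed.

End Embedding.

Lemma sum_block (F : nat -> R) m n :
  \sum_(j < m * n) F j = \sum_(i < m) \sum_(j < n) F (i * n + j)%N.
Proof.
elim: m => [|m IH]; first by rewrite mul0n !big_ord0.
rewrite big_ord_recr /= -IH -(big_mkord xpredT F) mulSnr.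
rewrite (big_cat_nat (leq0n (m * n)%N)) ?leq_addr//=.
rewrite big_mkord; congr (_ + _).
by rewrite -{1}[(m * n)%N]add0n big_addn addKn big_mkord; apply: eq_bigr => j _; rewrite addnC.
Qed.

Lemma sum_double (F : nat -> R) n :
  \sum_(j < 2 * n) F j = \sum_(j < n) F j + \sum_(j < n) F (n + j)%N.
Proof.
rewrite (sum_block F) !big_ord_recr big_ord0 /= add0r mul0n mul1n.
by congr (_ + _).
Qed.

Lemma avgE c k i : avg c k i = 2 ^- k * \sum_(j < 2 ^ k) c (i * 2 ^ k + j)%N.
Proof.
elim: k i => [|k IH] i.
  by rewrite /= expn0 big_ord1 expr0 invr1 mul1r muln1 addn0.
rewrite /= !IH expnS (sum_double (fun j => c (i * (2 * 2 ^ k) + j)%N)) exprS invfM.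
have -> : \sum_(j < 2 ^ k) c (i.*2 * 2 ^ k + j)%N
        = \sum_(j < 2 ^ k) c (i * (2 * 2 ^ k) + j)%N.
  by apply: eq_bigr => j _; rewrite mulnA muln2.
have -> : \sum_(j < 2 ^ k) c (i.*2.+1 * 2 ^ k + j)%N
        = \sum_(j < 2 ^ k) c (i * (2 * 2 ^ k) + (2 ^ k + j))%N.
  by apply: eq_bigr => j _; rewrite addnA mulnA muln2 mulSn [(2 ^ k + _)%N]addnC.
by ring.
Qed.

Lemma wsumE beta c k i0 : wsum beta c k i0 =
  \sum_(j < k.+1) \sum_(i < 2 ^ (k - j))
     beta j (i0 * 2 ^ (k - j) + i)%N * avg c j (i0 * 2 ^ (k - j) + i)%N ^+ 2.
Proof.
elim: k i0 => [|k IH] i0.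
  by rewrite /= addr0 big_ord1 subn0 expn0 big_ord1 muln1 addn0.
rewrite [LHS]/= !IH [in RHS]big_ord_recr /= subnn expn0 big_ord1.
rewrite muln1 addn0 [RHS]addrC; congr (_ + _).
rewrite -big_split /=; apply: eq_bigr => j _.
have jk : (j <= k)%N by rewrite -ltnS ltn_ord.
rewrite subSn// expnS (sum_double (fun i => beta j (i0 * (2 * 2 ^ (k - j)) + i)%N
  * avg c j (i0 * (2 * 2 ^ (k - j)) + i)%N ^+ 2)); congr (_ + _); apply: eq_bigr => i _.
  by rewrite mulnA muln2.
by rewrite addnA mulnA muln2 mulSn [(2 ^ _ + _)%N]addnC.
Qed.

Lemma weighted_cauchy_schwarz n (p b : nat -> R) :
  (forall i, (i < n)%N -> 0 <= p i) ->
  (\sum_(i < n) p i * b i) ^+ 2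
  <= (\sum_(i < n) p i) * (\sum_(i < n) p i * b i ^+ 2).
Proof.
move=> p0; set P := \sum_(i < n) p i; set B := \sum_(i < n) p i * b i.
set Q := \sum_(i < n) _.
have P0 : 0 <= P by apply: sumr_ge0 => i _; exact: p0.
have [Pz|Pn] := eqVneq P 0.
  have -> : B = 0; last by rewrite Pz expr0n mul0r.
  rewrite /B big1// => i _.
  have /eqP := Pz; rewrite psumr_eq0; last by move=> j _; exact: p0.
  by move=> /allP/(_ i (mem_index_enum _))/implyP/(_ isT)/eqP ->; rewrite mul0r.
have {}P0 : 0 < P by rewrite lt_neqAle eq_sym Pn.
have : 0 <= \sum_(i < n) p i * (P * b i - B) ^+ 2.
  by apply: sumr_ge0 => i _; rewrite mulr_ge0 ?sqr_ge0// p0.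
have -> : \sum_(i < n) p i * (P * b i - B) ^+ 2 = P * (P * Q - B ^+ 2).
  transitivity (\sum_(i < n) (P ^+ 2 * (p i * b i ^+ 2)
      - 2 * P * B * (p i * b i) + B ^+ 2 * p i)).
    by apply: eq_bigr => i _; ring.
  rewrite big_split /= sumrB -!mulr_sumr -/P -/B -/Q; ring.
by rewrite pmulr_rge0// subr_ge0.
Qed.

(** [Y] bounds the terms on the left of [i'] and [Z] those on its right, in
    terms of the offset only, which makes the bound uniform in [i']. *)
Lemma sum_offsets_le n i' (X Y Z : nat -> R) : (i' < n)%N ->
  (forall l, 0 <= Y l) -> (forall l, 0 <= Z l) ->
  (forall i, (i <= i')%N -> X i <= Y (i' - i)%N) ->
  (forall i, (i' < i)%N -> X i <= Z (i - i')%N) ->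
  \sum_(i < n) X i <= \sum_(l < n) (Y l + Z l).
Proof.
move=> i'n Y0 Z0 XY XZ; rewrite big_split /=.
rewrite -(big_mkord xpredT X) (big_cat_nat (leq0n i'.+1))//= big_mkord.
apply: lerD.
  apply: (@le_trans _ _ (\sum_(i < i'.+1) Y (i' - i)%N)).
    by apply: ler_sum => i _; apply: XY; rewrite -ltnS ltn_ord.
  rewrite (reindex_inj rev_ord_inj)/=.
  rewrite -(big_mkord xpredT Y) (big_cat_nat (leq0n i'.+1))//= big_mkord.
  rewrite -[leLHS]addr0; apply: lerD; last by apply: sumr_ge0.
  by apply: ler_sum => i _; rewrite subSS subKn// -ltnS ltn_ord.
rewrite -{1}[i'.+1]add0n big_addn big_mkord.
apply: (@le_trans _ _ (\sum_(l < n - i'.+1) Z l.+1)).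
  apply: ler_sum => l _; apply: le_trans (XZ _ _) _; first by rewrite addnS ltnS leq_addl.
  by rewrite addnS subSn ?leq_addl// addnK.
apply: (@le_trans _ _ (\sum_(0 <= l < (n - i'.+1).+1) Z l)).
  by rewrite big_mkord big_ord_recl lerDr.
rewrite -subSn// subSS -(big_mkord xpredT Z).
rewrite [leRHS](big_cat_nat (leq0n (n - i')%N)) ?leq_subr//=.
by rewrite lerDl; apply: sumr_ge0.
Qed.

End DyadicEmbedding.

Section OffsetWeights.
Variable R : rcfType.

(** By telescoping: the primitive of [x^(-3/2)] is [- 2 x^(-1/2)]. *)
Lemma sum_inv32_le n :
  \sum_(m < n) (m.+1%:R * Num.sqrt m.+1%:R)^-1 <= 4 :> R.
Proof.
suff : \sum_(m < n) (m.+1%:R * Num.sqrt m.+1%:R)^-1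
       <= 4 - 4 * (Num.sqrt n.+1%:R)^-1 :> R.
  by move/le_trans; apply; rewrite gerBl mulr_ge0// invr_ge0 sqrtr_ge0.
elim: n => [|n IH]; first by rewrite big_ord0 sqrtr1 invr1 mulr1 subrr.
rewrite big_ord_recr /=; apply: le_trans (lerD IH (lexx _)) _.
set a := Num.sqrt n.+1%:R; set b := Num.sqrt n.+2%:R.
have a0 : 0 < a by rewrite sqrtr_gt0 ltr0n.
have b0 : 0 < b by rewrite sqrtr_gt0 ltr0n.
have a2 : a ^+ 2 = n.+1%:R by rewrite sqr_sqrtr.
have b2 : b ^+ 2 = a ^+ 2 + 1 by rewrite a2 sqr_sqrtr// -natr1.
have a1 : 1 <= a ^+ 2 by rewrite a2 ler1n.
rewrite -a2 -subr_ge0.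
have ab : a <= b by rewrite ler_sqrt// ler_nat.
have b2a : b * (a + b) <= 4 * a ^+ 2.
  have : b * (a + b) <= 2 * b ^+ 2 by rewrite mulrDr -expr2 mulr2n mulrDl !mul1r lerD2r expr2 ler_wpM2l// ltW.
  by move/le_trans; apply; rewrite b2; lra.
have -> : 4 - 4 / b - (4 - 4 / a + (a ^+ 2 * a)^-1)
   = (4 * a ^+ 2 * (b - a) - b) / (a ^+ 3 * b) by field; rewrite !gt_eqF.
rewrite divr_ge0 ?mulr_ge0 ?exprn_ge0 ?(ltW a0) ?(ltW b0)// subr_ge0.
have dd : (b - a) * (a + b) = 1.
  have -> : (b - a) * (a + b) = b ^+ 2 - a ^+ 2 by ring.
  by rewrite b2; ring.
have ba0 : 0 <= b - a by rewrite subr_ge0.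
have {1}-> : b = (b - a) * (b * (a + b)) by rewrite mulrCA dd mulr1.
by rewrite [leRHS]mulrC; exact: ler_wpM2l.
Qed.

(** [offw] is the decay of the Poisson kernel at distance [l] boxes, nearest
    neighbours counting as distance [0].  The Cauchy-Schwarz weight [offs]
    satisfies [offw / offs * (l + 1) = offw * offs], so that the factor [l + 1]
    lost by translating boxes still leaves a convergent sum. *)
Definition offw (l : nat) : R := (1 + (l.-1)%:R ^+ 2)^-1.
Definition offs (l : nat) : R := Num.sqrt l.+1%:R.

Lemma offw_gt0 l : 0 < offw l.
Proof. by rewrite invr_gt0 ltr_pwDl// sqr_ge0. Qed.

Lemma offs_gt0 l : 0 < offs l.
Proof. by rewrite sqrtr_gt0 ltr0n. Qed.

Lemma sum_offsets n : \sum_(l < n) offw l * offs l <= 20.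
Proof.
apply: (@le_trans _ _ (\sum_(l < n) 5 * (l.+1%:R * Num.sqrt l.+1%:R)^-1)).
  apply: ler_sum => l _; rewrite /offw /offs.
  have a0 : 0 < Num.sqrt l.+1%:R :> R by rewrite sqrtr_gt0 ltr0n.
  have l0 : 0 < l.+1%:R :> R by rewrite ltr0n.
  have w0 : 0 < 1 + (l.-1)%:R ^+ 2 :> R by rewrite ltr_pwDl// sqr_ge0.
  rewrite invfM mulrA ler_pdivlMr// -mulrA -expr2 sqr_sqrtr ?ler0n//.
  rewrite mulrC ler_pdivrMr// mulrAC ler_pdivlMr// -expr2.
  case: (nat_of_ord l) => [|k]; first by rewrite expr0n/= addr0 mulr1 expr1n; lra.
  have := sqr_ge0 (2 * k%:R - 1 : R); rewrite /= -!natr1; move: (k%:R : R) => x; lra.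
rewrite -mulr_sumr; have := sum_inv32_le n; lra.
Qed.

End OffsetWeights.

(** * Holomorphic functions of one variable *)

Section Hol.
Variable R : realType.
Implicit Types (f g : R[i] -> R[i]) (z w c : R[i]).

Definition hol f z : Prop := derivable f z 1.

Lemma hol_cst c z : hol (fun _ => c) z.
Proof. exact: (@derivable_cst _ R[i] R[i] c z 1). Qed.

Lemma hol_id z : hol (fun x => x) z.
Proof. exact: (@derivable_id _ R[i] z 1). Qed.

Lemma holD f g z : hol f z -> hol g z -> hol (fun x => f x + g x) z.
Proof. move=> h1 h2; exact: (@derivableD _ R[i] R[i] f g z 1 h1 h2). Qed.

Lemma holN f z : hol f z -> hol (fun x => - f x) z.
Proof. move=> h1; exact: (@derivableN _ R[i] R[i] f z 1 h1). Qed.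

Lemma holB f g z : hol f z -> hol g z -> hol (fun x => f x - g x) z.
Proof. move=> h1 h2; exact: (holD h1 (holN h2)). Qed.

Lemma holM f g z : hol f z -> hol g z -> hol (fun x => f x * g x) z.
Proof. move=> h1 h2; exact: (@derivableM _ R[i] f g z 1 h1 h2). Qed.

Lemma holV f z : f z != 0 -> hol f z -> hol (fun x => (f x)^-1) z.
Proof. move=> h h1; exact: (@derivableV _ R[i] f z 1 h h1). Qed.

Lemma holX f n z : hol f z -> hol (fun x => f x ^+ n) z.
Proof.
move=> h; elim: n => [|n IH].
  have -> : (fun x => f x ^+ 0) = (fun _ => 1).
    by apply/funext => x; rewrite expr0.
  exact: hol_cst.
have -> : (fun x => f x ^+ n.+1) = (fun x => f x * f x ^+ n).
  by apply/funext => x; rewrite exprS.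
exact: holM.
Qed.

Lemma hol_sum (n : nat) (F : nat -> R[i] -> R[i]) z :
  (forall i, (i < n)%N -> hol (F i) z) ->
  hol (fun x => \sum_(i < n) F i x) z.
Proof.
elim: n => [|n IH] H.
  have -> : (fun x => \sum_(i < 0) F i x) = (fun _ => 0).
    by apply/funext => x; rewrite big_ord0.
  exact: hol_cst.
have -> : (fun x => \sum_(i < n.+1) F i x)
        = (fun x => \sum_(i < n) F i x + F n x).
  by apply/funext => x; rewrite big_ord_recr.
apply: holD; last exact: H.
by apply: IH => i ilt; apply: H; rewrite ltnS ltnW.
Qed.

Lemma hol_continuous f z : hol f z -> {for z, continuous f}.
Proof. by move=> /derivable1_diffP /differentiable_continuous. Qed.

Lemma normrE z : `|z| = (normc z)%:C.
Proof. by []. Qed.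

Lemma normc_distC z w : normc (z - w) = normc (w - z).
Proof. by rewrite -normcN opprB. Qed.

Lemma normc_ge0 z : 0 <= normc z.
Proof. by case: z => a b; exact: sqrtr_ge0. Qed.

Lemma normc_eq0 z : (normc z == 0) = (z == 0).
Proof.
apply/eqP/eqP; first exact: eq0_normc.
by move=> ->; exact: normc0.
Qed.

Lemma normc_gt0 z : z != 0 -> 0 < normc z.
Proof. by move=> h; rewrite lt_neqAle normc_ge0 eq_sym normc_eq0 h. Qed.

Lemma normcX z n : normc (z ^+ n) = normc z ^+ n.
Proof.
elim: n => [|n IH]; first by rewrite !expr0; exact: normc1.
by rewrite !exprS normcM IH.
Qed.

Lemma normcR (x : R) : normc x%:C = `|x|.
Proof. by rewrite /= expr0n /= addr0 sqrtr_sqr. Qed.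

Lemma normc_sqrE z : normc z ^+ 2 = complex.Re z ^+ 2 + complex.Im z ^+ 2.
Proof. by case: z => a b /=; rewrite sqr_sqrtr// addr_ge0 ?sqr_ge0. Qed.

Lemma cReD z w : complex.Re (z + w) = complex.Re z + complex.Re w.
Proof. by case: z; case: w. Qed.
Lemma cImD z w : complex.Im (z + w) = complex.Im z + complex.Im w.
Proof. by case: z; case: w. Qed.
Lemma cReN z : complex.Re (- z) = - complex.Re z.
Proof. by case: z. Qed.
Lemma cImN z : complex.Im (- z) = - complex.Im z.
Proof. by case: z. Qed.
Lemma cReM z w : complex.Re (z * w)
  = complex.Re z * complex.Re w - complex.Im z * complex.Im w.
Proof. by case: z; case: w. Qed.
Lemma cImM z w : complex.Im (z * w)
  = complex.Re z * complex.Im w + complex.Im z * complex.Re w.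
Proof. by case: z; case: w. Qed.
Definition ReImE := (cReD, cImD, cReN, cImN, cReM, cImM).

Lemma complex_eq z w :
  complex.Re z = complex.Re w -> complex.Im z = complex.Im w -> z = w.
Proof. by case: z => a b; case: w => a' b' /= -> ->. Qed.

Lemma le_Re_normc z : `|complex.Re z| <= normc z.
Proof.
rewrite -(@ler_pXn2r _ 2) ?nnegrE ?normc_ge0//.
by rewrite normc_sqrE real_normK ?num_real// lerDl sqr_ge0.
Qed.

Lemma le_Im_normc z : `|complex.Im z| <= normc z.
Proof.
rewrite -(@ler_pXn2r _ 2) ?nnegrE ?normc_ge0//.
by rewrite normc_sqrE real_normK ?num_real// lerDr sqr_ge0.
Qed.

Lemma normc_le_ReIm z : normc z <= `|complex.Re z| + `|complex.Im z|.
Proof.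
rewrite -(@ler_pXn2r _ 2) ?nnegrE ?normc_ge0 ?addr_ge0//.
rewrite normc_sqrE sqrrD !real_normK ?num_real//.
by rewrite -addrA lerD2l lerDr mulrn_wge0// mulr_ge0.
Qed.

Lemma nbhs_normcP z (P : R[i] -> Prop) : (\forall w \near z, P w) <->
  exists2 d : R, 0 < d & forall w, normc (w - z) < d -> P w.
Proof.
split.
- move=> /nbhs_ballP[[d e]] /=; rewrite ltcE /= => /andP[/eqP -> d0] H.
  exists d => // w wd; apply: H.
  by rewrite -ball_normE /ball_ /= normrE ltcE /= eqxx /= normc_distC.
- move=> [d d0 H]; apply/nbhs_ballP; exists d%:C; first by rewrite /= ltcR.
  move=> w; rewrite -ball_normE /ball_ /= normrE ltcE /= eqxx /= => h.
  by apply: H; rewrite normc_distC.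
Qed.

Lemma continuous_normcP f z : {for z, continuous f} <->
  forall e : R, 0 < e ->
  exists2 d : R, 0 < d & forall w, normc (w - z) < d -> normc (f w - f z) < e.
Proof.
split.
- move=> H e e0; apply/nbhs_normcP.
  apply: (H (fun y => normc (y - f z) < e)).
  by apply/nbhs_normcP; exists e.
- move=> H A /nbhs_normcP[e e0 eA]; apply/nbhs_normcP.
  have [d d0 Hd] := H _ e0.
  by exists d => // w wd; apply: eA; exact: Hd.
Qed.

Lemma continuousCR_normcP (f : R[i] -> R) z : {for z, continuous f} <->
  forall e : R, 0 < e ->
  exists2 d : R, 0 < d & forall w, normc (w - z) < d -> `|f w - f z| < e.
Proof.
split.
- move=> H e e0; apply/nbhs_normcP.
  apply: (H (fun y => `|y - f z| < e)).
  by apply/nbhs_ballP; exists e => //= y; rewrite /ball /= distrC.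
- move=> H A /nbhs_ballP[e /= e0 eA]; apply/nbhs_normcP.
  have [d d0 Hd] := H _ e0.
  by exists d => // w wd; apply: eA; rewrite /ball/= distrC; exact: Hd.
Qed.

Lemma continuousRC_normcP (f : R -> R[i]) x : {for x, continuous f} <->
  forall e : R, 0 < e ->
  exists2 d : R, 0 < d & forall y, `|y - x| < d -> normc (f y - f x) < e.
Proof.
split.
- move=> H e e0.
  have : \forall y \near x, normc (f y - f x) < e.
    by apply: (H (fun y => normc (y - f x) < e)); apply/nbhs_normcP; exists e.
  move=> /nbhs_ballP[d /= d0 Hd]; exists d => // y yd; apply: Hd.
  by rewrite /ball/= distrC.
- move=> H A /nbhs_normcP[e e0 eA].
  have [d d0 Hd] := H _ e0.
  apply/nbhs_ballP; exists d => // y; rewrite /ball/= distrC => yd.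
  by apply: eA; exact: Hd.
Qed.

Lemma continuous_Re : continuous (@complex.Re R).
Proof.
move=> z; apply/continuousCR_normcP => e e0; exists e => // w.
by apply: le_lt_trans; rewrite -cReN -cReD le_Re_normc.
Qed.

Lemma continuous_Im : continuous (@complex.Im R).
Proof.
move=> z; apply/continuousCR_normcP => e e0; exists e => // w.
by apply: le_lt_trans; rewrite -cImN -cImD le_Im_normc.
Qed.

Lemma ler_dist_normc z w : `|normc z - normc w| <= normc (z - w).
Proof.
have h u v : normc u - normc v <= normc (u - v).
  by rewrite lerBlDr; apply: le_trans (le_normcD _ _); rewrite subrK.
by rewrite ler_norml h andbT -[X in _ <= X]opprB lerN2 normc_distC h.
Qed.

Lemma continuous_normc : continuous (@normc R).
Proof.
move=> z; apply/continuousCR_normcP => e e0; exists e => // w.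
exact/le_lt_trans/ler_dist_normc.
Qed.

(** The derivative as a linear approximation with an explicit modulus, the form
    in which Goursat's argument uses it. *)
Lemma hol_linear_approx f z : hol f z -> exists D : R[i], forall e : R, 0 < e ->
  exists2 d : R, 0 < d & forall w, normc (w - z) < d ->
    normc (f w - f z - D * (w - z)) <= e * normc (w - z).
Proof.
move=> /cvg_ex[D HD]; exists D => e e0.
have : \forall h \near (0 : R[i])^',
    normc (h^-1 *: (f (h *: 1 + z) - f z) - D) < e.
  apply: (HD (fun y => normc (y - D) < e)).
  by apply/nbhs_normcP; exists e.
move=> /nbhs_normcP[d d0 Hd]; exists d => // w wd.
have [->|wz] := eqVneq w z; first by rewrite !subrr mulr0 subrr !normc0 mulr0.
have h0 : w - z != 0 by rewrite subr_eq0.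
have := Hd (w - z); rewrite subr0 => /(_ wd h0).
have -> : (w - z) *: (1 : R[i]) + z = w by rewrite /GRing.scale /= mulr1 subrK.
rewrite /GRing.scale /= => /ltW H.
have -> : f w - f z - D * (w - z) =
          ((w - z)^-1 * (f w - f z) - D) * (w - z).
  by rewrite mulrBl mulrAC mulVf// mul1r.
by rewrite normcM ler_wpM2r// normc_ge0.
Qed.

Lemma hol_near f g z : (\forall w \near z, f w = g w) -> hol g z -> hol f z.
Proof.
move=> fg; have gf : {near z, g =1 f} by apply: filterS fg => w ->.
exact: (@near_eq_derivable _ R[i] R[i] g f z 1 gf).
Qed.

End Hol.

#[global] Opaque hol.

(** * Goursat's theorem on squares *)

Section SegmentIntegral.
Variable R : realType.
Implicit Types (phi psi : R -> R) (a b c : R).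

Definition cont_on a b phi := forall t, a <= t <= b -> {for t, continuous phi}.

Definition II a b phi : R :=
  \int[lebesgue_measure]_(t in `[a, b]) phi t.

Lemma cont_on_integrable a b phi : cont_on a b phi ->
  (@lebesgue_measure R).-integrable `[a, b] (EFin \o phi).
Proof.
move=> H; apply: continuous_compact_integrable; first exact: segment_compact.
apply: continuous_in_subspaceT => x; rewrite inE/= in_itv/= => xab.
exact: H.
Qed.

Lemma cont_onS a b a' b' phi : a <= a' -> b' <= b ->
  cont_on a b phi -> cont_on a' b' phi.
Proof.
move=> aa' bb' H t /andP[h1 h2]; apply: H.
by rewrite (le_trans aa' h1) (le_trans h2 bb').
Qed.

Lemma IID a b phi psi : cont_on a b phi -> cont_on a b psi ->
  II a b (fun t => phi t + psi t) = II a b phi + II a b psi.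
Proof. by move=> h1 h2; apply: RintegralD => //; exact: cont_on_integrable. Qed.

Lemma IIB a b phi psi : cont_on a b phi -> cont_on a b psi ->
  II a b (fun t => phi t - psi t) = II a b phi - II a b psi.
Proof. by move=> h1 h2; apply: RintegralB => //; exact: cont_on_integrable. Qed.

Lemma IIZ a b k phi : cont_on a b phi ->
  II a b (fun t => k * phi t) = k * II a b phi.
Proof. by move=> h1; apply: RintegralZl => //; exact: cont_on_integrable. Qed.

Lemma cont_on_cst a b c : cont_on a b (fun _ => c).
Proof. by move=> t _; exact: cst_continuous. Qed.

Lemma II_cst a b c : a <= b -> II a b (fun _ => c) = c * (b - a).
Proof.
move=> ab; rewrite /II Rintegral_cst//= lebesgue_measure_itv/= lte_fin.
by case: ltgtP ab => // -> _ /=; rewrite subrr.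
Qed.

Lemma eq_II a b phi psi : (forall t, a <= t <= b -> phi t = psi t) ->
  II a b phi = II a b psi.
Proof. by move=> H; apply: eq_Rintegral => t; rewrite inE/= in_itv/=; exact: H. Qed.

Lemma le_II a b phi psi : cont_on a b phi -> cont_on a b psi ->
  (forall t, a <= t <= b -> phi t <= psi t) -> II a b phi <= II a b psi.
Proof.
move=> h1 h2 h; by apply: le_Rintegral => //; exact: cont_on_integrable.
Qed.

Lemma II_ge0 a b phi : (forall t, a <= t <= b -> 0 <= phi t) -> 0 <= II a b phi.
Proof. by move=> H; apply: Rintegral_ge0 => t /=; rewrite in_itv/=; exact: H. Qed.

Lemma II_split a m b phi : a <= m -> m <= b -> cont_on a b phi ->
  II a b phi = II a m phi + II m b phi.
Proof.
move=> am mb H.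
have Hi := cont_on_integrable H.
have := @Rintegral_itvB R phi (BLeft a) (BRight b) m Hi.
rewrite !bnd_simp => /(_ am mb).
rewrite Rintegral_itv_obnd_cbnd; last first.
  apply: integrableS Hi => //; apply: subset_itvr; rewrite bnd_simp.
  exact: am.
by rewrite /II => <-; rewrite addrC subrK.
Qed.

Lemma II_close a b c M phi : a <= b -> cont_on a b phi ->
  (forall t, a <= t <= b -> `|phi t - c| <= M) ->
  `|II a b phi - c * (b - a)| <= M * (b - a).
Proof.
move=> ab cphi H.
have h1 : II a b phi <= (c + M) * (b - a).
  rewrite -(II_cst _ ab); apply: le_II => //; first exact: cont_on_cst.
  by move=> t /H; rewrite ler_norml lerBlDr => /andP[_]; rewrite addrC.
have h2 : (c - M) * (b - a) <= II a b phi.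
  rewrite -(II_cst _ ab); apply: le_II => //; first exact: cont_on_cst.
  move=> t /H; rewrite ler_norml lerBrDr => /andP[+ _].
  by rewrite addrC.
rewrite ler_norml; apply/andP; split; move: h1 h2; rewrite mulrDl mulrBl; lra.
Qed.

Lemma cont_onD a b phi psi : cont_on a b phi -> cont_on a b psi ->
  cont_on a b (fun t => phi t + psi t).
Proof. by move=> h1 h2 t tab; apply: continuousD; [exact: h1|exact: h2]. Qed.

Lemma cont_onB a b phi psi : cont_on a b phi -> cont_on a b psi ->
  cont_on a b (fun t => phi t - psi t).
Proof. by move=> h1 h2 t tab; apply: continuousB; [exact: h1|exact: h2]. Qed.

Lemma cont_onM a b phi psi : cont_on a b phi -> cont_on a b psi ->
  cont_on a b (fun t => phi t * psi t).
Proof. by move=> h1 h2 t tab; apply: continuousM; [exact: h1|exact: h2]. Qed.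

End SegmentIntegral.

Section Goursat.
Variable R : realType.
Implicit Types (g : R[i] -> R[i]) (x y L : R) (z : R[i]).

Definition in_sq x y L z :=
  (x <= complex.Re z <= x + L) && (y <= complex.Im z <= y + L).

(** The real part of the counterclockwise contour integral of [g dz] along the
    square with lower left corner [x + iy] and side [L]; the imaginary part is
    recovered by rotating [g]. *)
Definition JJ g x y L : R :=
  II x (x + L) (fun t => complex.Re (g (t +i* y)))
  - II x (x + L) (fun t => complex.Re (g (t +i* (y + L))))
  - II y (y + L) (fun t => complex.Im (g ((x + L) +i* t)))
  + II y (y + L) (fun t => complex.Im (g (x +i* t))).

Definition sq_continuous g x y L :=
  forall z, in_sq x y L z -> {for z, continuous g}.

Lemma cont_horiz (g : R[i] -> R[i]) t y : {for t +i* y, continuous g} ->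
  {for t, continuous (fun t => g (t +i* y))}.
Proof.
move=> /continuous_normcP cg; apply/continuousRC_normcP => e /cg[d d0 Hd].
exists d => // t' ht; apply: Hd.
by rewrite /= subrr expr0n addr0 sqrtr_sqr.
Qed.

Lemma cont_vert (g : R[i] -> R[i]) x t : {for x +i* t, continuous g} ->
  {for t, continuous (fun t => g (x +i* t))}.
Proof.
move=> /continuous_normcP cg; apply/continuousRC_normcP => e /cg[d d0 Hd].
exists d => // t' ht; apply: Hd.
by rewrite /= subrr expr0n add0r sqrtr_sqr.
Qed.

Lemma cont_Re_comp (h : R -> R[i]) t : {for t, continuous h} ->
  {for t, continuous (fun t => complex.Re (h t))}.
Proof.
move=> ch; apply: (@continuous_comp _ _ _ h (@complex.Re R)) => //.
exact: continuous_Re.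
Qed.

Lemma cont_Im_comp (h : R -> R[i]) t : {for t, continuous h} ->
  {for t, continuous (fun t => complex.Im (h t))}.
Proof.
move=> ch; apply: (@continuous_comp _ _ _ h (@complex.Im R)) => //.
exact: continuous_Im.
Qed.

Lemma cont_normc_comp (h : R -> R[i]) t : {for t, continuous h} ->
  {for t, continuous (fun t => normc (h t))}.
Proof.
move=> ch; apply: (@continuous_comp _ _ _ h (@normc R)) => //.
exact: continuous_normc.
Qed.

Section Sides.
Variables (g : R[i] -> R[i]) (x y L : R).
Hypotheses (L0 : 0 <= L) (cg : sq_continuous g x y L).

Lemma cont_on_horiz c : y <= c <= y + L ->
  cont_on x (x + L) (fun t => complex.Re (g (t +i* c))).
Proof.
move=> yc t tx; apply: cont_Re_comp; apply: cont_horiz; apply: cg.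
by rewrite /in_sq/= tx.
Qed.

Lemma cont_on_vert c : x <= c <= x + L ->
  cont_on y (y + L) (fun t => complex.Im (g (c +i* t))).
Proof.
move=> xc t ty; apply: cont_Im_comp; apply: cont_vert; apply: cg.
by rewrite /in_sq/= xc.
Qed.

(** An affine function contributes nothing: the bottom and top integrands, and
    the right and left ones, differ by constants that cancel. *)
Lemma JJ_affine_err (A B : R[i]) (M : R) :
  (forall z, in_sq x y L z -> normc (g z - A - B * z) <= M) ->
  `|JJ g x y L| <= 4 * M * L.
Proof.
move=> H.
have yy : y <= y <= y + L by rewrite lexx lerDl.
have yL : y <= y + L <= y + L by rewrite lexx lerDl L0.
have xx : x <= x <= x + L by rewrite lexx lerDl.
have xL : x <= x + L <= x + L by rewrite lexx lerDl L0.
have xle : x <= x + L by rewrite lerDl.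
have yle : y <= y + L by rewrite lerDl.
have := II_close (c := complex.Im B * L) (M := M + M) xle
  (cont_onB (cont_on_horiz yy) (cont_on_horiz yL)).
rewrite IIB; [|exact: cont_on_horiz..].
have := II_close (c := complex.Im B * L) (M := M + M) yle
  (cont_onB (cont_on_vert xL) (cont_on_vert xx)).
rewrite IIB; [|exact: cont_on_vert..].
have e1 : y + L - y = L by rewrite addrC addKr.
have e2 : x + L - x = L by rewrite addrC addKr.
rewrite e1 e2.
have key : forall u v : R[i], in_sq x y L u -> in_sq x y L v ->
    normc ((g u - g v) - B * (u - v)) <= M + M.
  move=> u v hu hv.
  have -> : (g u - g v) - B * (u - v) = (g u - A - B * u) - (g v - A - B * v).
    ring.
  by apply: le_trans (le_normcD _ _) _; rewrite normcN lerD// H.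
move=> /(_ _) hV /(_ _) hH.
have {}hV := hV _; have {}hH := hH _.
have {}hV : `|II y (y + L) (fun t => complex.Im (g ((x + L) +i* t))) -
      II y (y + L) (fun t => complex.Im (g (x +i* t))) - complex.Im B * L * L|
      <= (M + M) * L.
  apply: hV => t ty.
  have := key ((x + L) +i* t) (x +i* t).
  rewrite /in_sq/= xx xL ty/= => /(_ isT isT) /(le_trans (le_Im_normc _)).
  have -> : ((x + L) +i* t - x +i* t) = L%:C.
    by apply: complex_eq; rewrite /= ?subrr// addrC addKr.
  by rewrite !cImD !cImN cImM /= mulr0 add0r.
have {}hH : `|II x (x + L) (fun t => complex.Re (g (t +i* y))) -
      II x (x + L) (fun t => complex.Re (g (t +i* (y + L)))) -
      complex.Im B * L * L| <= (M + M) * L.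
  apply: hH => t tx.
  have := key (t +i* y) (t +i* (y + L)).
  rewrite /in_sq/= yy yL tx/= => /(_ isT isT) /(le_trans (le_Re_normc _)).
  have -> : (t +i* y - t +i* (y + L)) = 0 -i* L.
    by apply: complex_eq; rewrite /= ?subrr// opprD addrA subrr add0r.
  by rewrite !cReD !cReN cReM /= mulr0 sub0r mulrN opprK.
rewrite /JJ; move: hV hH.
move: (II x _ _) (II x _ _) (II y _ _) (II y _ _) => H1 H2 V1 V2.
have -> : 4 * M * L = (M + M) * L + (M + M) * L by ring.
move: (complex.Im B * L * L : R) ((M + M) * L : R) => ML c.
move=> hV hH.
have -> : H2 - H1 - V2 + V1 = (H2 - H1 - ML) - (V2 - V1 - ML) by ring.
by apply: le_trans (ler_normB _ _) _; exact: lerD.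
Qed.

Lemma JJ_quarter (h := L / 2) : JJ g x y L =
  JJ g x y h + JJ g (x + h) y h + JJ g x (y + h) h + JJ g (x + h) (y + h) h.
Proof.
have h0 : 0 <= h by rewrite divr_ge0.
have eL : L = h + h by rewrite /h -splitr.
have eh c : c + L = c + h + h by rewrite eL addrA.
rewrite /JJ !eh.
have sH c : y <= c <= y + L -> II x (x + h + h) (fun t => complex.Re (g (t +i* c)))
   = II x (x + h) (fun t => complex.Re (g (t +i* c)))
   + II (x + h) (x + h + h) (fun t => complex.Re (g (t +i* c))).
  by move=> hc; apply: II_split; rewrite ?lerDl// -eh; exact: cont_on_horiz.
have sV c : x <= c <= x + L -> II y (y + h + h) (fun t => complex.Im (g (c +i* t)))
   = II y (y + h) (fun t => complex.Im (g (c +i* t)))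
   + II (y + h) (y + h + h) (fun t => complex.Im (g (c +i* t))).
  by move=> hc; apply: II_split; rewrite ?lerDl// -eh; exact: cont_on_vert.
rewrite !sH ?sV; [ring| lra..].
Qed.

End Sides.
End Goursat.

Section GoursatTheorem.
Variable R : realType.
Implicit Types (g : R[i] -> R[i]) (x y L : R) (z : R[i]).

Lemma in_sq_sub x y L x' y' L' z : x <= x' -> y <= y' ->
  x' + L' <= x + L -> y' + L' <= y + L -> in_sq x' y' L' z -> in_sq x y L z.
Proof. by rewrite /in_sq => ? ? ? ? /andP[/andP[? ?] /andP[? ?]]; lra. Qed.

Lemma exp2_small (L d : R) : 0 < d -> exists n, L / 2 ^+ n < d.
Proof.
move=> d0; have [L0|L0] := leP L 0.
  by exists 0%N; rewrite expr0 divr1 (le_lt_trans L0).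
have : \forall n \near \oo, (2^-1 : R) ^+ n < d / L.
  have h : `|2^-1 : R| < 1 by rewrite ger0_norm// invf_lt1// ltr1n.
  have /cvgrPdist_lt := @cvg_expr R 2^-1 h.
  move=> /(_ _ (divr_gt0 d0 L0)); apply: filterS => n.
  by rewrite sub0r normrN ger0_norm// exprn_ge0.
move=> [N _ /(_ N (leqnn N))] H; exists N.
by rewrite -exprVn mulrC -ltr_pdivlMr.
Qed.

(** Goursat's subdivision: the child square with the largest share of the
    integral is kept, as a corner offset by half of the side. *)
Definition goursat_step g (e L : R) (p : R * R) : R * R :=
  let h := L / 2 in let: (x, y) := p in
  let big x' y' := e * h ^+ 2 < `|JJ g x' y' h| in
  if big x y then (x, y) else if big (x + h) y then (x + h, y)
  else if big x (y + h) then (x, y + h) else (x + h, y + h).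

Fixpoint goursat_seq g (e L : R) (p : R * R) (n : nat) : R * R :=
  if n is n'.+1 then goursat_step g e (L / 2 ^+ n') (goursat_seq g e L p n')
  else p.

Lemma goursat_stepP g (e L : R) p p' : p' = goursat_step g e L p ->
  0 <= L -> sq_continuous g p.1 p.2 L -> e * L ^+ 2 < `|JJ g p.1 p.2 L| ->
  [/\ p.1 <= p'.1 <= p.1 + L / 2, p.2 <= p'.2 <= p.2 + L / 2 &
      e * (L / 2) ^+ 2 < `|JJ g p'.1 p'.2 (L / 2)|].
Proof.
case: p => x y -> /= L0 cg.
rewrite (JJ_quarter L0 cg).
have h0 : 0 <= L / 2 by rewrite divr_ge0.
have -> : e * L ^+ 2 = e * (L / 2) ^+ 2 *+ 4 by field.
move: (L / 2) h0 => h h0.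
case: ifPn => [b1|/=]; first by rewrite !lexx !lerDl h0.
case: ifPn => [b1 _|/=]; first by rewrite !lexx !lerDl h0.
case: ifPn => [b1 _ _|/=]; first by rewrite !lexx !lerDl h0.
rewrite -!leNgt /= => b3 b2 b1 H; rewrite !lexx !lerDl h0; split => //.
rewrite ltNge; apply/negP => b4; move: H; rewrite ltNge => /negP; apply.
rewrite !mulrSr mulr0n add0r.
by do 3 (apply: le_trans (ler_normD _ _) _; apply: lerD => //).
Qed.

(** At the point [Z] common to all the nested squares the error of the linear
    approximation of [g] is small compared with the side, hence so is the
    contour integral compared with the area. *)
Lemma goursat_aux g (e L x y : R) : 0 < L -> 0 < e ->
  (forall z, in_sq x y L z -> hol g z) -> `|JJ g x y L| <= e * L ^+ 2.
Proof.
move=> L0 e0 hg; rewrite leNgt; apply/negP => big0.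
set u := goursat_seq g e L (x, y).
pose Ln n := L / 2 ^+ n : R.
have Ln0 n : 0 < Ln n by rewrite divr_gt0// exprn_gt0.
have LnS n : Ln n.+1 = Ln n / 2.
  by rewrite /Ln exprS invfM mulrA mulrAC.
have P n : [/\ x <= (u n).1, (u n).1 + Ln n <= x + L, y <= (u n).2,
    (u n).2 + Ln n <= y + L & e * (Ln n) ^+ 2 < `|JJ g (u n).1 (u n).2 (Ln n)|].
  elim: n => [|n [h1 h2 h3 h4 h5]].
    by rewrite /u/= /Ln expr0 divr1 !lexx.
  have cn : sq_continuous g (u n).1 (u n).2 (Ln n).
    move=> z zn; apply: hol_continuous; apply: hg.
    exact: in_sq_sub h1 h3 h2 h4 zn.
  have [] := @goursat_stepP g e (Ln n) (u n) (u n.+1) (erefl _) (ltW (Ln0 n)) cn h5.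
  rewrite -LnS => /andP[k1 k2] /andP[k3 k4] k5; split => //.
  - exact: le_trans k1.
  - by apply: le_trans h2; move: k2; rewrite LnS (splitr (Ln n)); lra.
  - exact: le_trans k3.
  - by apply: le_trans h4; move: k4; rewrite LnS (splitr (Ln n)); lra.
have step n : [/\ (u n).1 <= (u n.+1).1, (u n.+1).1 + Ln n.+1 <= (u n).1 + Ln n,
   (u n).2 <= (u n.+1).2 & (u n.+1).2 + Ln n.+1 <= (u n).2 + Ln n].
  have [h1 h2 h3 h4 h5] := P n.
  have cn : sq_continuous g (u n).1 (u n).2 (Ln n).
    move=> z zn; apply: hol_continuous; apply: hg.
    exact: in_sq_sub h1 h3 h2 h4 zn.
  have [] := @goursat_stepP g e (Ln n) (u n) (u n.+1) (erefl _) (ltW (Ln0 n)) cn h5.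
  rewrite LnS => /andP[k1 k2] /andP[k3 k4] _; split => //.
  - by move: k2; rewrite {2 3}(splitr (Ln n)); lra.
  - by move: k4; rewrite {2 3}(splitr (Ln n)); lra.
have nest n m : [/\ (u n).1 <= (u (m + n)%N).1,
    (u (m + n)%N).1 + Ln (m + n)%N <= (u n).1 + Ln n,
   (u n).2 <= (u (m + n)%N).2 & (u (m + n)%N).2 + Ln (m + n)%N <= (u n).2 + Ln n].
  elim: m => [|m [h1 h2 h3 h4]]; first by rewrite add0n !lexx.
  rewrite addSn; have [k1 k2 k3 k4] := step (m + n)%N.
  split; [exact: le_trans k1|exact: le_trans h2|exact: le_trans k3|exact: le_trans h4].
have nest1 n m : (u m).1 <= (u n).1 + Ln n /\ (u m).2 <= (u n).2 + Ln n.
  have [nm|/ltnW mn] := leqP n m.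
    have [_ h2 _ h4] := nest n (m - n)%N; rewrite subnK// in h2 h4.
    have := Ln0 m; split; lra.
  have [h1 _ h3 _] := nest m (n - m)%N; rewrite subnK// in h1 h3.
  have := Ln0 n; split; lra.
pose X := sup (range (fun n => (u n).1)).
pose Y := sup (range (fun n => (u n).2)).
have hX n : (u n).1 <= X <= (u n).1 + Ln n.
  have ub : ubound (range (fun n => (u n).1)) ((u n).1 + Ln n).
    by move=> _ [m _ <-]; have [] := nest1 n m.
  apply/andP; split.
    apply: ub_le_sup; last by exists n.
    by exists ((u n).1 + Ln n).
  by apply: ge_sup => //; exists (u 0%N).1, 0%N.
have hY n : (u n).2 <= Y <= (u n).2 + Ln n.
  have ub : ubound (range (fun n => (u n).2)) ((u n).2 + Ln n).
    by move=> _ [m _ <-]; have [] := nest1 n m.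
  apply/andP; split.
    apply: ub_le_sup; last by exists n.
    by exists ((u n).2 + Ln n).
  by apply: ge_sup => //; exists (u 0%N).2, 0%N.
pose Z := X +i* Y.
have inZ : in_sq x y L Z.
  have := hX 0%N; have := hY 0%N; rewrite /u/= /Ln expr0 divr1 /in_sq/=.
  by move=> -> ->.
have [D HD] := hol_linear_approx (hg _ inZ).
have e16 : 0 < e / 16 by rewrite divr_gt0.
have [d d0 Hd] := HD _ e16.
have [n Hn] := exp2_small (2 * L) d0.
have {}Hn : 2 * Ln n < d by rewrite /Ln mulrA.
have [h1 h2 h3 h4 h5] := P n.
have sub z : in_sq (u n).1 (u n).2 (Ln n) z -> in_sq x y L z.
  exact: in_sq_sub.
have near z : in_sq (u n).1 (u n).2 (Ln n) z -> normc (z - Z) <= 2 * Ln n.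
  move=> /andP[/andP[a1 a2] /andP[a3 a4]].
  apply: le_trans (normc_le_ReIm _) _; rewrite !cReD !cImD !cReN !cImN /=.
  have /andP[? ?] := hX n; have /andP[? ?] := hY n.
  by rewrite mulr_natl mulr2n lerD// ler_norml; apply/andP; split; lra.
have := @JJ_affine_err R g (u n).1 (u n).2 (Ln n) (ltW (Ln0 n)) _
  (g Z - D * Z) D (e / 16 * (2 * Ln n)).
have c1 : sq_continuous g (u n).1 (u n).2 (Ln n).
  by move=> z /sub/hg/hol_continuous.
move=> /(_ c1) H.
suff : `|JJ g (u n).1 (u n).2 (Ln n)| <= 4 * (e / 16 * (2 * Ln n)) * Ln n.
  have eL2 : 0 < e * Ln n ^+ 2 by rewrite mulr_gt0// exprn_gt0.
  have -> : 4 * (e / 16 * (2 * Ln n)) * Ln n = e * Ln n ^+ 2 / 2 by field.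
  move: h5 eL2; move: (e * Ln n ^+ 2 : R) => A; lra.
apply: H => z zin.
have -> : g z - (g Z - D * Z) - D * z = g z - g Z - D * (z - Z) by ring.
apply: le_trans (Hd _ (le_lt_trans (near _ zin) Hn)) _.
by rewrite ler_pM2l//; exact: near.
Qed.

Theorem goursat g x y L : 0 < L ->
  (forall z, in_sq x y L z -> hol g z) -> JJ g x y L = 0.
Proof.
move=> L0 hg; apply/eqP; rewrite -normr_le0; apply/ler_addgt0Pr => e e0.
rewrite add0r; have L20 : 0 < L ^+ 2 by rewrite exprn_gt0.
apply: le_trans (goursat_aux L0 (divr_gt0 e0 L20) hg) _.
by rewrite divfK// gt_eqF.
Qed.

(** Goursat for a square with an exceptional point at a corner: the other three
    quarters contribute nothing, and the quarter at the corner has length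
    tending to zero under a bounded integrand. *)
Lemma goursat_corner g (X Y : R) (e1 e2 : bool) (L : R) : 0 < L ->
  {for X +i* Y, continuous g} ->
  (forall z, in_sq (X - L *+ e1) (Y - L *+ e2) L z -> z != X +i* Y -> hol g z) ->
  JJ g (X - L *+ e1) (Y - L *+ e2) L = 0.
Proof.
move=> L0 cg hg.
have xy_sub (h : R) : 0 <= h <= L ->
    forall z, in_sq (X - h *+ e1) (Y - h *+ e2) h z ->
    in_sq (X - L *+ e1) (Y - L *+ e2) L z.
  move=> hL z; apply: in_sq_sub;
    case: (e1); case: (e2); rewrite ?mulr1n ?mulr0n ?subr0 ?subrK; lra.
have cont (h : R) : 0 <= h <= L ->
    sq_continuous g (X - h *+ e1) (Y - h *+ e2) h.
  move=> hL z /(xy_sub _ hL) zin; have [->//|zn] := eqVneq z (X +i* Y).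
  exact: hol_continuous (hg _ zin zn).
have half (h : R) : 0 < h <= L -> JJ g (X - h *+ e1) (Y - h *+ e2) h
    = JJ g (X - (h / 2) *+ e1) (Y - (h / 2) *+ e2) (h / 2).
  move=> hL.
  have hh0 : 0 <= h by lra.
  have hL' : 0 <= h <= L by lra.
  have sub := xy_sub h hL'.
  rewrite (JJ_quarter hh0 (cont h hL')).
  have h2 : 0 < h / 2 by rewrite divr_gt0//; lra.
  have hsp : h = h / 2 + h / 2 by rewrite -splitr.
  have z0 x' y' : X - h *+ e1 <= x' -> Y - h *+ e2 <= y' ->
      x' + h / 2 <= X - h *+ e1 + h -> y' + h / 2 <= Y - h *+ e2 + h ->
      ~~ in_sq x' y' (h / 2) (X +i* Y) -> JJ g x' y' (h / 2) = 0.
    move=> a1 a2 a3 a4 nin; apply: (goursat h2) => z zin; apply: hg.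
      by apply: sub; exact: in_sq_sub zin.
    by apply: contraNneq nin => <-.
  move: (h / 2) h2 hsp z0 => k k0 hk z0; rewrite hk in z0 *.
  clear - z0 k0; rewrite /in_sq/= in z0.
  case: e1 e2 z0 => [] [] z0; rewrite ?mulr1n ?mulr0n ?subr0 in z0 *.
  - have -> : X - (k + k) + k = X - k by ring.
    have -> : Y - (k + k) + k = Y - k by ring.
    rewrite (z0 (X - (k + k)) (Y - (k + k))) ?(z0 (X - k) (Y - (k + k))) ?(z0 (X - (k + k)) (Y - k)) ?add0r//; try (apply/negP => /andP[/andP[? ?] /andP[? ?]]); lra.
  - have -> : X - (k + k) + k = X - k by ring.
    rewrite (z0 (X - (k + k)) Y) ?(z0 (X - (k + k)) (Y + k)) ?(z0 (X - k) (Y + k)) ?add0r ?addr0//; try (apply/negP => /andP[/andP[? ?] /andP[? ?]]); lra.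
  - have -> : Y - (k + k) + k = Y - k by ring.
    rewrite (z0 X (Y - (k + k))) ?(z0 (X + k) (Y - (k + k))) ?(z0 (X + k) (Y - k)) ?add0r ?addr0//; try (apply/negP => /andP[/andP[? ?] /andP[? ?]]); lra.
  - rewrite (z0 (X + k) Y) ?(z0 X (Y + k)) ?(z0 (X + k) (Y + k)) ?add0r ?addr0//; try (apply/negP => /andP[/andP[? ?] /andP[? ?]]); lra.
have Ln n : 0 < L / 2 ^+ n <= L.
  rewrite divr_gt0 ?exprn_gt0//= ler_pdivrMr ?exprn_gt0//.
  by apply: ler_peMr; [exact: ltW|rewrite exprn_ege1// ler1n].
have small n : JJ g (X - L *+ e1) (Y - L *+ e2) L =
    JJ g (X - (L / 2 ^+ n) *+ e1) (Y - (L / 2 ^+ n) *+ e2) (L / 2 ^+ n).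
  elim: n => [|n ->]; first by rewrite expr0 divr1.
  by rewrite half// exprS invfM mulrA mulrAC.
have /continuous_normcP/(_ 1 ltr01)[d d0 Hd] := cg.
apply/eqP; rewrite -normr_le0; apply/ler_addgt0Pr => e e0; rewrite add0r.
have d'0 : 0 < Num.min (d / 2) (e / 4).
  by rewrite lt_min !divr_gt0.
have [n] := exp2_small L d'0.
rewrite lt_min (small n); move: (L / 2 ^+ n) (Ln n) => h hL /andP[hd he].
have hL' : 0 <= h <= L by lra.
apply: (@le_trans _ _ (4 * 1 * h)); last by move: he; lra.
have hh0 : 0 <= h by lra.
apply: (@JJ_affine_err R g _ _ h hh0 (cont h hL') (g (X +i* Y)) 0 1).
move=> z zin; rewrite mul0r subr0; apply/ltW/Hd.
apply: le_lt_trans (normc_le_ReIm _) _; rewrite !cReD !cImD !cReN !cImN /=.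
have : `|complex.Re z - X| <= h /\ `|complex.Im z - Y| <= h.
  move: zin => /andP[]; rewrite !ler_norml.
  case: (e1); case: (e2); rewrite ?mulr1n ?mulr0n ?subr0 ?subrK => /andP[? ?] /andP[? ?];
    by split; apply/andP; split; lra.
by move=> [a b]; move: hd; lra.
Qed.

End GoursatTheorem.

(** * The Cauchy estimate and the maximum principle *)

Section CauchyEstimate.
Variable R : realType.
Implicit Types (f g F : R[i] -> R[i]) (x y r m : R) (z w s : R[i]).

Definition diffq F s (D : R[i]) z : R[i] :=
  if z == s then D else (F z - F s) / (z - s).

Lemma hol_diffq F s D z : z != s -> hol F z -> hol (diffq F s D) z.
Proof.
move=> zs hF; apply: (@hol_near R _ (fun w => (F w - F s) / (w - s)) z).
  apply/nbhs_normcP; exists (normc (z - s)).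
    by apply: normc_gt0; rewrite subr_eq0.
  move=> w wz; rewrite /diffq ifN//; apply: contraTneq wz => ->.
  by rewrite normc_distC ltxx.
have zs0 : z - s != 0 by rewrite subr_eq0.
exact: (holM (holB hF (@hol_cst R (F s) z))
  (@holV _ (fun w => w - s) z zs0 (holB (@hol_id R z) (@hol_cst R s z)))).
Qed.

Lemma continuous_diffq F s : hol F s ->
  exists D, {for s, continuous (diffq F s D)}.
Proof.
move=> /hol_linear_approx[D HD]; exists D; apply/continuous_normcP => e e0.
have e20 : 0 < e / 2 by rewrite divr_gt0.
have [d d0 Hd] := HD _ e20; exists d => // w wd.
rewrite /diffq eqxx; case: eqVneq => [_|ws]; first by rewrite subrr normc0.
have ws0 : w - s != 0 by rewrite subr_eq0.
have -> : (F w - F s) / (w - s) - D = (F w - F s - D * (w - s)) / (w - s).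
  by rewrite [in RHS]mulrBl (mulfK ws0).
rewrite normcM normcV ltr_pdivrMr ?normc_gt0//.
apply: le_lt_trans (Hd _ wd) _; rewrite ltr_pM2r ?normc_gt0//.
by rewrite ltr_pdivrMr// ltr_pMr// ltr1n.
Qed.

Lemma continuous_normc_comp f z : {for z, continuous f} ->
  forall e : R, 0 < e ->
  exists2 d : R, 0 < d & forall w, normc (w - z) < d ->
    `|normc (f w) - normc (f z)| < e.
Proof.
move=> /continuous_normcP H e /H[d d0 Hd]; exists d => // w /Hd.
exact/le_lt_trans/ler_dist_normc.
Qed.

Lemma cont_on_normc_horiz f a b y : (forall t, a <= t <= b -> hol f (t +i* y)) ->
  cont_on a b (fun t => normc (f (t +i* y))).
Proof.
by move=> H t /H /hol_continuous cf; apply: cont_normc_comp; exact: cont_horiz.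
Qed.

Lemma cont_on_normc_vert f a b x : (forall t, a <= t <= b -> hol f (x +i* t)) ->
  cont_on a b (fun t => normc (f (x +i* t))).
Proof.
by move=> H t /H /hol_continuous cf; apply: cont_normc_comp; exact: cont_vert.
Qed.

(** The contour integral of the modulus over the square of center [x + iy] and
    half side [r]. *)
Definition perim f x y r : R :=
  II (x - r) (x + r) (fun t => normc (f (t +i* (y - r))))
  + II (x - r) (x + r) (fun t => normc (f (t +i* (y + r))))
  + (II (y - r) (y + r) (fun t => normc (f ((x - r) +i* t)))
  + II (y - r) (y + r) (fun t => normc (f ((x + r) +i* t)))).

Definition in_csq x y r z :=
  (x - r <= complex.Re z <= x + r) && (y - r <= complex.Im z <= y + r).

Lemma normc_div_le (A w : R[i]) r : 0 < r -> r <= normc w ->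
  normc (A / w) <= r^-1 * normc A.
Proof.
move=> r0 rw; rewrite normcM normcV mulrC ler_wpM2r ?normc_ge0//.
by rewrite lef_pV2// posrE// (lt_le_trans r0).
Qed.

Lemma kernel_const_bound (u r m : R) : 0 < r -> `|u| <= r -> 0 <= m ->
  m / r <= 2 * (m * r / (u ^+ 2 + r ^+ 2)).
Proof.
move=> r0 ur m0.
have u2 : u ^+ 2 <= r ^+ 2 by rewrite -real_normK ?num_real// ler_pXn2r ?nnegrE// ltW.
have r2 : 0 < r ^+ 2 by rewrite exprn_gt0.
have N0 : 0 < u ^+ 2 + r ^+ 2 by rewrite ltr_wpDl// sqr_ge0.
rewrite -subr_ge0.
have -> : 2 * (m * r / (u ^+ 2 + r ^+ 2)) - m / r
        = m * (r ^+ 2 - u ^+ 2) / ((u ^+ 2 + r ^+ 2) * r).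
  by field; rewrite !gt_eqF.
by rewrite divr_ge0 ?mulr_ge0 ?subr_ge0// ltW.
Qed.

(** Pairs of opposite sides of the square of half side [r] around [s]: the
    Cauchy kernel has modulus at most [1/r], and the contribution of the
    constant [F s = - i m] has a sign on the pair, with total at least
    [m / r] by [kernel_const_bound]. *)
Lemma kernel_Re_bound (F1 F2 : R[i]) (u r m : R) : 0 < r -> `|u| <= r -> 0 <= m ->
  complex.Re ((F1 - (0 -i* m)) / (u -i* r)) - complex.Re ((F2 - (0 -i* m)) / (u +i* r))
  <= r^-1 * (normc F1 + normc F2) - m / r.
Proof.
move=> r0 ur m0; rewrite !mulrBl !cReD !cReN.
have e1 : complex.Re ((0 -i* m) / (u -i* r)) = m * r / (u ^+ 2 + r ^+ 2).
  by rewrite cReM /= sqrrN; ring.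
have e2 : complex.Re ((0 -i* m) / (u +i* r)) = - (m * r / (u ^+ 2 + r ^+ 2)).
  by rewrite cReM /=; ring.
rewrite e1 e2; have := kernel_const_bound r0 ur m0.
have rw (v : R) : `|v| = r -> r <= normc (u +i* v).
  by move=> <-; exact: le_trans (le_Im_normc (u +i* v)).
have rn : `|r| = r by rewrite gtr0_norm.
have rn' : `|- r| = r by rewrite normrN.
have := le_trans (le_Re_normc _) (normc_div_le F1 r0 (rw _ rn')).
have := le_trans (le_Re_normc _) (normc_div_le F2 r0 (rw _ rn)).
rewrite !ler_norml mulrDr => /andP[? _] /andP[_ ?]; lra.
Qed.

Lemma kernel_Im_bound (F1 F2 : R[i]) (u r m : R) : 0 < r -> `|u| <= r -> 0 <= m ->
  complex.Im ((F2 - (0 -i* m)) / ((- r) +i* u)) - complex.Im ((F1 - (0 -i* m)) / (r +i* u))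
  <= r^-1 * (normc F2 + normc F1) - m / r.
Proof.
move=> r0 ur m0; rewrite !mulrBl !cImD !cImN.
have e1 : complex.Im ((0 -i* m) / ((- r) +i* u)) = m * r / (u ^+ 2 + r ^+ 2).
  by rewrite cImM /= sqrrN [r ^+ 2 + _]addrC; ring.
have e2 : complex.Im ((0 -i* m) / (r +i* u)) = - (m * r / (u ^+ 2 + r ^+ 2)).
  by rewrite cImM /= [r ^+ 2 + _]addrC; ring.
rewrite e1 e2; have := kernel_const_bound r0 ur m0.
have rw (v : R) : `|v| = r -> r <= normc (v +i* u).
  by move=> <-; exact: le_trans (le_Re_normc (v +i* u)).
have rn : `|r| = r by rewrite gtr0_norm.
have rn' : `|- r| = r by rewrite normrN.
have := le_trans (le_Im_normc _) (normc_div_le F2 r0 (rw _ rn')).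
have := le_trans (le_Im_normc _) (normc_div_le F1 r0 (rw _ rn)).
rewrite !ler_norml mulrDr => /andP[? _] /andP[_ ?]; lra.
Qed.

(** The contour integral of the difference quotient [(F - F s) / (z - s)] is [0]
    on each quarter of the square, by [goursat_corner]; its part coming from
    [F s] is bounded below without computing the residue.  With [F s = - i m]
    that part lies in the real component of the integral. *)
Lemma cauchy_estimate_aux F x y r m : 0 < r -> 0 <= m ->
  F (x +i* y) = 0 -i* m ->
  (forall z, in_csq x y r z -> hol F z) ->
  4 * r * m <= perim F x y r.
Proof.
move=> r0 m0 Fs hF; set s := x +i* y.
have hFs : hol F s.
  by apply: hF; rewrite /in_csq/=; apply/andP; split; lra.
have [D cD] := continuous_diffq hFs.
pose G := diffq F s D.
have er c : c - r + r = c by rewrite subrK.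
have er2 c : c - r + 2 * r = c + r by ring.
have sub a b z : x - r <= a -> y - r <= b -> a + r <= x + r -> b + r <= y + r ->
    in_sq a b r z -> in_csq x y r z.
  by rewrite /in_sq /in_csq => ? ? ? ? /andP[/andP[? ?] /andP[? ?]]; lra.
have hG z : in_csq x y r z -> z != s -> hol G z.
  by move=> zin zs; exact: (@hol_diffq F s D z zs (hF z zin)).
have c0 : sq_continuous G (x - r) (y - r) (2 * r).
  move=> z; rewrite /in_sq !er2 -/(in_csq x y r z) => zin.
  have [->//|zs] := eqVneq z s.
  exact: hol_continuous (hG _ zin zs).
have corner (e1 e2 : bool) : JJ G (x - r *+ e1) (y - r *+ e2) r = 0.
  apply: (@goursat_corner R G x y e1 e2 r r0 cD) => z zin zs.
  apply: (hG z _ zs); apply: sub zin; case: e1; case: e2; rewrite ?mulr1n ?mulr0n; lra.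
have r20 : 0 <= 2 * r by rewrite mulr_ge0// ltW.
have J0 : JJ G (x - r) (y - r) (2 * r) = 0.
  rewrite (JJ_quarter r20 c0).
  have -> : 2 * r / 2 = r by rewrite mulrC mulKf.
  rewrite !er.
  have := corner true true; have := corner true false.
  have := corner false true; have := corner false false.
  by rewrite !mulr1n !mulr0n !subr0 => -> -> -> ->; rewrite !addr0.
have le2 c : c - r <= c + r by lra.
have yb : y - r <= y - r <= y - r + 2 * r by lra.
have yt : y - r <= y + r <= y - r + 2 * r by lra.
have xl : x - r <= x - r <= x - r + 2 * r by lra.
have xr : x - r <= x + r <= x - r + 2 * r by lra.
have cb := cont_on_horiz c0 yb; have ct := cont_on_horiz c0 yt.
have cl := cont_on_vert c0 xl; have cr := cont_on_vert c0 xr.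
rewrite er2 in cb ct; rewrite er2 in cl cr.
have hb : cont_on (x - r) (x + r) (fun t => normc (F (t +i* (y - r)))).
  apply: cont_on_normc_horiz => t tx; apply: hF; rewrite /in_csq/= tx; lra.
have ht : cont_on (x - r) (x + r) (fun t => normc (F (t +i* (y + r)))).
  apply: cont_on_normc_horiz => t tx; apply: hF; rewrite /in_csq/= tx; lra.
have hl : cont_on (y - r) (y + r) (fun t => normc (F ((x - r) +i* t))).
  apply: cont_on_normc_vert => t tx; apply: hF; rewrite /in_csq/= tx; lra.
have hr : cont_on (y - r) (y + r) (fun t => normc (F ((x + r) +i* t))).
  apply: cont_on_normc_vert => t tx; apply: hF; rewrite /in_csq/= tx; lra.
have B1 : II (x - r) (x + r) (fun t => complex.Re (G (t +i* (y - r)))) -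
     II (x - r) (x + r) (fun t => complex.Re (G (t +i* (y + r)))) <=
     r^-1 * (II (x - r) (x + r) (fun t => normc (F (t +i* (y - r))))
     + II (x - r) (x + r) (fun t => normc (F (t +i* (y + r))))) - 2 * m.
  rewrite -IIB// -IID// -IIZ; last exact: cont_onD.
  have -> : 2 * m = m / r * (x + r - (x - r)) by field; rewrite gt_eqF.
  rewrite -II_cst// -IIB; [|by apply: cont_onM; [exact: cont_on_cst|exact: cont_onD]|exact: cont_on_cst].
  apply: le_II; first exact: cont_onB.
    apply: cont_onB; last exact: cont_on_cst.
    by apply: cont_onM; [exact: cont_on_cst|exact: cont_onD].
  move=> t tx; rewrite /G /diffq !ifN; last 2 first.
  - by rewrite eq_complex /= negb_and orbC; apply/orP; left; apply/negP => /eqP; lra.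
  - by rewrite eq_complex /= negb_and orbC; apply/orP; left; apply/negP => /eqP; lra.
  have -> : t +i* (y - r) - s = (t - x) -i* r.
    by apply: complex_eq => //=; ring.
  have -> : t +i* (y + r) - s = (t - x) +i* r.
    by apply: complex_eq => //=; ring.
  rewrite Fs; apply: kernel_Re_bound => //.
  by rewrite ler_norml; apply/andP; split; lra.
have B2 : II (y - r) (y + r) (fun t => complex.Im (G ((x - r) +i* t))) -
     II (y - r) (y + r) (fun t => complex.Im (G ((x + r) +i* t))) <=
     r^-1 * (II (y - r) (y + r) (fun t => normc (F ((x - r) +i* t)))
     + II (y - r) (y + r) (fun t => normc (F ((x + r) +i* t)))) - 2 * m.
  rewrite -IIB// -IID// -IIZ; last exact: cont_onD.
  have -> : 2 * m = m / r * (y + r - (y - r)) by field; rewrite gt_eqF.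
  rewrite -II_cst// -IIB; [|by apply: cont_onM; [exact: cont_on_cst|exact: cont_onD]|exact: cont_on_cst].
  apply: le_II; first exact: cont_onB.
    apply: cont_onB; last exact: cont_on_cst.
    by apply: cont_onM; [exact: cont_on_cst|exact: cont_onD].
  move=> t tx; rewrite /G /diffq !ifN; last 2 first.
  - by rewrite eq_complex /= negb_and; apply/orP; left; apply/negP => /eqP; lra.
  - by rewrite eq_complex /= negb_and; apply/orP; left; apply/negP => /eqP; lra.
  have -> : (x - r) +i* t - s = (- r) +i* (t - y).
    by apply: complex_eq => //=; ring.
  have -> : (x + r) +i* t - s = r +i* (t - y).
    by apply: complex_eq => //=; ring.
  rewrite Fs; apply: kernel_Im_bound => //.
  by rewrite ler_norml; apply/andP; split; lra.
move: J0; rewrite /JJ !er2.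
move=> J0.
have : 4 * m <= r^-1 * perim F x y r by rewrite /perim mulrDr; lra.
have -> : 4 * r * m = r * (4 * m) by ring.
move=> H; by rewrite -ler_pdivlMl.
Qed.

(** A weak mean value inequality, with the factor 2 lost over harmonic measure;
    the constant is removed later by applying it to powers. *)
Lemma cauchy_estimate f x y r : 0 < r ->
  (forall z, in_csq x y r z -> hol f z) ->
  4 * r * normc (f (x +i* y)) <= perim f x y r.
Proof.
move=> r0 hf; have [f0|f0] := eqVneq (f (x +i* y)) 0.
  rewrite f0 normc0 mulr0 /perim; do 3?apply: addr_ge0; apply: II_ge0 => t _;
    exact: normc_ge0.
set w := f (x +i* y) in f0 *; set m := normc w.
have m0 : 0 < m := normc_gt0 f0.
have wm : w / m%:C != 0.
  by rewrite mulf_neq0// invr_eq0; apply/eqP => -[/eqP]; rewrite gt_eqF.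
pose k : R[i] := (0 -i* 1) / (w / m%:C).
have nk : normc k = 1.
  rewrite !normcM !normcV normcM normcV normcR gtr0_norm// mulfV ?gt_eqF//.
  by rewrite invr1 mulr1 /= expr0n/= add0r sqrrN expr1n sqrtr1.
have kw : k * w = 0 -i* m.
  rewrite /k invf_div mulrA (divfK f0).
  by apply: complex_eq; rewrite ?cReM ?cImM /=; ring.
have -> : perim f x y r = perim (fun z => k * f z) x y r.
  by rewrite /perim; do !congr (_ + _); apply: eq_II => t _;
    rewrite normcM nk mul1r.
apply: (cauchy_estimate_aux r0 (ltW m0) kw) => z /hf hz.
exact: (holM (@hol_cst R k z) hz).
Qed.

End CauchyEstimate.

Section MaximumPrinciple.
Variable R : realType.
Implicit Types (f G F : R[i] -> R[i]) (x y r m : R) (z w s : R[i]).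

Lemma le_of_pow_le2 (a b : R) : 0 <= a -> 0 <= b ->
  (forall n, a ^+ n <= 2 * b ^+ n) -> a <= b.
Proof.
move=> a0 b0 H; rewrite leNgt; apply/negP => ba.
have [b00|bpos] := eqVneq b 0.
  by have := H 1%N; rewrite !expr1 b00 mulr0; lra.
have {}b0 : 0 < b by rewrite lt_neqAle eq_sym bpos.
have c1 : 0 < a / b - 1 by rewrite subr_gt0 ltr_pdivlMr// mul1r.
have bern (n : nat) : 1 + n%:R * (a / b - 1) <= (a / b) ^+ n.
  elim: n => [|n IH]; first by rewrite mul0r addr0 expr0.
  rewrite exprS; have ab0 : 0 <= a / b by rewrite divr_ge0// ltW.
  apply: le_trans (ler_wpM2l ab0 IH).
  rewrite -subr_ge0 -natr1.
  have -> : a / b * (1 + n%:R * (a / b - 1)) - (1 + (n%:R + 1) * (a / b - 1))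
     = n%:R * (a / b - 1) ^+ 2 by ring.
  by rewrite mulr_ge0 ?sqr_ge0.
have [n Hn] : exists n : nat, 2 < n%:R * (a / b - 1).
  exists (Num.Def.archi_bound (2 / (a / b - 1))).
  rewrite -ltr_pdivrMr//; apply: archi_boundP.
  by rewrite divr_ge0// ltW.
have := bern n; have := H n.
rewrite -ler_pdivrMr ?exprn_gt0// -expr_div_n; lra.
Qed.

Definition on_csq_boundary x y r z := in_csq x y r z &&
  ((`|complex.Re z - x| == r) || (`|complex.Im z - y| == r)).

Lemma perim_le f x y r m : 0 < r ->
  (forall z, in_csq x y r z -> hol f z) ->
  (forall z, on_csq_boundary x y r z -> normc (f z) <= m) ->
  perim f x y r <= 8 * r * m.
Proof.
move=> r0 hf H.
have rn : `|r| = r by rewrite gtr0_norm.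
have side (a b : R) (phi : R -> R) : b - a = 2 * r -> a <= b ->
    cont_on a b phi -> (forall t, a <= t <= b -> phi t <= m) ->
    II a b phi <= 2 * r * m.
  move=> hab ab cphi hphi; rewrite -hab mulrC -(II_cst m ab).
  by apply: le_II => //; exact: cont_on_cst.
have l c : c + r - (c - r) = 2 * r by ring.
have lc c : c - r <= c + r by lra.
have -> : 8 * r * m = 2 * r * m + 2 * r * m + (2 * r * m + 2 * r * m) by ring.
rewrite /perim; apply: lerD; apply: lerD; apply: side => //.
- by apply: cont_on_normc_horiz => t tx; apply: hf; rewrite /in_csq/= tx; lra.
- move=> t tx; apply: H; rewrite /on_csq_boundary /in_csq/= tx/=.
  by rewrite addrAC subrr add0r normrN rn eqxx orbT andbT; lra.
- by apply: cont_on_normc_horiz => t tx; apply: hf; rewrite /in_csq/= tx; lra.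
- move=> t tx; apply: H; rewrite /on_csq_boundary /in_csq/= tx/=.
  by rewrite addrAC subrr add0r rn eqxx orbT andbT; lra.
- by apply: cont_on_normc_vert => t tx; apply: hf; rewrite /in_csq/= tx; lra.
- move=> t tx; apply: H; rewrite /on_csq_boundary /in_csq/= tx/=.
  by rewrite addrAC subrr add0r normrN rn eqxx !andbT; lra.
- by apply: cont_on_normc_vert => t tx; apply: hf; rewrite /in_csq/= tx; lra.
- move=> t tx; apply: H; rewrite /on_csq_boundary /in_csq/= tx/=.
  by rewrite addrAC subrr add0r rn eqxx !andbT; lra.
Qed.

(** Landau's trick: the constant in the Cauchy estimate disappears when the
    estimate is applied to the powers of [f]. *)
Lemma max_modulus_square f x y r m : 0 < r -> 0 <= m ->
  (forall z, in_csq x y r z -> hol f z) ->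
  (forall z, on_csq_boundary x y r z -> normc (f z) <= m) ->
  normc (f (x +i* y)) <= m.
Proof.
move=> r0 m0 hf H; apply: le_of_pow_le2 => // [|n]; first exact: normc_ge0.
have hfn z : in_csq x y r z -> hol (fun z => f z ^+ n) z.
  by move=> /hf hz; exact: (@holX R f n z hz).
have r40 : 0 < 4 * r by rewrite mulr_gt0.
rewrite -(ler_pM2l r40) -normcX.
apply: le_trans (cauchy_estimate r0 hfn) _.
have -> : 4 * r * (2 * m ^+ n) = 8 * r * m ^+ n by ring.
apply: (perim_le r0 hfn) => z zb; rewrite normcX.
by rewrite lerXn2r ?nnegrE ?normc_ge0// H.
Qed.

(** A large constant turns a real part into a modulus:
    [|M + F|] is about [M + Re F]. *)
Lemma strict_max_contra F x y r (k : R) : 0 < r -> 0 < k ->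
  (forall z, in_csq x y r z -> hol F z) ->
  F (x +i* y) = 0 ->
  (forall z, on_csq_boundary x y r z -> normc (F z) <= 1) ->
  (forall z, on_csq_boundary x y r z -> complex.Re (F z) <= - k) -> False.
Proof.
move=> r0 k0 hF F0 H1 H2.
pose M := 1 + k^-1.
have M1 : 1 <= M by rewrite lerDl invr_ge0 ltW.
have M0 : 0 <= M by lra.
have m0 : 0 <= M ^+ 2 - 1 by rewrite subr_ge0 exprn_ege1.
have hg z : in_csq x y r z -> hol (fun z => M%:C + F z) z.
  by move=> /hF hz; exact: (holD (@hol_cst R M%:C z) hz).
have := @max_modulus_square _ x y r (Num.sqrt (M ^+ 2 - 1)) r0 (sqrtr_ge0 _) hg.
rewrite F0 addr0 normcR (ger0_norm M0) => h.
have {}h : M <= Num.sqrt (M ^+ 2 - 1).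
  apply: h => z zb; rewrite -(@ler_pXn2r _ 2) ?nnegrE ?normc_ge0 ?sqrtr_ge0//.
  rewrite sqr_sqrtr// normc_sqrE !cReD !cImD /= add0r.
  have n1 : normc (F z) ^+ 2 <= 1 by rewrite expr_le1 ?normc_ge0 ?H1.
  have h2 := H2 _ zb.
  rewrite normc_sqrE in n1.
  have : 2 * M * (complex.Re (F z) + k) <= 0.
    by rewrite mulr_ge0_le0 ?mulr_ge0//; lra.
  have Mk : M * k = k + 1 by rewrite /M mulrDl mul1r mulVf ?gt_eqF.
  have -> : 2 * M * (complex.Re (F z) + k) = 2 * M * complex.Re (F z) + 2 * (M * k) by ring.
  rewrite Mk => h3.
  move: n1 h3 k0; move: (complex.Re (F z)) (complex.Im (F z)) => u v.
  have -> : (M + u) ^+ 2 + v ^+ 2 = M ^+ 2 + 2 * M * u + (u ^+ 2 + v ^+ 2) by ring.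
  move: (2 * M * u : R) (u ^+ 2 : R) (v ^+ 2 : R) (M ^+ 2 : R) => A B C D.
  lra.
move: h; rewrite -(@ler_pXn2r _ 2) ?nnegrE ?sqrtr_ge0// sqr_sqrtr//; lra.
Qed.

(** The Taylor polynomial of [log (1 + z)], obtained from [ln |1 + z|^2] so that
    no branch of the complex logarithm is involved. *)
Lemma ln_normc_ge z : normc z <= 8^-1 ->
  complex.Re (z - z ^+ 2 / 2) - 16 * normc z ^+ 3 <= ln (normc (1 + z)).
Proof.
move=> z8; have n0 := normc_ge0 z.
have := normc_sqrE z; have := le_Re_normc z.
have -> : complex.Re (z - z ^+ 2 / 2) = complex.Re z
    - (complex.Re z ^+ 2 - complex.Im z ^+ 2) / 2.
  by case: z {z8 n0} => a b; rewrite /= ; field.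
have sq1 : normc (1 + z) ^+ 2 = 1 + (2 * complex.Re z + normc z ^+ 2).
  by rewrite !normc_sqrE !cReD !cImD /=; ring.
have np : 0 < normc (1 + z).
  apply: lt_le_trans (le_Re_normc _); rewrite cReD /= normr_gt0.
  have := le_trans (le_Re_normc z) z8; rewrite ler_norml => /andP[? _]; lra.
have -> : ln (normc (1 + z)) = ln (1 + (2 * complex.Re z + normc z ^+ 2)) / 2.
  by rewrite -sq1 lnXn// mulr2n; lra.
move: (complex.Re z) (complex.Im z) (normc z) z8 n0 => a b n n8 n0 an nE.
have n3 : 0 <= n ^+ 3 by rewrite exprn_ge0.
have n2 : n ^+ 2 <= n / 8 by rewrite expr2 ler_wpM2l.
have X3 : `|2 * a + n ^+ 2| <= 3 * n.
  move: an; rewrite !ler_norml => /andP[? ?]; have := sqr_ge0 n.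
  by move=> ?; apply/andP; split; lra.
have X12 : `|2 * a + n ^+ 2| <= 2^-1 by lra.
have := ln_taylor X12; rewrite ler_norml => /andP[h _].
have X27 : `|2 * a + n ^+ 2| ^+ 3 <= 27 * n ^+ 3.
  have -> : 27 * n ^+ 3 = (3 * n) ^+ 3 by ring.
  by rewrite lerXn2r// nnegrE mulr_ge0.
have an3 : a * n ^+ 2 <= n ^+ 3.
  rewrite exprS ler_wpM2r ?sqr_ge0//.
  by apply: le_trans an; exact: ler_norm.
have n4 : n ^+ 4 <= n ^+ 3 / 8 by rewrite exprSr ler_wpM2l.
have e : (2 * a + n ^+ 2) - (2 * a + n ^+ 2) ^+ 2 / 2
  = 2 * a + n ^+ 2 - 2 * a ^+ 2 - 2 * (a * n ^+ 2) - n ^+ 4 / 2 by field.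
rewrite e in h.
move: h X27 an3 n4 n3 nE.
move: (ln _) (`|2 * a + _| ^+ 3 : R) => l Y.
move: (n ^+ 3 : R) (n ^+ 4 : R) (a * n ^+ 2 : R) (a ^+ 2 : R) (b ^+ 2 : R) => n3 n4 P A B.
move: (n ^+ 2 : R) => N2.
lra.
Qed.

Definition in_rect (a b c d : R) z :=
  (a <= complex.Re z <= b) && (c <= complex.Im z <= d).

Lemma compact_rect (a b c d : R) :
  compact ([set z | in_rect a b c d z] : set R[i]).
Proof.
have -> : [set z | in_rect a b c d z] =
    (fun p : R * R => p.1 +i* p.2) @` (`[a, b] `*` `[c, d]).
  apply/seteqP; split => [z /= /andP[h1 h2]|_ [[u v] /= [h1 h2] <-]].
    exists (complex.Re z, complex.Im z); last by case: z {h1 h2}.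
    by split; rewrite /= in_itv.
  by move: h1 h2; rewrite /in_rect /= !in_itv/= => -> ->.
apply: continuous_compact; last by apply: compact_setX; exact: segment_compact.
apply: continuous_subspaceT => -[u v] A /nbhs_normcP[e e0 eA].
have e2 : 0 < e / 2 by rewrite divr_gt0.
apply/nbhs_ballP; exists (e / 2) => // -[u' v'] [/= hu hv]; apply: eA.
apply: le_lt_trans (normc_le_ReIm _) _; rewrite !cReD !cImD !cReN !cImN /=.
move: hu hv; rewrite /ball/= distrC => hu; rewrite distrC => hv.
by rewrite (splitr e) ltrD.
Qed.

Lemma normc_addR2 z w : normc (z + w) ^+ 2 =
  normc z ^+ 2 + complex.Re (2%:R * (z^*)%C * w) + normc w ^+ 2.
Proof.
rewrite !normc_sqrE; case: z => a b; case: w => c d /=; ring.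
Qed.

(** The local form of the subharmonicity of [|f|^q]: near a point where [f] does
    not vanish, [|f|^q] is at least the real part of a holomorphic function, up
    to a cubic error absorbed by the strictly subharmonic term in [eta]. *)
Lemma no_local_max f G (q eta rho : R) s0 s1
    (v := fun z => normc (f z) `^ q - complex.Re (G z) + eta * normc (z - s1) ^+ 2) :
  0 < q -> 0 < eta -> 0 < rho -> f s0 != 0 ->
  (forall z, normc (z - s0) < rho -> hol f z) ->
  (forall z, normc (z - s0) < rho -> hol G z) ->
  (forall z, normc (z - s0) < rho -> v z <= v s0) -> False.
Proof.
move=> q0 eta0 rho0 fs0 hf hG hv.
have in0 : normc (s0 - s0) < rho by rewrite subrr normc0.
pose c0 := normc (f s0) `^ q.
have c00 : 0 < c0 by rewrite powR_gt0// normc_gt0.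
(* [|f|^q = c0 |1 + zeta|^q >= c0 (1 + q ln |1 + zeta|)]. *)
pose zeta z := (f z - f s0) * (f s0)^-1.
have hzeta z : normc (z - s0) < rho -> hol zeta z.
  move=> /hf hz; exact: (holM (holB hz (@hol_cst R (f s0) z)) (@hol_cst R _ z)).
have zeta0 : zeta s0 = 0 by rewrite /zeta subrr mul0r.
(* [eta |z - s1|^2] is [eta |z - s0|^2] plus a constant and the real part of an
   affine function of slope [kc]. *)
pose kc : R[i] := (eta%:C * (2%:R * ((s0 - s1)^*)%C)).
pose F z := c0%:C * (q%:C * (zeta z - zeta z ^+ 2 * 2^-1)) - (G z - G s0)
            + kc * (z - s0).
have F0 : F s0 = 0 by rewrite /F zeta0 !subrr expr0n /= !(mul0r,mulr0,subr0,addr0).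
have hF z : normc (z - s0) < rho -> hol F z.
  move=> zr; have hz := hzeta z zr.
  have h1 := holB hz (holM (@holX R zeta 2 z hz) (@hol_cst R 2^-1 z)).
  have h2 := holM (@hol_cst R c0%:C z) (holM (@hol_cst R q%:C z) h1).
  have h3 := holB (hG z zr) (@hol_cst R (G s0) z).
  have h4 := holM (@hol_cst R kc z) (holB (@hol_id R z) (@hol_cst R s0 z)).
  exact: (holD (holB h2 h3) h4).
have /hol_continuous/continuous_normcP/(_ 1 ltr01)[d1 d10 Hd1] := hF s0 in0.
have [D /(_ 1 ltr01)[d2 d20 Hd2]] := hol_linear_approx (hzeta s0 in0).
pose L := normc D + 1.
have L1 : 1 <= L by rewrite lerDr normc_ge0.
have L0 : 0 < L by lra.
have HL z : normc (z - s0) < d2 -> normc (zeta z) <= L * normc (z - s0).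
  move=> /Hd2; rewrite zeta0 subr0 mul1r => h.
  have -> : zeta z = (zeta z - D * (z - s0)) + D * (z - s0) by rewrite subrK.
  apply: le_trans (le_normcD _ _) _; rewrite normcM /L mulrDl mul1r addrC.
  by rewrite lerD2l.
pose K := 32 * (c0 * q * L ^+ 3).
have K0 : 0 < K by rewrite !mulr_gt0// exprn_gt0.
pose dl := Num.min (Num.min rho d1) (Num.min d2 (Num.min ((8 * L)^-1) (eta / K))).
have dl0 : 0 < dl.
  by rewrite /dl !lt_min rho0 d10 d20 invr_gt0 mulr_gt0//= divr_gt0.
have key z : normc (z - s0) < dl ->
    complex.Re (F z) <= - (eta / 2 * normc (z - s0) ^+ 2).
  rewrite /dl !lt_min => /andP[/andP[zr zd1] /andP[zd2 /andP[z8 zK]]].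
  have := hv z zr; rewrite /v.
  set n := normc (z - s0) in zr zd1 zd2 z8 zK *.
  have n0 : 0 <= n by exact: normc_ge0.
  have zL := HL z zd2; rewrite -/n in zL.
  have zl8 : normc (zeta z) <= 8^-1.
    apply: le_trans zL _; rewrite mulrC -ler_pdivlMr//.
    by rewrite -invfM; exact: ltW.
  have := ln_normc_ge zl8; set l := ln _ => hl.
  have e1 : f z = f s0 * (1 + zeta z).
    by rewrite /zeta mulrDr mulr1 mulrCA mulfV// mulr1 addrC subrK.
  have pos : 0 < normc (1 + zeta z).
    apply: lt_le_trans (le_Re_normc _); rewrite cReD /= normr_gt0.
    have := le_trans (le_Re_normc _) zl8; rewrite ler_norml => /andP[? _]; lra.
  have e2 : c0 * (1 + q * l) <= normc (f z) `^ q.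
    rewrite e1 normcM powRM ?normc_ge0// ler_pM2l//.
    by rewrite /powR gt_eqF// expR_ge1Dx.
  have e3 : normc (z - s1) ^+ 2 = normc (s0 - s1) ^+ 2
      + complex.Re (2%:R * ((s0 - s1)^*)%C * (z - s0)) + n ^+ 2.
    by rewrite -normc_addR2; congr (normc _ ^+ 2); ring.
  have e4 : complex.Re (F z) = c0 * (q * complex.Re (zeta z - zeta z ^+ 2 / 2))
     - complex.Re (G z) + complex.Re (G s0)
     + eta * complex.Re (2%:R * ((s0 - s1)^*)%C * (z - s0)).
    have ReZ (t : R) w : complex.Re (t%:C * w) = t * complex.Re w.
      by rewrite cReM /= mul0r subr0.
    by rewrite /F /kc !cReD !cReN !cReD !cReN -!mulrA !ReZ mulrA opprB; ring.
  rewrite e3 -/c0 => hvz.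
  have z3 : normc (zeta z) ^+ 3 <= L ^+ 3 * n ^+ 3.
    by rewrite -exprMn lerXn2r// nnegrE ?normc_ge0// mulr_ge0// ltW.
  have z4 : 16 * (c0 * q * (L ^+ 3 * n ^+ 3)) <= eta / 2 * n ^+ 2.
    have -> : 16 * (c0 * q * (L ^+ 3 * n ^+ 3)) = (K * n) / 2 * n ^+ 2.
      by rewrite /K; field.
    rewrite ler_wpM2r ?sqr_ge0// ler_pM2r//.
    by rewrite mulrC -ler_pdivlMr// ltW.
  have cq0 : 0 < c0 * q by rewrite mulr_gt0.
  have z5 : c0 * q * (complex.Re (zeta z - zeta z ^+ 2 / 2) - 16 * (L ^+ 3 * n ^+ 3))
      <= c0 * q * l.
    rewrite ler_pM2l//; apply: le_trans hl; lra.
  rewrite e4; move: hvz e2 z4 z5.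
  move: (complex.Re (zeta z - _)) (complex.Re (2%:R * _ * _)) => A B.
  move: (normc (s0 - s1) ^+ 2 : R) (n ^+ 2 : R) (L ^+ 3 * n ^+ 3 : R) => C N2 E.
  move: (normc (f z) `^ q : R) (complex.Re (G z)) (complex.Re (G s0)) => V g1 g0.
  clear; move: c0 eta => c e; lra.
pose r := dl / 4.
have r0 : 0 < r by rewrite divr_gt0.
have sub z : in_csq (complex.Re s0) (complex.Im s0) r z -> normc (z - s0) < dl.
  move=> /andP[/andP[? ?] /andP[? ?]].
  apply: le_lt_trans (normc_le_ReIm _) _; rewrite !cReD !cImD !cReN !cImN /=.
  have : `|complex.Re z - complex.Re s0| <= r by rewrite ler_norml; apply/andP; split; lra.
  have : `|complex.Im z - complex.Im s0| <= r by rewrite ler_norml; apply/andP; split; lra.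
  rewrite /r; lra.
have s0E : complex.Re s0 +i* complex.Im s0 = s0 by case: (s0).
have k0 : 0 < eta / 2 * r ^+ 2 by rewrite mulr_gt0 ?divr_gt0// exprn_gt0.
apply: (@strict_max_contra F (complex.Re s0) (complex.Im s0) r _ r0 k0).
- by move=> z /sub zd; apply: hF; apply: lt_le_trans zd _; rewrite /dl !ge_min lexx.
- by rewrite s0E.
- move=> z /andP[/sub zd _]; apply/ltW; have := Hd1 z; rewrite F0 subr0; apply.
  by apply: lt_le_trans zd _; rewrite /dl !ge_min lexx !orbT.
- move=> z /andP[/sub zd bd]; apply: le_trans (key z zd) _.
  rewrite lerN2 ler_pM2l ?divr_gt0// lerXn2r// ?nnegrE ?normc_ge0// ?(ltW r0)//.
  move: bd => /orP[] /eqP e.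
    by have := le_Re_normc (z - s0); rewrite cReD cReN e.
  by have := le_Im_normc (z - s0); rewrite cImD cImN e.
Qed.

Lemma powR_nneg_continuous (q x e : R) : 0 < q -> 0 <= x -> 0 < e ->
  exists2 d : R, 0 < d &
    forall y, 0 <= y -> `|y - x| < d -> `|y `^ q - x `^ q| < e.
Proof.
move=> q0; rewrite le_eqVlt => /predU1P[<- e0|x0 e0].
  exists (e `^ q^-1); first by rewrite powR_gt0.
  move=> y y0; rewrite subr0 ger0_norm// powR0 ?gt_eqF// subr0 => ye.
  rewrite ger0_norm ?powR_ge0//.
  have -> : e = (e `^ q^-1) `^ q by rewrite -powRrM mulVf ?gt_eqF// powRr1// ltW.
  by apply: gt0_ltr_powR; rewrite ?nnegrE ?powR_ge0.
have c : {for x, continuous (fun y : R => y `^ q)}.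
  apply: differentiable_continuous; apply/derivable1_diffP.
  by apply: derivable_powR; rewrite in_itv/= andbT.
have := c (fun t => `|t - x `^ q| < e).
have hb : nbhs (x `^ q) (fun t => `|t - x `^ q| < e).
  by apply/nbhs_ballP; exists e => //= t; rewrite /ball/= distrC.
move=> /(_ hb) /nbhs_ballP[d /= d0 Hd]; exists d => // y _ yd.
by apply: Hd; rewrite /ball/= distrC.
Qed.

Lemma continuous_normc_powR f (q : R) z : 0 < q -> {for z, continuous f} ->
  {for z, continuous (fun w => normc (f w) `^ q)}.
Proof.
move=> q0 /continuous_normc_comp cf; apply/continuousCR_normcP => e e0.
have [d d0 Hd] := powR_nneg_continuous q0 (normc_ge0 (f z)) e0.
have [d' d'0 Hd'] := cf _ d0; exists d' => // w /Hd' wd.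
exact: Hd (normc_ge0 _) wd.
Qed.

(** The maximum principle for the subharmonic function [|f|^q - Re G].  The
    term [eta |z - s1|^2] makes it strictly subharmonic without creating an
    interior maximum out of the boundary values. *)
Theorem max_principle f G (q a b c d : R) : 0 < q ->
  (forall z, in_rect a b c d z -> hol f z) ->
  (forall z, in_rect a b c d z -> hol G z) ->
  (forall z, in_rect a b c d z -> 0 <= complex.Re (G z)) ->
  (forall z, in_rect a b c d z ->
     [|| complex.Re z == a, complex.Re z == b, complex.Im z == c
       | complex.Im z == d] -> normc (f z) `^ q <= complex.Re (G z)) ->
  forall z, in_rect a b c d z -> normc (f z) `^ q <= complex.Re (G z).
Proof.
move=> q0 hf hG G0 hbd s1 s1in; rewrite leNgt; apply/negP => lt1.
have hin := s1in; move: hin => /andP[/andP[a1 b1] /andP[c1 d1]].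
pose Dm := (b - a) + (d - c).
have Dm0 : 0 <= Dm by rewrite /Dm; lra.
have diam z : in_rect a b c d z -> normc (z - s1) <= Dm.
  move=> /andP[/andP[? ?] /andP[? ?]].
  apply: le_trans (normc_le_ReIm _) _; rewrite !cReD !cImD !cReN !cImN.
  by apply: lerD; rewrite ler_norml; apply/andP; split; lra.
pose gap := normc (f s1) `^ q - complex.Re (G s1).
have gap0 : 0 < gap by rewrite subr_gt0.
pose eta := gap / (2 * (Dm ^+ 2 + 1)).
have D1 : 0 < Dm ^+ 2 + 1 by rewrite ltr_wpDl// sqr_ge0.
have eta0 : 0 < eta by rewrite divr_gt0// mulr_gt0.
have etaD z : in_rect a b c d z -> eta * normc (z - s1) ^+ 2 < gap.
  move=> zin; apply: (@le_lt_trans _ _ (eta * Dm ^+ 2)).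
    by rewrite ler_pM2l// lerXn2r ?nnegrE ?normc_ge0// diam.
  have -> : gap = eta * (2 * (Dm ^+ 2 + 1)) by rewrite divfK// gt_eqF// mulr_gt0.
  by rewrite ltr_pM2l//; have := sqr_ge0 Dm; lra.
pose v z := normc (f z) `^ q - complex.Re (G z) + eta * normc (z - s1) ^+ 2.
have vs1 : v s1 = gap by rewrite /v subrr normc0 expr0n mulr0 addr0.
have cv : {within [set z | in_rect a b c d z], continuous v}.
  apply: continuous_in_subspaceT => z; rewrite inE => zin.
  apply/continuousCR_normcP => e e0.
  have e3 : 0 < e / 3 by rewrite divr_gt0.
  have /continuousCR_normcP/(_ _ e3)[d2 d20 H1] :=
    continuous_normc_powR q0 (hol_continuous (hf z zin)).
  have /continuous_normcP/(_ _ e3)[d3 d30 H2] := hol_continuous (hG z zin).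
  have hsq : {for z, continuous (fun w => eta * normc (w - s1) ^+ 2)}.
    have -> : (fun w => eta * normc (w - s1) ^+ 2)
            = (fun w => normc (eta%:C * (w - s1) ^+ 2)).
      by apply/funext => w; rewrite normcM normcR gtr0_norm// normcX.
    apply/continuousCR_normcP; apply: continuous_normc_comp.
    have h := holB (@hol_id R z) (@hol_cst R s1 z).
    exact: (hol_continuous (holM (@hol_cst R eta%:C z) (@holX R _ 2 z h))).
  have /continuousCR_normcP/(_ _ e3)[d4 d40 H3] := hsq.
  exists (Num.min d2 (Num.min d3 d4)); first by rewrite !lt_min d20 d30 d40.
  move=> w; rewrite !lt_min => /and3P[w2 w3 w4].
  have {H1} := H1 w w2; have {H3} := H3 w w4.
  have {H2} := le_lt_trans (le_Re_normc _) (H2 w w3); rewrite cReD cReN /v.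
  rewrite !ltr_norml => /andP[? ?] /andP[? ?] /andP[? ?].
  by apply/andP; split; lra.
have ne : [set z | in_rect a b c d z] !=set0 by exists s1.
have [s0] := compact_EVT_max ne (@compact_rect a b c d) cv.
rewrite inE => s0in vmax.
(* The quadratic term stays below the gap, so that at the maximum [s0] still
   [|f|^q > Re G >= 0]: [s0] is an interior point where [f] does not vanish. *)
have v0 : gap <= v s0 by rewrite -vs1; apply: vmax; rewrite inE.
have f0 : complex.Re (G s0) < normc (f s0) `^ q.
  by have := etaD _ s0in; move: v0; rewrite /v; lra.
have fs0 : f s0 != 0.
  apply: contraTneq f0 => ->; rewrite normc0 powR0 ?gt_eqF// -leNgt.
  exact: G0.
have int : [&& a < complex.Re s0, complex.Re s0 < b, c < complex.Im s0
            & complex.Im s0 < d].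
  apply/negPn/negP => bd; move: f0; rewrite ltNge => /negP; apply.
  apply: hbd => //; move: bd s0in; rewrite /in_rect !negb_and -!leNgt.
  by move=> + /andP[/andP[? ?] /andP[? ?]]; rewrite !eq_le; lra.
have {int} [rho rho0 Hrho] : exists2 rho, 0 < rho & forall z, normc (z - s0) < rho ->
    in_rect a b c d z.
  move: int => /and4P[h1 h2 h3 h4].
  pose rho := Num.min (Num.min (complex.Re s0 - a) (b - complex.Re s0))
                      (Num.min (complex.Im s0 - c) (d - complex.Im s0)).
  exists rho; first by rewrite /rho !lt_min !subr_gt0 h1 h2 h3 h4.
  move=> z; rewrite /rho !lt_min => /andP[/andP[k1 k2] /andP[k3 k4]].
  have := le_Re_normc (z - s0); have := le_Im_normc (z - s0).
  rewrite !cReD !cImD !cReN !cImN !ler_norml /in_rect => /andP[? ?] /andP[? ?].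
  by lra.
apply: (@no_local_max f G q eta rho s0 s1 q0 eta0 rho0 fs0).
- by move=> z /Hrho; exact: hf.
- by move=> z /Hrho; exact: hG.
- by move=> z /Hrho zin; apply: vmax; rewrite inE.
Qed.

End MaximumPrinciple.

(** * From line integrals to area integrals *)

Section SegmentSubstitution.
Variable R : realType.
Local Notation mu := (@lebesgue_measure R).
Implicit Types (phi : R -> R) (a b c : R).

Lemma II_fin a b phi : cont_on a b phi ->
  (\int[mu]_(t in `[a, b]) (phi t)%:E)%E = (II a b phi)%:E.
Proof.
move=> cphi; rewrite /II /Rintegral fineK//.
by apply: integrable_fin_num => //; exact: cont_on_integrable.
Qed.

Lemma cont_on_within a b phi : cont_on a b phi -> {within `[a, b], continuous phi}.
Proof.
move=> H; apply: continuous_in_subspaceT => x; rewrite inE/= in_itv/= => xab.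
exact: H.
Qed.

Lemma II_shift a b c phi : a <= b -> cont_on (c + a) (c + b) phi ->
  II a b (fun t => phi (c + t)) = II (c + a) (c + b) phi.
Proof.
move=> ab cphi; apply/EFin_inj.
rewrite -II_fin; last first.
  move=> t tab; apply: (@continuous_comp _ _ _ (fun t => c + t) phi).
    by apply: continuousD; [exact: cst_continuous|exact: cvg_id].
  by apply: cphi; rewrite !lerD2l.
rewrite -II_fin//.
have d1 (t : R) : is_derive t 1 (fun t : R => c + t) (0 + 1).
  exact: (@is_deriveD _ R R (cst c) id t 1 0 1 _ _).
have dF : derive1 (fun t : R => c + t) = cst 1.
  by apply/funext => t; rewrite derive1E; have [_ ->] := d1 t; rewrite add0r.
rewrite (@integration_by_substitution_increasing R (fun t => c + t) phi a b ab).
- by apply: eq_integral => t _; rewrite !fctE dF /= mulr1.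
- by move=> x y _ _ xy; rewrite ltrD2l.
- by rewrite dF => ? _; exact: cvg_cst.
- by rewrite dF; exact: is_cvg_cst.
- by rewrite dF; exact: is_cvg_cst.
- have cc (x : R) : {for x, continuous (fun t : R => c + t)}.
    by apply: continuousD; [exact: cst_continuous|exact: cvg_id].
  split.
  + by move=> t _; exact: (@ex_derive _ _ _ _ _ _ _ (d1 t)).
  + exact/cvg_at_right_filter/cc.
  + exact/cvg_at_left_filter/cc.
- exact: cont_on_within.
Qed.

Lemma II_reflect a b phi : a <= b -> cont_on (- b) (- a) phi ->
  II a b (fun t => phi (- t)) = II (- b) (- a) phi.
Proof.
move=> ab cphi; apply/EFin_inj.
rewrite -II_fin; last first.
  move=> t tab; apply: (@continuous_comp _ _ _ (fun t => - t) phi).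
    by apply: continuousN; exact: cvg_id.
  by apply: cphi; rewrite !lerN2 andbC.
rewrite -II_fin// integration_by_substitution_oppr//.
exact: cont_on_within.
Qed.

Lemma II_sub a b a' b' phi : a <= a' -> a' <= b' -> b' <= b -> cont_on a b phi ->
  (forall t, a <= t <= b -> 0 <= phi t) -> II a' b' phi <= II a b phi.
Proof.
move=> aa' ab' bb' cphi phi0.
rewrite (@II_split R a a' b)//; last exact: le_trans bb'.
rewrite (@II_split R a' b' b)//; last by apply: cont_onS cphi.
have h1 : 0 <= II a a' phi.
  by apply: II_ge0 => t /andP[? ?]; apply: phi0; lra.
have h2 : 0 <= II b' b phi.
  by apply: II_ge0 => t /andP[? ?]; apply: phi0; lra.
lra.
Qed.

(** The two translates of an interval of radii [[rho/2, rho]] lie in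
    [[c - rho, c + rho]]. *)
Lemma II_radius_le (c rho : R) phi : 0 <= rho ->
  cont_on (c - rho) (c + rho) phi ->
  (forall t, c - rho <= t <= c + rho -> 0 <= phi t) ->
  II (rho / 2) rho (fun r => phi (c + r)) <= II (c - rho) (c + rho) phi /\
  II (rho / 2) rho (fun r => phi (c - r)) <= II (c - rho) (c + rho) phi.
Proof.
move=> rho0 cphi phi0; split.
  rewrite II_shift; [|lra|by apply: cont_onS cphi; lra].
  by apply: II_sub => //; lra.
have -> : (fun r => phi (c - r)) = (fun r => (fun t => phi (c + t)) (- r)) by [].
have cs : cont_on (- rho) (- (rho / 2)) (fun t => phi (c + t)).
  move=> t tab; apply: (@continuous_comp _ _ _ (fun t => c + t) phi).
    by apply: continuousD; [exact: cst_continuous|exact: cvg_id].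
  by apply: cphi; lra.
rewrite (@II_reflect (rho / 2) rho (fun t => phi (c + t))) //; last lra.
rewrite II_shift; [|lra|by apply: cont_onS cphi; lra].
by apply: II_sub => //; lra.
Qed.

End SegmentSubstitution.

Section Tonelli.
Variable R : realType.
Local Notation mu := (@lebesgue_measure R).

Let step (a b : R) (n i : nat) : R := a + (b - a) * i%:R / n.+1%:R.

(** A function measurable in one variable and continuous in the other is a
    pointwise limit of functions that are locally constant in the latter. *)
Lemma measurable_separately (k : R -> R -> R) (a b : R) : a < b ->
  (forall x, a <= x <= b -> measurable_fun setT (k x)) ->
  (forall x y, a <= x <= b -> {for x, continuous (k ^~ y)}) ->
  measurable_fun setT (fun z : R * R => \1_(`[a, b] : set R) z.1 * k z.1 z.2).
Proof.
move=> ab mk ck.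
pose K n (z : R * R) : R := \sum_(i < n.+1)
   \1_(`[step a b n i, step a b n i.+1[ : set R) z.1 * k (step a b n i) z.2.
have ba0 : 0 < b - a by rewrite subr_gt0.
have stepP n i : (i <= n.+1)%N -> a <= step a b n i <= b.
  move=> ilt; rewrite /step; apply/andP; split.
    by rewrite lerDl divr_ge0// mulr_ge0// ltW.
  by rewrite -lerBrDl ler_pdivrMr// ler_wpM2l ?(ltW ba0)// ler_nat.
have mI (c d : R) : measurable_fun setT (fun z : R * R => \1_(`[c, d[ : set R) z.1 : R).
  apply: (@measurableT_comp _ _ _ _ _ _ (\1_(`[c, d[ : set R) : R -> R)) => //.
have mterm (c d x : R) : a <= x <= b ->
   measurable_fun setT (fun z : R * R => \1_(`[c, d[ : set R) z.1 * k x z.2).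
  move=> xab; apply: measurable_funM; first exact: mI.
  by apply: (@measurableT_comp _ _ _ _ _ _ (k x)) => //; exact: mk.
have mK n : measurable_fun setT (K n).
  apply: measurable_sum => i.
  by apply: mterm; apply: stepP; apply: ltnW; exact: ltn_ord.
pose F (z : R * R) : R := \1_(`[a, b[ : set R) z.1 * k z.1 z.2.
have mF : measurable_fun setT F.
  apply: (@measurable_fun_cvg _ _ _ setT K F) => //.
  move=> [x y] _; rewrite /F /=.
  have [xab|xab] := boolP (a <= x < b); last first.
    have -> : K^~ (x, y) = fun=> 0.
      apply/funext => n; rewrite /K big1// => i _ /=.
      rewrite indicE memNset ?mul0r//= in_itv/=; apply/negP; apply: contra xab.
      have /andP[h1 _] := stepP n i (ltnW (ltn_ord i)).
      have /andP[_ h2] := stepP n i.+1 (ltn_ord i).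
      by move=> /andP[h3 h4]; rewrite (le_trans h1 h3) (lt_le_trans h4 h2).
    rewrite indicE memNset ?mul0r//=; first exact: cvg_cst.
    by rewrite in_itv/=; apply/negP.
  have x1 : a <= x <= b by lra.
  rewrite indicE mem_set ?mul1r/=; last by rewrite in_itv.
  have KE n : exists x', [/\ K n (x, y) = k x' y, `|x' - x| <= (b - a) / n.+1%:R & a <= x' <= b].
    pose t := (x - a) / (b - a) * n.+1%:R.
    have t0 : 0 <= t by rewrite mulr_ge0// divr_ge0 ?(ltW ba0)//; lra.
    have n0 : (0 : R) < n.+1%:R by rewrite ltr0n.
    have xt : x = a + (b - a) / n.+1%:R * t.
      rewrite /t mulrCA (divfK (lt0r_neq0 n0)) (divfK (lt0r_neq0 ba0)).
      by rewrite addrC subrK.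
    have st (j : nat) : step a b n j = a + (b - a) / n.+1%:R * j%:R.
      by rewrite /step mulrAC.
    have bn0 : 0 < (b - a) / n.+1%:R by rewrite divr_gt0.
    pose i0 := Num.trunc t.
    have /andP[i1 i2] : i0%:R <= t < i0.+1%:R := truncn_itv t0.
    have i0n : (i0 < n.+1)%N.
      rewrite -(ltr_nat R); apply: le_lt_trans i1 _.
      rewrite /t -[ltRHS]mul1r ltr_pM2r// ltr_pdivrMr// mul1r; lra.
    have inI (i : nat) : (step a b n i <= x < step a b n i.+1) = (i%:R <= t < i.+1%:R).
      by rewrite !st xt lerD2l ltrD2l ler_pM2l// ltr_pM2l.
    exists (step a b n i0); split; last (by apply: stepP; exact: ltnW).
    + rewrite /K (bigD1 (Ordinal i0n))//= big1 ?addr0.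
        by rewrite indicE mem_set ?mul1r//= in_itv/= inI i1 i2.
      move=> i; rewrite -val_eqE /= => ii.
      rewrite indicE memNset ?mul0r//= in_itv/= inI => /andP[j1 j2].
      move/eqP: ii; apply; apply/eqP; rewrite eqn_leq -(ltnS i) -(ltnS i0) -(ltr_nat R i) -(ltr_nat R i0).
      by rewrite (le_lt_trans j1 i2) (le_lt_trans i1 j2).
    + rewrite st {1}xt opprD addrACA subrr add0r -mulrBr.
      rewrite normrM ger0_norm ?(ltW bn0)//.
      rewrite -[leRHS]mulr1 ler_wpM2l ?divr_ge0 ?(ltW ba0)//.
      by rewrite -natr1 in i2; rewrite ler_norml; lra.
  have := ck x y x1; move=> /cvgrPdist_lt H; apply/cvgrPdist_lt => e e0.
  have /nbhs_ballP[dl /= dl0 Hd] := H e e0.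
  have : \forall n \near \oo, (b - a) / n.+1%:R < dl.
    pose N := Num.Def.archi_bound ((b - a) / dl).
    have hN : (b - a) / dl < N%:R by apply: archi_boundP; rewrite divr_ge0// ltW.
    exists N => // n /= Nn; rewrite ltr_pdivrMr ?ltr0n// mulrC -ltr_pdivrMr//.
    by apply: lt_le_trans hN _; rewrite ler_nat leqW.
  apply: filterS => n hn; have [x' [-> h1 h2]] := KE n.
  by apply: Hd; rewrite /ball/= distrC (le_lt_trans h1).
have -> : (fun z : R * R => \1_(`[a, b] : set R) z.1 * k z.1 z.2) =
   (fun z => F z + \1_([set b] : set R) z.1 * k b z.2).
  apply/funext => -[x y]; rewrite /F /= !indicE /=.
  have -> : (x \in [set b]) = (x == b) by apply/idP/eqP; rewrite inE.
  rewrite !mem_setE !in_itv/=; have [->|xb] := eqVneq x b.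
    by rewrite ltxx andbF lexx (ltW ab) mul0r add0r.
  by rewrite mul0r addr0 lt_neqAle xb.
apply: measurable_funD => //; apply: measurable_funM.
  exact: (@measurableT_comp _ _ _ _ _ _ (\1_([set b] : set R) : R -> R)).
apply: (@measurableT_comp _ _ _ _ _ _ (k b)) => //; apply: mk.
by rewrite lexx ltW.
Qed.

Section Box.
Variables (g : R -> R -> R) (a b c d : R).
Hypothesis ab : a < b.
Hypothesis g0 : forall x y, a <= x <= b -> c <= y <= d -> 0 <= g x y.
Hypothesis gx :
  forall x y, a <= x <= b -> c <= y <= d -> {for x, continuous (g ^~ y)}.
Hypothesis gy :
  forall x y, a <= x <= b -> c <= y <= d -> {for y, continuous (g x)}.

Let f (z : R * R) : \bar R :=
  (\1_(`[a, b] : set R) z.1 * (\1_(`[c, d] : set R) z.2 * g z.1 z.2))%:E.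

Let fE x y :
  f (x, y) = if (x \in `[a, b]) && (y \in `[c, d]) then (g x y)%:E else 0%E.
Proof.
rewrite /f /= !indicE; case: (boolP (x \in `[a, b])) => xab /=; last first.
  by rewrite memNset ?mul0r//=; exact/negP.
rewrite mem_set// mul1r; case: ifPn => ycd; first by rewrite mem_set// mul1r.
by rewrite memNset ?mul0r//=; exact/negP.
Qed.

Let f0 z : (0 <= f z)%E.
Proof.
case: z => x y; rewrite fE; case: ifPn => // /andP[]; rewrite !in_itv/= => h1 h2.
by rewrite lee_fin g0.
Qed.

Let mf : measurable_fun setT f.
Proof.
pose k x y := \1_(`[c, d] : set R) y * g x y.
have kE x y : k x y = if y \in `[c, d] then g x y else 0.
  rewrite /k indicE; case: ifPn => yD.
    by rewrite mem_set ?mul1r.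
  by rewrite memNset ?mul0r//=; exact/negP.
apply/measurable_EFinP; apply: (@measurable_separately k a b ab).
- move=> x xab; have -> : k x = (g x) \_ (`[c, d]).
    by apply/funext => y; rewrite kE patchE mem_setE.
  apply/(measurable_restrictT _ _).1 => //.
  apply: subspace_continuous_measurable_fun => //.
  by apply: cont_on_within => y ycd; exact: gy.
- move=> x y xab; have [ycd|ycd] := boolP (y \in `[c, d]).
    have -> : k ^~ y = g ^~ y by apply/funext => x'; rewrite kE ycd.
    by apply: gx => //; move: ycd; rewrite in_itv.
  have -> : k ^~ y = fun=> 0 by apply/funext => x'; rewrite kE (negbTE ycd).
  exact: cst_continuous.
Qed.

Let innerE x : (\int[mu]_y f (x, y) =
  ((fun x => \int[mu]_(y in `[c, d]) (g x y)%:E) \_ `[a, b]) x)%E.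
Proof.
rewrite patchE mem_setE; case: ifPn => xab.
  rewrite [in RHS]integral_mkcond; apply: eq_integral => y _.
  by rewrite patchE mem_setE fE xab.
by rewrite integral0_eq// => y _; rewrite fE (negbTE xab).
Qed.

Lemma measurable_inner :
  measurable_fun `[a, b] (fun x => \int[mu]_(y in `[c, d]) (g x y)%:E)%E.
Proof.
apply/(measurable_restrictT _ _).2 => //.
have := @measurable_fun_fubini_tonelli_F _ _ _ _ R mu f mf f0.
by rewrite (_ : fubini_F mu f =
  (fun x => \int[mu]_(y in `[c, d]) (g x y)%:E)%E \_ `[a, b])//; apply/funext.
Qed.

Lemma tonelli_separately :
  (\int[mu]_(x in `[a, b]) \int[mu]_(y in `[c, d]) (g x y)%:E =
   \int[mu]_(y in `[c, d]) \int[mu]_(x in `[a, b]) (g x y)%:E)%E.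
Proof.
have := @fubini_tonelli _ _ _ _ R mu mu f mf f0.
move=> H; rewrite integral_mkcond [in RHS]integral_mkcond.
transitivity (\int[mu]_x \int[mu]_y f (x, y))%E.
  by apply: eq_integral => x _; rewrite innerE.
rewrite H; apply: eq_integral => y _; rewrite patchE mem_setE.
case: ifPn => ycd.
  rewrite [in RHS]integral_mkcond; apply: eq_integral => x _.
  by rewrite patchE mem_setE fE ycd andbT.
by rewrite integral0_eq// => x _; rewrite fE (negbTE ycd) andbF.
Qed.

End Box.

End Tonelli.

Lemma sume4 (R : realType) (F : nat -> \bar R) (a b c d : R) :
  F 0%N = a%:E -> F 1%N = b%:E -> F 2%N = c%:E -> F 3%N = d%:E ->
  (\sum_(i < 4) F i)%E = (a + b + (c + d))%:E.
Proof.
by move=> h0 h1 h2 h3; rewrite !big_ord_recl big_ord0 /= adde0 h0 h1 h2 h3 -!EFinD -!addrA.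
Qed.

Section AreaEstimate.
Variable R : realType.
Local Notation mu := (@lebesgue_measure R).
Variables (f : R[i] -> R[i]) (p : R).
Hypothesis p1 : 1 <= p.

Let g (x y : R) : R := normc (f (x +i* y)) `^ p.

Let p0 : 0 < p. Proof. by rewrite (lt_le_trans _ p1). Qed.

Lemma cont_powR_horiz x y : hol f (x +i* y) -> {for x, continuous (g ^~ y)}.
Proof.
move=> /hol_continuous /(continuous_normc_powR p0) /continuousCR_normcP H.
apply/cvgrPdist_lt => e e0; have [d d0 Hd] := H e e0.
apply/nbhs_ballP; exists d => // x' /=; rewrite /ball/= distrC => hx'.
rewrite distrC; apply: Hd.
by rewrite /= subrr expr0n addr0 sqrtr_sqr.
Qed.

Lemma cont_powR_vert x y : hol f (x +i* y) -> {for y, continuous (g x)}.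
Proof.
move=> /hol_continuous /(continuous_normc_powR p0) /continuousCR_normcP H.
apply/cvgrPdist_lt => e e0; have [d d0 Hd] := H e e0.
apply/nbhs_ballP; exists d => // y' /=; rewrite /ball/= distrC => hy'.
rewrite distrC; apply: Hd.
by rewrite /= subrr expr0n add0r sqrtr_sqr.
Qed.

(** Replaces Jensen's inequality: either [u <= a/4], or [u/a] is at most
    [4^(p-1) (u/a)^p]. *)
Lemma le_powR_split (a u : R) : 0 < a -> 0 <= u ->
  u <= a / 4 + 4 `^ (p - 1) * a `^ (1 - p) * u `^ p.
Proof.
move=> a0 u0.
have C0 : 0 <= 4 `^ (p - 1) * a `^ (1 - p) * u `^ p.
  by rewrite !mulr_ge0// powR_ge0.
have [ua|ua] := leP u (a / 4); first by rewrite (le_trans ua)// lerDl.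
have u1 : 0 < u by rewrite (lt_trans _ ua)// divr_gt0.
suff : u <= 4 `^ (p - 1) * a `^ (1 - p) * u `^ p.
  by move/le_trans; apply; rewrite lerDr divr_ge0// ltW.
have -> : u `^ p = u * u `^ (p - 1).
  by rewrite mulr_powRB1// ltW.
rewrite mulrCA ler_peMr// ?(ltW u1)//.
have -> : a `^ (1 - p) = (a `^ (p - 1))^-1 by rewrite -powRN opprB.
rewrite -mulrA [X in _ * X]mulrC mulrA ler_pdivlMr ?powR_gt0// mul1r.
rewrite -powRM ?(ltW u1)//; apply: (@ge0_ler_powR R (p - 1)).
- by rewrite subr_ge0.
- by rewrite nnegrE ltW.
- by rewrite nnegrE mulr_ge0// ltW.
- by move: ua; lra.
Qed.

Definition perim_powR x y r : R :=
  II (x - r) (x + r) (g ^~ (y - r)) + II (x - r) (x + r) (g ^~ (y + r))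
  + (II (y - r) (y + r) (g (x - r)) + II (y - r) (y + r) (g (x + r))).

(** [le_powR_split] turns the estimate for [|f|] into one for [|f|^p]: the terms
    [a / 4] over a contour of length [8 r] are absorbed by the left side. *)
Lemma cauchy_estimate_powR x y r : 0 < r ->
  (forall z, in_csq x y r z -> hol f z) ->
  2 * r * g x y <= 4 `^ (p - 1) * perim_powR x y r.
Proof.
move=> r0 hf.
have perim0 : 0 <= perim_powR x y r.
  by rewrite /perim_powR; do !apply: addr_ge0; apply: II_ge0 => t _;
    exact: powR_ge0.
have [fz|fz] := eqVneq (f (x +i* y)) 0.
  rewrite /g fz normc0 powR0 ?gt_eqF// mulr0.
  by rewrite mulr_ge0// powR_ge0.
set a := normc (f (x +i* y)); have a0 : 0 < a := normc_gt0 fz.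
have le2 (c : R) : c - r <= c + r by lra.
pose K := 4 `^ (p - 1) * a `^ (1 - p).
have side (u v : R) (phi : R -> R[i]) : u <= v ->
    cont_on u v (fun t => normc (phi t)) -> cont_on u v (fun t => normc (phi t) `^ p) ->
    II u v (fun t => normc (phi t)) <= a / 4 * (v - u) + K * II u v (fun t => normc (phi t) `^ p).
  move=> uv c1 c2; rewrite -(II_cst _ uv) -IIZ// -IID; [|exact: cont_on_cst|].
    apply: le_II => //.
      apply: cont_onD; first exact: cont_on_cst.
      by apply: cont_onM => //; exact: cont_on_cst.
    by move=> t _; exact: le_powR_split a0 (normc_ge0 _).
  by apply: cont_onM => //; exact: cont_on_cst.
have hin (t : R) (b : bool) : x - r <= t <= x + r -> hol f (t +i* (y + (if b then r else - r))).
  by move=> tx; apply: hf; rewrite /in_csq/= tx/=; case: b; lra.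
have vin (t : R) (b : bool) : y - r <= t <= y + r -> hol f ((x + (if b then r else - r)) +i* t).
  by move=> tx; apply: hf; rewrite /in_csq/= tx/=; case: b; lra.
have := cauchy_estimate r0 hf; rewrite -/a /perim => H.
have h1 := side _ _ (fun t => f (t +i* (y - r))) (le2 x)
  (cont_on_normc_horiz (fun t tx => hin t false tx)) (fun t tx => cont_powR_horiz (hin t false tx)).
have h2 := side _ _ (fun t => f (t +i* (y + r))) (le2 x)
  (cont_on_normc_horiz (fun t tx => hin t true tx)) (fun t tx => cont_powR_horiz (hin t true tx)).
have h3 := side _ _ (fun t => f ((x - r) +i* t)) (le2 y)
  (cont_on_normc_vert (fun t tx => vin t false tx)) (fun t tx => cont_powR_vert (vin t false tx)).
have h4 := side _ _ (fun t => f ((x + r) +i* t)) (le2 y)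
  (cont_on_normc_vert (fun t tx => vin t true tx)) (fun t tx => cont_powR_vert (vin t true tx)).
have er (c : R) : c + r - (c - r) = 2 * r by ring.
rewrite !er in h1 h2 h3 h4.
have H2 : 2 * r * a <= K * perim_powR x y r.
  rewrite /= in h1 h2 h3 h4.
  have e1 : a / 4 * (2 * r) = r * a / 2 by field.
  rewrite e1 in h1 h2 h3 h4.
  rewrite /perim_powR /g.
  clearbody a K; clear -H h1 h2 h3 h4.
  set B1 := II _ _ (fun t => normc (f (t +i* (y - r)))) in H h1.
  set B2 := II _ _ (fun t => normc (f (t +i* (y + r)))) in H h2.
  set B3 := II _ _ (fun t => normc (f ((x - r) +i* t))) in H h3.
  set B4 := II _ _ (fun t => normc (f ((x + r) +i* t))) in H h4.
  set C1 := II _ _ (fun t => normc (f (t +i* (y - r))) `^ p) in h1 *.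
  set C2 := II _ _ (fun t => normc (f (t +i* (y + r))) `^ p) in h2 *.
  set C3 := II _ _ (fun t => normc (f ((x - r) +i* t)) `^ p) in h3 *.
  set C4 := II _ _ (fun t => normc (f ((x + r) +i* t)) `^ p) in h4 *.
  clearbody B1 B2 B3 B4 C1 C2 C3 C4; lra.
have -> : g x y = a * a `^ (p - 1) by rewrite mulr_powRB1// ltW.
rewrite mulrA.
have -> : 4 `^ (p - 1) * perim_powR x y r = K * perim_powR x y r * a `^ (p - 1).
  have aa : a `^ (1 - p) * a `^ (p - 1) = 1.
    rewrite -powRD; last by apply/implyP => _; rewrite gt_eqF.
    by rewrite addrC subrKA subrr powRr0.
  have -> : K * perim_powR x y r * a `^ (p - 1) =
     4 `^ (p - 1) * perim_powR x y r * (a `^ (1 - p) * a `^ (p - 1)).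
    by rewrite /K; ring.
  by rewrite aa mulr1.
by rewrite ler_wpM2r// powR_ge0.
Qed.

Section Area.
Variables (x y rho : R).
Hypothesis rho0 : 0 < rho.
Hypothesis hf : forall z, in_csq x y rho z -> hol f z.

Let chz (u v : R) : x - rho <= u <= x + rho -> y - rho <= v <= y + rho ->
  {for u, continuous (g ^~ v)}.
Proof. by move=> hu hv; apply: cont_powR_horiz; apply: hf; rewrite /in_csq/= hu hv. Qed.

Let cvt (u v : R) : x - rho <= u <= x + rho -> y - rho <= v <= y + rho ->
  {for v, continuous (g u)}.
Proof. by move=> hu hv; apply: cont_powR_vert; apply: hf; rewrite /in_csq/= hu hv. Qed.

Let box : \bar R := (\int[mu]_(u in `[(x - rho)%R, (x + rho)%R])
  \int[mu]_(v in `[(y - rho)%R, (y + rho)%R]) (g u v)%:E)%E.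

Let cont_line (c : R) (s : bool) (t : R) (phi : R -> R) :
  {for c + (if s then t else - t), continuous phi} ->
  {for t, continuous (fun r => phi (c + (if s then r else - r)))}.
Proof.
case: s => cphi.
  apply: (@continuous_comp _ _ _ (fun t => c + t) phi) => //.
  by apply: continuousD; [exact: cst_continuous|exact: cvg_id].
apply: (@continuous_comp _ _ _ (fun t => c - t) phi) => //.
by apply: continuousB; [exact: cst_continuous|exact: cvg_id].
Qed.

Let radius_in (c t : R) (s : bool) : rho / 2 <= t <= rho ->
  c - rho <= c + (if s then t else - t) <= c + rho.
Proof. by case: s; have := rho0; lra. Qed.

(** Averaging a side of the square over its radius stays within the area
    integral; [s] tells on which side of the center the side lies. *)
Let side_horiz (s : bool) :
  (\int[mu]_(r in `[(rho / 2)%R, rho]) \int[mu]_(u in `[(x - rho)%R, (x + rho)%R])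
     (g u (y + (if s then r else - r))%R)%:E <= box)%E /\
  measurable_fun `[(rho / 2)%R, rho] (fun r => \int[mu]_(u in `[(x - rho)%R, (x + rho)%R])
     (g u (y + (if s then r else - r))%R)%:E)%E.
Proof.
have r2 : rho / 2 < rho by have := rho0; lra.
have xx : x - rho <= x + rho by have := rho0; lra.
have yy : y - rho <= y + rho by have := rho0; lra.
pose k (r u : R) := g u (y + (if s then r else - r)).
have k0 r u : rho / 2 <= r <= rho -> x - rho <= u <= x + rho -> 0 <= k r u.
  by move=> _ _; exact: powR_ge0.
have kx r u : rho / 2 <= r <= rho -> x - rho <= u <= x + rho -> {for r, continuous (k ^~ u)}.
  by move=> hr hu; apply: (@cont_line y s r (g u)); apply: cvt => //; exact: radius_in.
have ky r u : rho / 2 <= r <= rho -> x - rho <= u <= x + rho -> {for u, continuous (k r)}.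
  by move=> hr hu; apply: chz => //; exact: radius_in.
split; last exact: (measurable_inner r2 k0 kx ky).
rewrite (tonelli_separately r2 k0 kx ky).
have xx' : x - rho < x + rho by have := rho0; lra.
apply: ge0_le_integral; [exact: measurable_itv| | | |].
- by move=> u _; apply: integral_ge0 => r _; rewrite lee_fin powR_ge0.
- have k0' u r : x - rho <= u <= x + rho -> rho / 2 <= r <= rho -> 0 <= k r u.
    by move=> _ _; exact: powR_ge0.
  exact: (@measurable_inner R (fun u r => k r u) _ _ _ _ xx' k0'
    (fun u r hu hr => ky r u hr hu) (fun u r hu hr => kx r u hr hu)).
- have gg0 u v : x - rho <= u <= x + rho -> y - rho <= v <= y + rho -> 0 <= g u v.
    by move=> _ _; exact: powR_ge0.
  exact: (@measurable_inner R g _ _ _ _ xx' gg0 chz cvt).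
- move=> u; rewrite /= in_itv/= => hu.
  have cg : cont_on (y - rho) (y + rho) (g u) by move=> v hv; exact: (cvt hu hv).
  have ck : cont_on (rho / 2) rho (k ^~ u) by move=> r hr; exact: (kx r u hr hu).
  rewrite (II_fin cg) (II_fin ck).
  rewrite lee_fin.
  have [h1 h2] := II_radius_le (ltW rho0) cg (fun t _ => powR_ge0 _ _).
  rewrite /k; clear k k0 kx ky ck; case: (s); [exact: h1|exact: h2].
Qed.

Let side_vert (s : bool) :
  (\int[mu]_(r in `[(rho / 2)%R, rho]) \int[mu]_(v in `[(y - rho)%R, (y + rho)%R])
     (g (x + (if s then r else - r))%R v)%:E <= box)%E /\
  measurable_fun `[(rho / 2)%R, rho] (fun r => \int[mu]_(v in `[(y - rho)%R, (y + rho)%R])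
     (g (x + (if s then r else - r))%R v)%:E)%E.
Proof.
have r2 : rho / 2 < rho by have := rho0; lra.
have xx : x - rho < x + rho by have := rho0; lra.
have yy : y - rho < y + rho by have := rho0; lra.
pose k (r v : R) := g (x + (if s then r else - r)) v.
have k0 r u : rho / 2 <= r <= rho -> y - rho <= u <= y + rho -> 0 <= k r u.
  by move=> _ _; exact: powR_ge0.
have kx r u : rho / 2 <= r <= rho -> y - rho <= u <= y + rho -> {for r, continuous (k ^~ u)}.
  by move=> hr hu; apply: (@cont_line x s r (g ^~ u)); apply: chz => //; exact: radius_in.
have ky r u : rho / 2 <= r <= rho -> y - rho <= u <= y + rho -> {for u, continuous (k r)}.
  by move=> hr hu; apply: cvt => //; exact: radius_in.
split; last exact: (measurable_inner r2 k0 kx ky).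
rewrite (tonelli_separately r2 k0 kx ky).
have gg0 (u v : R) : x - rho <= u <= x + rho -> y - rho <= v <= y + rho -> 0 <= g u v.
  by move=> _ _; exact: powR_ge0.
have Hb := @tonelli_separately R g _ _ _ _ xx gg0 chz cvt.
rewrite /box Hb.
apply: ge0_le_integral; [exact: measurable_itv| | | |].
- by move=> u _; apply: integral_ge0 => r _; rewrite lee_fin powR_ge0.
- have k0' u r : y - rho <= u <= y + rho -> rho / 2 <= r <= rho -> 0 <= k r u.
    by move=> _ _; exact: powR_ge0.
  exact: (@measurable_inner R (fun u r => k r u) _ _ _ _ yy k0'
    (fun u r hu hr => ky r u hr hu) (fun u r hu hr => kx r u hr hu)).
- have gg0' v u : y - rho <= v <= y + rho -> x - rho <= u <= x + rho -> 0 <= g u v.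
    by move=> _ _; exact: powR_ge0.
  exact: (@measurable_inner R (fun v u => g u v) _ _ _ _ yy gg0'
    (fun v u hv hu => cvt hu hv) (fun v u hv hu => chz hu hv)).
- move=> v; rewrite /= in_itv/= => hv.
  have cg : cont_on (x - rho) (x + rho) (g ^~ v) by move=> u hu; exact: (chz hu hv).
  have ck : cont_on (rho / 2) rho (k ^~ v) by move=> r hr; exact: (kx r v hr hv).
  rewrite (II_fin cg) (II_fin ck).
  rewrite lee_fin.
  have [h1 h2] := II_radius_le (ltW rho0) cg (fun t _ => powR_ge0 _ _).
  rewrite /k; clear k k0 kx ky ck; case: (s); [exact: h1|exact: h2].
Qed.

(** The Cauchy estimate averaged over the half side [r] in [[rho/2, rho]]. *)
Lemma area_estimate :
  ((rho ^+ 2 * g x y)%R%:E <= (2 * 4 `^ p)%R%:E * box)%E.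
Proof.
have r2 : rho / 2 <= rho by have := rho0; lra.
pose S (i : nat) (r : R) : \bar R :=
  (if i is 0 then \int[mu]_(u in `[(x - rho)%R, (x + rho)%R]) (g u (y + - r)%R)%:E
   else if i is 1 then \int[mu]_(u in `[(x - rho)%R, (x + rho)%R]) (g u (y + r)%R)%:E
   else if i is 2 then \int[mu]_(v in `[(y - rho)%R, (y + rho)%R]) (g (x + - r)%R v)%:E
   else \int[mu]_(v in `[(y - rho)%R, (y + rho)%R]) (g (x + r)%R v)%:E)%E.
have [b0 m0] := side_horiz false; have [b1 m1] := side_horiz true.
have [b2 m2] := side_vert false; have [b3 m3] := side_vert true.
rewrite /= in b0 m0 b1 m1 b2 m2 b3 m3.
have mS i : measurable_fun `[(rho / 2)%R, rho] (S i).
  case: i => [|[|[|i]]]; [exact: m0|exact: m1|exact: m2|exact: m3].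
have S0 i r : (0 <= S i r)%E.
  by rewrite /S; case: i => [|[|[|i]]]; apply: integral_ge0 => t _; rewrite lee_fin powR_ge0.
have bS i : (\int[mu]_(r in `[(rho / 2)%R, rho]) S i r <= box)%E.
  case: i => [|[|[|i]]]; [exact: b0|exact: b1|exact: b2|exact: b3].
have key (r : R) : rho / 2 <= r <= rho ->
    ((rho * g x y)%R%:E <= (4 `^ (p - 1))%R%:E * (\sum_(i < 4) S i r))%E.
  move=> hr; have r0 : 0 < r by have := rho0; lra.
  have sub c t : c - r <= t <= c + r -> c - rho <= t <= c + rho by lra.
  have hf' z : in_csq x y r z -> hol f z.
    by move=> /andP[/sub h1 /sub h2]; apply: hf; rewrite /in_csq h1.
  have H := cauchy_estimate_powR r0 hf'.
  have e (c : R) : c - rho <= c - r <= c + rho by lra.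
  have e' (c : R) : c - rho <= c + r <= c + rho by lra.
  have c1 : cont_on (x - rho) (x + rho) (g ^~ (y - r)).
    by move=> t ht; exact: (chz ht (e y)).
  have c2 : cont_on (x - rho) (x + rho) (g ^~ (y + r)).
    by move=> t ht; exact: (chz ht (e' y)).
  have c3 : cont_on (y - rho) (y + rho) (g (x - r)).
    by move=> t ht; exact: (cvt (e x) ht).
  have c4 : cont_on (y - rho) (y + rho) (g (x + r)).
    by move=> t ht; exact: (cvt (e' x) ht).
  have sumE : (\sum_(i < 4) S i r)%E = (II (x - rho) (x + rho) (g ^~ (y - r)) + II (x - rho) (x + rho) (g ^~ (y + r))
     + (II (y - rho) (y + rho) (g (x - r)) + II (y - rho) (y + rho) (g (x + r))))%:E.
    have s0 : S 0%N r = _ := II_fin c1; have s1 : S 1%N r = _ := II_fin c2.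
    have s2 : S 2%N r = _ := II_fin c3; have s3 : S 3%N r = _ := II_fin c4.
    exact: (sume4 (F := S ^~ r) s0 s1 s2 s3).
  rewrite sumE -EFinM lee_fin.
  apply: (@le_trans _ _ (2 * r * g x y)).
    by rewrite ler_wpM2r ?powR_ge0//; lra.
  apply: le_trans H _; rewrite ler_wpM2l ?powR_ge0// /perim_powR.
  have wide (c : R) (phi : R -> R) : cont_on (c - rho) (c + rho) phi ->
      (forall t, 0 <= phi t) -> II (c - r) (c + r) phi <= II (c - rho) (c + rho) phi.
    by move=> cphi phi0; apply: II_sub => //; lra.
  by apply: lerD; apply: lerD; apply: wide => // t; exact: powR_ge0.
have : (\int[mu]_(r in `[(rho / 2)%R, rho]) (cst (rho * g x y)%R%:E r) <=
    \int[mu]_(r in `[(rho / 2)%R, rho]) ((4 `^ (p - 1))%R%:E * (\sum_(i < 4) S i r)))%E.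
  apply: ge0_le_integral => //=.
  - by move=> r _; rewrite lee_fin mulr_ge0 ?powR_ge0// ltW.
  - by apply: emeasurable_funM => //; apply: emeasurable_sum => i; exact: mS.
rewrite integral_cst//= ge0_integralZl//; last 2 first.
- exact: (@emeasurable_sum _ _ R _ _ _ (fun i : 'I_4 => S i) (fun i => mS i)).
- by move=> r _; apply: sume_ge0 => i _.
rewrite ge0_integral_sum//; last by move=> i; exact: mS.
move=> h.
have box0 : (0 <= box)%E.
  by apply: integral_ge0 => u _; apply: integral_ge0 => v _; rewrite lee_fin powR_ge0.
have sum4 : (\sum_(i < 4) \int[mu]_(r in `[(rho / 2)%R, rho]) S i r <= 4%:E * box)%E.
  have -> : (4%:E * box = \sum_(i < 4) 1%:E * box)%E.
    rewrite -ge0_sume_distrl; last by move=> i _; rewrite lee_fin.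
    by rewrite sumEFin sumr_const card_ord.
  by apply: lee_sum => i _; rewrite mul1e; exact: bS.
have -> : (rho ^+ 2 * g x y)%:E = (2%:E * ((rho * g x y)%:E * mu `[(rho / 2)%R, rho]))%E.
  rewrite lebesgue_measure_itv/= lte_fin ltr_pdivrMr// ltr_pMr// ltr1n/=.
  by rewrite -EFinB -!EFinM; congr EFin; field.
have -> : ((2 * 4 `^ p)%:E * box = 2%:E * ((4 `^ (p - 1))%:E * (4%:E * box)))%E.
  rewrite [in RHS]muleA [in RHS]muleA -!EFinM; congr (_%:E * _)%E.
  have h4 : (0 : R) <= 4 by [].
  by rewrite -(mulr_powRB1 h4 p0); ring.
rewrite lee_pmul2l//; apply: le_trans h _; apply: lee_wpmul2l; last exact: sum4.
by rewrite lee_fin powR_ge0.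
Qed.

End Area.
End AreaEstimate.

(** * Whitney boxes and Carleson measures *)

Section BorelPlane.
Variable R : realType.

Lemma open_measurableC (A : set R[i]) : open A -> measurable (A : set (borelC R)).
Proof. by move=> oA; exact: sub_sigma_algebra. Qed.

Lemma continuous_measurableC (f : R[i] -> R) :
  continuous f -> measurable_fun setT (f : borelC R -> R).
Proof.
move=> cf; apply: (measurability _ (RGenOpens.measurableE R)).
move=> _ [_ [a [b ->] <-]]; rewrite setTI; apply: open_measurableC.
by move/continuousP : cf; apply; exact: interval_open.
Qed.

Lemma measurable_Re : measurable_fun setT (@complex.Re R : borelC R -> R).
Proof. exact: (continuous_measurableC (@continuous_Re R)). Qed.

Lemma measurable_Im : measurable_fun setT (@complex.Im R : borelC R -> R).
Proof. exact: (continuous_measurableC (@continuous_Im R)). Qed.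

Lemma measurable_ReIm (I J : interval R) :
  measurable ([set s | complex.Re s \in I /\ complex.Im s \in J] : set (borelC R)).
Proof.
rewrite (_ : [set _ | _] = (@complex.Re R @^-1` [set` I]) `&` (@complex.Im R @^-1` [set` J]))//.
apply: measurableI.
  by rewrite -[_ @^-1` _]setTI; exact: (measurable_Re measurableT (measurable_itv I)).
by rewrite -[_ @^-1` _]setTI; exact: (measurable_Im measurableT (measurable_itv J)).
Qed.

Lemma measurable_halfplane : measurable (@halfplane R : set (borelC R)).
Proof.
rewrite (_ : @halfplane R = [set s | complex.Re s \in `]2^-1, +oo[ /\ complex.Im s \in `]-oo, +oo[]).
  exact: measurable_ReIm.
by apply/seteqP; split => s /=; rewrite !in_itv/= ?andbT => // -[].
Qed.

End BorelPlane.

Section Whitney.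
Variable R : realType.
Variable mu : {measure set (borelC R) -> \bar R}.

Definition height (s : R[i]) : R := complex.Re s - 2^-1.

Definition strip (t w h : R) : set (borelC R) :=
  [set s | 0 < height s < h /\ t <= complex.Im s < t + w].

Lemma measurable_strip t w h : measurable (strip t w h).
Proof.
rewrite (_ : strip t w h = [set s | (complex.Re s \in `]2^-1, 2^-1 + h[)
    /\ (complex.Im s \in `[t, t + w[)]).
  exact: measurable_ReIm.
by apply/seteqP; split => s /=; rewrite /strip /height !in_itv/= ltrBlDl ltrBrDl addr0.
Qed.

Variable Cm : R.
Hypothesis carleson_square :
  forall t h : R, 0 < h -> (mu (strip t h h) <= (Cm * h)%:E)%E.

Lemma mu_strip_le t h n : 0 < h -> (mu (strip t (n%:R * h) h) <= (n%:R * (Cm * h))%:E)%E.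
Proof.
move=> h0; elim: n => [|n IH].
  rewrite (_ : strip _ _ _ = set0) ?measure0 ?mul0r//.
  by apply/seteqP; split => s //= [_ +]; rewrite addr0 => /andP[]; lra.
have sub : strip t (n.+1%:R * h) h `<=` strip t (n%:R * h) h `|` strip (t + n%:R * h) h h.
  move=> s [h1 /andP[h2 h3]]; have [h4|h4] := ltP (complex.Im s) (t + n%:R * h).
    by left; split => //; rewrite h2.
  by right; split => //; rewrite h4/=; move: h3; rewrite -natr1 mulrDl mul1r addrA.
apply: le_trans (le_measure mu _ _ sub) _.
- by rewrite inE; exact: measurable_strip.
- by rewrite inE; apply: measurableU; exact: measurable_strip.
apply: le_trans (measureU2 _ _ _) _; [exact: measurable_strip..|].
rewrite -natr1 mulrDl mul1r EFinD; apply: leeD; first exact: IH.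
exact: carleson_square.
Qed.

Variables (eps x0 : R).
Hypothesis eps0 : 0 < eps.

Let hh (k : nat) : R := 2 ^+ k * eps.

Let hh0 k : 0 < hh k. Proof. by rewrite mulr_gt0// exprn_gt0. Qed.

Let hhS k : hh k.+1 = 2 * hh k. Proof. by rewrite /hh exprS mulrA. Qed.

(** Whitney boxes are translated by [d] times their own width: the translates
    carry the interaction of a box with the boxes at distance [d]. *)
Definition wbox (d : R) (k i : nat) : set (borelC R) :=
  [set s | hh k <= height s < hh k.+1 /\
    x0 + i%:R * hh k <= complex.Im s + d * hh k < x0 + i.+1%:R * hh k].

(** The part of the half-plane whose translated boxes lie in the dyadic tree
    below the node [(k, i)]. *)
Definition wtent (d : R) (k i : nat) : set (borelC R) :=
  \bigcup_(j in `I_k.+1) [set s | hh j <= height s < hh j.+1 /\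
    x0 + i%:R * hh k <= complex.Im s + d * hh j < x0 + i.+1%:R * hh k].

Let measurable_piece (d : R) (k j i : nat) :
  measurable ([set s | hh j <= height s < hh j.+1 /\
    x0 + i%:R * hh k <= complex.Im s + d * hh j < x0 + i.+1%:R * hh k] : set (borelC R)).
Proof.
rewrite (_ : [set _ | _] = [set s | (complex.Re s \in `[2^-1 + hh j, 2^-1 + hh j.+1[)
    /\ (complex.Im s \in `[x0 + i%:R * hh k - d * hh j, x0 + i.+1%:R * hh k - d * hh j[)]).
  exact: measurable_ReIm.
by apply/seteqP; split => s /=; rewrite /height !in_itv/= lerBrDl ltrBlDl lerBlDr ltrBrDr.
Qed.

Lemma measurable_wbox d k i : measurable (wbox d k i).
Proof. exact: measurable_piece. Qed.

Lemma measurable_wtent d k i : measurable (wtent d k i).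
Proof. by apply: bigcup_measurable => j _; exact: measurable_piece. Qed.

Lemma hh_mono j k : (j <= k)%N -> hh j <= hh k.
Proof. by move=> jk; rewrite /hh ler_pM2r// ler_eXn2l// ltr1n. Qed.

(** Boxes of smaller generation are translated less, so a tent stays in the
    strip over the interval widened by the translation on both sides. *)
Lemma wtent_sub (d : R) (l k i : nat) : `|d| = l%:R ->
  wtent d k i `<=` strip (x0 + i%:R * hh k - l%:R * hh k) (l.+1%:R * hh k.+1) (hh k.+1).
Proof.
move=> dl s [j /= jk [/andP[h1 h2] /andP[h3 h4]]].
have jk' : hh j <= hh k by apply: hh_mono; rewrite -ltnS.
have jk1 : hh j.+1 <= hh k.+1 by exact: hh_mono.
have dj : `|d * hh j| <= l%:R * hh k.
  by rewrite normrM dl ger0_norm ?(ltW (hh0 j))// ler_wpM2l.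
move: dj; rewrite ler_norml => /andP[dj1 dj2].
split; apply/andP; split.
- by apply: lt_le_trans h1; exact: hh0.
- exact: lt_le_trans h2 jk1.
- lra.
- have k0 := hh0 k; rewrite hhS.
  have e1 : i.+1%:R * hh k = i%:R * hh k + hh k by rewrite -natr1 mulrDl mul1r.
  have e2 : l.+1%:R * (2 * hh k) = 2 * (l%:R * hh k) + 2 * hh k.
    by rewrite -natr1; ring.
  by rewrite e2; move: h4; rewrite e1; lra.
Qed.

Lemma mu_wtent_le (d : R) (l k i : nat) : `|d| = l%:R ->
  (mu (wtent d k i) <= (2 * l.+1%:R * Cm * eps * 2 ^+ k)%:E)%E.
Proof.
move=> dl; apply: le_trans (le_measure mu _ _ (wtent_sub dl)) _.
- by rewrite inE; exact: measurable_wtent.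
- by rewrite inE; exact: measurable_strip.
apply: le_trans (mu_strip_le _ _ (hh0 _)) _.
by rewrite lee_fin hhS /hh le_eqVlt; apply/orP; left; apply/eqP; ring.
Qed.

Lemma wbox_sub_wtent d k i : wbox d k i `<=` wtent d k i.
Proof. by move=> s hs; exists k => //=. Qed.

Definition boxmass (d : R) (k i : nat) : R := fine (mu (wbox d k i)).

Lemma boxmassE (d : R) (l k i : nat) : `|d| = l%:R ->
  (boxmass d k i)%:E = mu (wbox d k i).
Proof.
move=> dl; rewrite fineK// ge0_fin_numE// (le_lt_trans _ (ltry (2 * l.+1%:R * Cm * eps * 2 ^+ k)))//.
apply: le_trans (mu_wtent_le k i dl).
by apply: le_measure; rewrite ?inE; [exact: measurable_wbox|exact: measurable_wtent|exact: wbox_sub_wtent].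
Qed.

Lemma boxmass_ge0 d k i : 0 <= boxmass d k i.
Proof. exact: fine_ge0. Qed.

(** The boxes of the tree are disjoint, so that their masses add up to the
    measure of the tent. *)
Lemma mass_wtent (d : R) (l k i : nat) : `|d| = l%:R ->
  ((mass (boxmass d) k i)%:E <= mu (wtent d k i))%E.
Proof.
move=> dl; elim: k i => [|k IH] i /=.
  rewrite addr0 (boxmassE _ _ dl); apply: le_measure; rewrite ?inE;
    [exact: measurable_wbox|exact: measurable_wtent|exact: wbox_sub_wtent].
rewrite !EFinD (boxmassE _ _ dl).
have m1 := measurable_wbox d k.+1 i.
have m2 := measurable_wtent d k i.*2; have m3 := measurable_wtent d k i.*2.+1.
apply: (@le_trans _ _ (mu (wbox d k.+1 i `|` (wtent d k i.*2 `|` wtent d k i.*2.+1)))).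
  rewrite measureU//; last 2 first.
  - exact: measurableU.
  - apply/seteqP; split => s //= [[/andP[h1 _] _]].
    have lt j : (j < k.+1)%N -> height s < hh j.+1 -> False.
      by move=> jk h2; have : hh j.+1 <= hh k.+1 by [exact: hh_mono]; lra.
    by move=> [[j /= jk [/andP[_ h2] _]]|[j /= jk [/andP[_ h2] _]]]; exact: lt jk h2.
  rewrite measureU//; first by apply: leeD => //; exact: leeD.
  apply/seteqP; split => s //= [[j jk [/andP[a1 a2] /andP[a3 a4]]] [j' jk' [/andP[b1 b2] /andP[b3 b4]]]].
  have jj : j = j'.
    apply/eqP; rewrite eqn_leq; apply/andP; split; rewrite leqNgt; apply/negP => ltj.
      by have := hh_mono ltj; lra.
    by have := hh_mono ltj; lra.
  by move: a4 b3; rewrite jj; lra.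
apply: le_measure; rewrite ?inE; [|exact: measurable_wtent|].
  by apply: measurableU => //; exact: measurableU.
have e1 (c : nat) : c.*2%:R * hh k = c%:R * hh k.+1 by rewrite hhS -mul2n natrM; ring.
have e2 (c : nat) : c.*2.+1%:R * hh k = c%:R * hh k.+1 + hh k.
  by rewrite -natr1 mulrDl mul1r e1.
have e3 : i.+1%:R * hh k.+1 = i%:R * hh k.+1 + 2 * hh k.
  by rewrite -natr1 mulrDl mul1r; congr (_ + _); exact: hhS.
have k0 := hh0 k.
move=> s [|[[j /= jk [h1 /andP[h2 h3]]]|[j /= jk [h1 /andP[h2 h3]]]]].
- exact: wbox_sub_wtent.
- exists j => /=; first exact: ltnW.
  split => //; move: h2 h3; rewrite e1 e2 e3 => h2 h3; apply/andP; split; lra.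
- exists j => /=; first exact: ltnW.
  split => //; move: h2 h3; rewrite -(doubleS i) e1 e2 e3 => h2 h3.
  by apply/andP; split; lra.
Qed.

Lemma mass_boxmass_le (d : R) (l k i : nat) : `|d| = l%:R ->
  mass (boxmass d) k i <= 2 * l.+1%:R * Cm * eps * 2 ^+ k.
Proof.
by move=> dl; rewrite -lee_fin (le_trans (mass_wtent k i dl))// (mu_wtent_le k i dl).
Qed.

End Whitney.

Import IntDist.

Lemma sum_le_widen (R : realDomainType) (F : nat -> R) (m n : nat) :
  (m <= n)%N -> (forall l, 0 <= F l) -> \sum_(l < m) F l <= \sum_(l < n) F l.
Proof.
move=> mn F0; rewrite -!(big_mkord xpredT F) [leRHS](big_cat_nat (leq0n m) mn)/=.
by rewrite lerDl; apply: sumr_ge0.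
Qed.

Section WhitneyEmbedding.
Variable R : realType.
Variable mu : {measure set (borelC R) -> \bar R}.
Variables (Cm eps x0 : R).
Hypotheses (Cm0 : 0 < Cm) (eps0 : 0 < eps).
Hypothesis carleson_square :
  forall t h : R, 0 < h -> (mu (strip t h h) <= (Cm * h)%:E)%E.
Variable c : nat -> R.

Local Notation m := (boxmass mu eps x0).
Local Notation n K k := (2 ^ (K - k))%N.

(** Translating the boxes by [l] of their own widths costs a factor [l + 1]. *)
Lemma translated_embedding (d : R) (l K : nat) : `|d| = l%:R ->
  wsum (m d) c K 0 <= 8 * l.+1%:R * Cm * eps * \sum_(j < 2 ^ K) c j ^+ 2.
Proof.
move=> dl; pose L := 2 * l.+1%:R * Cm * eps.
have L0 : 0 < L by rewrite !mulr_gt0.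
have mL k i : mass (m d) k i <= L * 2 ^+ k.
  exact: (mass_boxmass_le carleson_square x0 eps0 k i dl).
have := dyadic_embedding c L0 (boxmass_ge0 mu eps x0 d) mL K 0.
move/le_trans; apply; rewrite avgE mul0n.
have P0 : (2 : R) ^+ K != 0 by rewrite expf_neq0.
rewrite mulrA -[4 * L * _ * _]mulrA mulfV// mulr1 /L.
by rewrite le_eqVlt; apply/orP; left; apply/eqP; ring.
Qed.

(** The box [i] is the box [i'] translated by [i' - i] widths. *)
Lemma boxmass_offset k (i i' : nat) (d : R) : d = i'%:R - i%:R ->
  m 0 k i = m d k i'.
Proof.
move=> dE; rewrite /boxmass; congr (fine (mu _)).
apply/seteqP; split => s /= [h1 /andP[h2 h3]]; split => //; apply/andP.
  move: h2 h3; rewrite -!natr1 dE mul0r addr0 !mulrDl mulNr ?mul1r => h2 h3.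
  by split; lra.
move: h2 h3; rewrite -!natr1 dE mul0r addr0 !mulrDl mulNr ?mul1r => h2 h3.
by split; lra.
Qed.

(** By Cauchy-Schwarz with the weights [offw * offs] the square of the inner sum
    becomes a sum of squares of averages; sorted by the offset [l], these are
    the sums of [translated_embedding] for the translations by [l] and [- l]. *)
Lemma whitney_embedding (K : nat) :
  \sum_(k < K.+1) \sum_(i < n K k) m 0 k i *
     (\sum_(i' < n K k) offw R (`|i' - i|)%N * avg c k i') ^+ 2
  <= (128 * 100) * Cm * eps * \sum_(j < 2 ^ K) c j ^+ 2.
Proof.
set SC := \sum_(j < 2 ^ K) _.
have SC0 : 0 <= SC by apply: sumr_ge0 => j _; exact: sqr_ge0.
have w0 l : 0 < offw R l := offw_gt0 R l.
have s0 l : 0 < offs R l := offs_gt0 R l.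
pose ws l := offw R l * offs R l.
pose wv l := offw R l / offs R l.
have ws0 l : 0 <= ws l by rewrite mulr_ge0 ?ltW.
have wv0 l : 0 <= wv l by rewrite divr_ge0 ?ltW.
have cs k i : (i < n K k)%N ->
    (\sum_(i' < n K k) offw R (`|i' - i|)%N * avg c k i') ^+ 2
    <= 40 * \sum_(i' < n K k) wv (`|i' - i|)%N * avg c k i' ^+ 2.
  move=> ilt.
  have := @weighted_cauchy_schwarz R (n K k) (fun i' => ws (`|i' - i|)%N)
    (fun i' => avg c k i' / offs R (`|i' - i|)%N) (fun _ _ => ws0 _).
  rewrite (_ : \sum_(i' < n K k) ws _ * (avg c k i' / _) =
    \sum_(i' < n K k) offw R (`|i' - i|)%N * avg c k i'); last first.
    by apply: eq_bigr => i' _; rewrite /ws; field; rewrite gt_eqF.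
  rewrite (_ : \sum_(i' < n K k) ws _ * (avg c k i' / _) ^+ 2 =
    \sum_(i' < n K k) wv (`|i' - i|)%N * avg c k i' ^+ 2); last first.
    by apply: eq_bigr => i' _; rewrite /ws /wv; field; rewrite gt_eqF.
  move/le_trans; apply; apply: ler_wpM2r.
    by apply: sumr_ge0 => i' _; rewrite mulr_ge0 ?sqr_ge0.
  apply: (@le_trans _ _ (\sum_(l < n K k) (ws l + ws l))).
    apply: (@sum_offsets_le R (n K k) i (fun i' => ws (`|i' - i|)%N) ws ws) => // i' hi.
      by rewrite distnEr.
    by rewrite distnEl// ltnW.
  rewrite big_split /=; have := sum_offsets R (n K k); rewrite -/ws; lra.
apply: (@le_trans _ _ (40 * \sum_(l < 2 ^ K) wv l *
   (wsum (m l%:R) c K 0 + wsum (m (- l%:R)) c K 0))).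
  apply: (@le_trans _ _ (\sum_(k < K.+1) \sum_(i < n K k) m 0 k i *
     (40 * \sum_(i' < n K k) wv (`|i' - i|)%N * avg c k i' ^+ 2))).
    apply: ler_sum => k _; apply: ler_sum => i _.
    by apply: ler_wpM2l; [exact: boxmass_ge0|exact: cs].
  have -> : 40 * \sum_(l < 2 ^ K) wv l * (wsum (m l%:R) c K 0 + wsum (m (- l%:R)) c K 0)
     = \sum_(k < K.+1) 40 * \sum_(i' < n K k) \sum_(l < 2 ^ K)
          (wv l * m l%:R k i' * avg c k i' ^+ 2 + wv l * m (- l%:R) k i' * avg c k i' ^+ 2).
    rewrite -mulr_sumr; congr (_ * _).
    under [in RHS]eq_bigr do rewrite exchange_big.
    rewrite [in RHS]exchange_big /=; apply: eq_bigr => l _.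
    rewrite !wsumE mulrDr !mulr_sumr -big_split /=; apply: eq_bigr => k _.
    rewrite !mulr_sumr -big_split /=; apply: eq_bigr => i' _.
    by rewrite mul0n add0n !mulrA.
  apply: ler_sum => k _.
  have kK : (k <= K)%N by rewrite -ltnS ltn_ord.
  under eq_bigr do rewrite mulrCA mulr_sumr.
  rewrite -mulr_sumr ler_wpM2l// exchange_big /=; apply: ler_sum => i' _.
  apply: (@le_trans _ _ (\sum_(l < n K k)
      (wv l * m l%:R k i' * avg c k i' ^+ 2 + wv l * m (- l%:R) k i' * avg c k i' ^+ 2))).
    have pos d l : 0 <= wv l * m d k i' * avg c k i' ^+ 2.
      apply: mulr_ge0; last exact: sqr_ge0.
      by apply: mulr_ge0; [exact: wv0|exact: boxmass_ge0].
    apply: (@sum_offsets_le R (n K k) i' (fun i => m 0 k i * (wv (`|i' - i|)%N * avg c k i' ^+ 2))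
      (fun l => wv l * m l%:R k i' * avg c k i' ^+ 2)
      (fun l => wv l * m (- l%:R) k i' * avg c k i' ^+ 2)) => // i hi.
      rewrite distnEl// (@boxmass_offset k i i' (i' - i)%N%:R) ?natrB//.
      by rewrite mulrCA mulrA.
    rewrite distnEr ?(ltnW hi)// (@boxmass_offset k i i' (- (i - i')%N%:R)).
      by rewrite mulrCA mulrA.
    by rewrite natrB ?opprB// ltnW.
  apply: (sum_le_widen (F := fun l => wv l * m l%:R k i' * avg c k i' ^+ 2 +
    wv l * m (- l%:R) k i' * avg c k i' ^+ 2)); first by rewrite leq_pexp2l// leq_subr.
  move=> l; apply: addr_ge0; apply: mulr_ge0; rewrite ?sqr_ge0//; apply: mulr_ge0;
    rewrite ?wv0 ?boxmass_ge0//.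
apply: (@le_trans _ _ (40 * \sum_(l < 2 ^ K) ws l * (16 * Cm * eps * SC))).
  rewrite ler_wpM2l//; apply: ler_sum => l _.
  have a1 : `|l%:R : R| = l%:R by rewrite normr_nat.
  have a2 : `|- l%:R : R| = l%:R by rewrite normrN normr_nat.
  have := translated_embedding K a1; have := translated_embedding K a2.
  rewrite -/SC => b1 b2.
  have s2 : offs R l ^+ 2 = l.+1%:R by rewrite sqr_sqrtr.
  apply: (@le_trans _ _ (wv l * (16 * l.+1%:R * Cm * eps * SC))).
    by rewrite ler_wpM2l//; lra.
  rewrite -s2 /wv /ws le_eqVlt; apply/orP; left; apply/eqP.
  by field; rewrite gt_eqF.
rewrite -mulr_suml.
have := sum_offsets R (2 ^ K); rewrite -/ws.
have A0 : 0 <= 16 * Cm * eps * SC by rewrite !mulr_ge0// ltW.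
move=> /(ler_wpM2r A0) h.
have -> : (128 * 100) * Cm * eps * SC = 40 * (20 * (16 * Cm * eps * SC)) by ring.
by rewrite ler_wpM2l.
Qed.

End WhitneyEmbedding.

(** * Poisson sums and harmonic majorants *)

Section PoissonKernel.
Variable R : realType.
Variables (eps x0 : R).
Hypothesis eps0 : 0 < eps.

Definition node (j : nat) : R := x0 + j%:R * eps + eps / 2.

(** [2 pi eps] times the Poisson kernel of the half-plane for the boundary point
    at [node j]. *)
Definition kern (j : nat) (y x : R) : R :=
  2 * eps * y / (y ^+ 2 + (x - node j) ^+ 2).

(** On a Whitney box the kernel is comparable to its value for the distance
    between the box and the dyadic interval containing the node. *)
Lemma kern_le (k i i' r : nat) (s : R[i]) : wbox eps x0 0 k i s -> (r < 2 ^ k)%N ->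
  kern (i' * 2 ^ k + r) (height s) (complex.Im s)
    <= 4 * offw R (`|i' - i|)%N * (2 ^+ k)^-1.
Proof.
rewrite /wbox/= mul0r addr0 => -[/andP[y1 y2] /andP[x1 x2]] rk.
move: (height s) (complex.Im s) y1 y2 x1 x2 => y x; rewrite exprS -mulrA.
have [h hE] : {h : R | h = 2 ^+ k * eps} by exists (2 ^+ k * eps).
rewrite -hE => y1 y2' x1 x2.
have h0 : 0 < h by rewrite hE mulr_gt0// exprn_gt0.
have y0 : 0 < y by exact: lt_le_trans h0 y1.
have r1 : r%:R * eps + eps <= h.
  have -> : r%:R * eps + eps = r.+1%:R * eps by rewrite -natr1 mulrDl mul1r.
  by rewrite hE ler_pM2r// -natrX ler_nat.
have r0 : 0 <= r%:R * eps by rewrite mulr_ge0// ltW.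
have xj : node (i' * 2 ^ k + r) = x0 + i'%:R * h + r%:R * eps + eps / 2.
  by rewrite /node natrD natrM natrX hE; ring.
pose l := (`|i' - i|)%N.
have xl : (l.-1)%:R * h <= `|x - node (i' * 2 ^ k + r)|.
  move: x2; rewrite -natr1 mulrDl mul1r => x2; rewrite xj.
  have [ei|ni] := eqVneq i' i; first by rewrite /l ei distnn/= mul0r.
  have [ii|ii] := leqP i' i.
    apply: le_trans (ler_norm _); rewrite /l distnEr// -subn1 !natrB// ?mulrBl ?mulrBl ?mul1r; last first.
      by rewrite subn_gt0 ltn_neqAle ni ii.
    move: x1 r1 (eps0) r0; clear; lra.
  rewrite distrC; apply: le_trans (ler_norm _); rewrite /l distnEl ?(ltnW ii)//.
  rewrite -subn1 !natrB ?(ltnW ii) ?subn_gt0// !mulrBl mul1r.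
  move: x2 r0 (eps0); clear; lra.
have d0 : 0 < y ^+ 2 + (x - node (i' * 2 ^ k + r)) ^+ 2.
  by rewrite ltr_wpDr ?sqr_ge0 ?exprn_gt0.
rewrite /kern ler_pdivrMr// /offw -/l.
set q := 1 + _ ^+ 2.
have q0 : 0 < q by rewrite ltr_wpDr ?sqr_ge0.
have dq : q * h ^+ 2 <= y ^+ 2 + (x - node (i' * 2 ^ k + r)) ^+ 2.
  rewrite /q mulrDl mul1r -exprMn lerD//; first by rewrite lerXn2r ?nnegrE ?(ltW h0) ?(ltW y0).
  rewrite -(real_normK (num_real (x - _))) lerXn2r ?nnegrE ?normr_ge0 ?mulr_ge0 ?(ltW h0)//.
apply: (@le_trans _ _ (4 * q^-1 * (2 ^+ k)^-1 * (q * h ^+ 2))); last first.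
  by rewrite ler_wpM2l// !mulr_ge0// invr_ge0 ?exprn_ge0// ltW.
have -> : 4 * q^-1 * (2 ^+ k)^-1 * (q * h ^+ 2) = 4 * eps * h.
  by rewrite hE; field; rewrite expf_neq0//= gt_eqF.
have : eps * y <= eps * (2 * h) by rewrite ler_pM2l// ltW.
by lra.
Qed.

Variable c : nat -> R.
Hypothesis c0 : forall j, 0 <= c j.

(** The nodes are grouped in dyadic intervals as long as the box. *)
Lemma sum_kern_le (K k i : nat) (s : R[i]) : (k <= K)%N -> wbox eps x0 0 k i s ->
  \sum_(j < 2 ^ K) c j * kern j (height s) (complex.Im s)
  <= 4 * \sum_(i' < 2 ^ (K - k)) offw R (`|i' - i|)%N * avg c k i'.
Proof.
move=> kK sW.
have -> : (2 ^ K = 2 ^ (K - k) * 2 ^ k)%N by rewrite -expnD subnK.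
rewrite (sum_block (fun j => c j * kern j (height s) (complex.Im s))) mulr_sumr.
apply: ler_sum => i' _; rewrite avgE !mulr_sumr; apply: ler_sum => r _.
rewrite [leRHS](_ : _ = c (i' * 2 ^ k + r)%N * (4 * offw R (`|i' - i|)%N * (2 ^+ k)^-1)); last by ring.
by rewrite ler_wpM2l//; apply: kern_le.
Qed.

End PoissonKernel.

Section HardyAreas.
Variable R : realType.
Local Notation lam := (@lebesgue_measure R).
Variables (f : R[i] -> R[i]) (p M : R).
Hypothesis p1 : 1 <= p.
Hypothesis hf : forall z, halfplane z -> hol f z.

Let g (u v : R) : R := normc (f (u +i* v)) `^ p.

Hypothesis fM : forall u : R, 2^-1 < u -> (\int[lam]_v (g u v)%:E <= M%:E)%E.

Let g0 u v : 0 <= g u v. Proof. exact: powR_ge0. Qed.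

Let gx (u v : R) : 2^-1 < u -> {for u, continuous (g ^~ v)}.
Proof. by move=> u2; apply: (cont_powR_horiz p1); apply: hf; exact: u2. Qed.

Let gy (u v : R) : 2^-1 < u -> {for v, continuous (g u)}.
Proof. by move=> u2; apply: (cont_powR_vert p1); apply: hf; exact: u2. Qed.

Let cg (u a b : R) : 2^-1 < u -> cont_on a b (g u).
Proof. by move=> u2 v _; exact: gy. Qed.

Lemma II_le_hardy (u a b : R) : 2^-1 < u -> II a b (g u) <= M.
Proof.
move=> u2; rewrite -lee_fin -(II_fin (@cg u a b u2)).
apply: le_trans (fM u2); apply: ge0_subset_integral => //=.
  apply/measurable_EFinP; apply: continuous_measurable_fun => v; exact: gy.
by move=> v _; rewrite lee_fin.
Qed.

Definition slab (a b c d : R) : \bar R := (\int[lam]_(u in `[a, b]) (II c d (g u))%:E)%E.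

Section Slab.
Variables (a b : R).
Hypotheses (a2 : 2^-1 < a) (ab : a < b).

Let ua (u : R) : a <= u <= b -> 2^-1 < u.
Proof. by move=> /andP[h _]; exact: lt_le_trans h. Qed.

Lemma measurable_slab (c d : R) : measurable_fun `[a, b] (fun u => (II c d (g u))%:E).
Proof.
have := @measurable_inner R g a b c d ab (fun x y _ _ => g0 x y)
  (fun x y h _ => @gx x y (@ua x h)) (fun x y h _ => @gy x y (@ua x h)).
apply: eq_measurable_fun => u; rewrite inE/= in_itv/= => /ua hu.
by rewrite (II_fin (@cg u c d hu)).
Qed.

Lemma slab_ge0 (c d : R) : (0 <= slab a b c d)%E.
Proof. by apply: integral_ge0 => u _; rewrite lee_fin; exact: II_ge0. Qed.

Lemma slab_mono (c d c' d' : R) : c' <= c -> c <= d -> d <= d' ->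
  (slab a b c d <= slab a b c' d')%E.
Proof.
move=> cc cd dd; apply: ge0_le_integral => //.
- by move=> u _; rewrite lee_fin; exact: II_ge0.
- exact: measurable_slab.
- exact: measurable_slab.
- move=> u; rewrite /= in_itv/= => /ua hu; rewrite lee_fin.
  by apply: II_sub => //; exact: cg.
Qed.

Lemma sum_slab_le (n : nat) (c d : nat -> R) (B : R) :
  (forall u, 2^-1 < u -> \sum_(j < n) II (c j) (d j) (g u) <= B) ->
  (\sum_(j < n) slab a b (c j) (d j) <= (B * (b - a))%:E)%E.
Proof.
move=> hB; rewrite /slab -ge0_integral_sum//; last 2 first.
- by move=> j; exact: measurable_slab.
- by move=> j u _; rewrite lee_fin; exact: II_ge0.
have B0 : 0 <= B.
  apply: le_trans (hB a a2); apply: sumr_ge0 => j _; exact: II_ge0.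
apply: (@le_trans _ _ (\int[lam]_(u in `[a, b]) (cst B%:E u))%E).
  apply: ge0_le_integral => //.
  - by move=> u _; apply: sume_ge0 => j _; rewrite lee_fin; exact: II_ge0.
  - by apply: emeasurable_sum => j; exact: measurable_slab.
  - by move=> u; rewrite /= in_itv/= => /ua hu; rewrite sumEFin lee_fin; exact: hB.
by rewrite integral_cst//= lebesgue_measure_itv/= lte_fin ab -EFinB -EFinM.
Qed.

Lemma slab_le (c d : R) : (slab a b c d <= (M * (b - a))%:E)%E.
Proof.
have := @sum_slab_le 1 (fun _ => c) (fun _ => d) M.
by rewrite big_ord1; apply => u hu; rewrite big_ord1; exact: II_le_hardy.
Qed.

End Slab.

(** Three translates of the grid cover the enlarged cells. *)
Lemma sum_cells (u a h : R) (n : nat) : 2^-1 < u -> 0 < h ->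
  \sum_(j < n) II (a + j%:R * h - h) (a + j%:R * h + 2 * h) (g u) <= 3 * M.
Proof.
move=> u2 h0.
have tele (a' : R) : \sum_(j < n) II (a' + j%:R * h) (a' + j%:R * h + h) (g u)
    = II a' (a' + n%:R * h) (g u).
  elim: n => [|n IH].
    by rewrite big_ord0 mul0r addr0 /II set_itv1 Rintegral_set1.
  rewrite big_ord_recr/= IH -natr1 mulrDl mul1r addrA.
  rewrite -(@II_split R a' _ (a' + n%:R * h + h))//; [|lra|exact: cg].
  by rewrite lerDl mulr_ge0// ltW.
have e j : II (a + j%:R * h - h) (a + j%:R * h + 2 * h) (g u) =
    II (a - h + j%:R * h) (a - h + j%:R * h + h) (g u) +
    II (a + j%:R * h) (a + j%:R * h + h) (g u) +
    II (a + h + j%:R * h) (a + h + j%:R * h + h) (g u).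
  rewrite (@II_split R _ (a + j%:R * h + h) (a + j%:R * h + 2 * h))//; try lra; last exact: cg.
  rewrite (@II_split R _ (a + j%:R * h) (a + j%:R * h + h))//; try lra; last exact: cg.
  have -> : a - h + j%:R * h = a + j%:R * h - h by ring.
  have -> : a + h + j%:R * h = a + j%:R * h + h by ring.
  have -> : a + j%:R * h + h + h = a + j%:R * h + 2 * h by ring.
  by rewrite subrK.
under eq_bigr do rewrite e.
rewrite !big_split/= !tele.
have H a' := @II_le_hardy u a' (a' + n%:R * h) u2.
have := H (a - h); have := H a; have := H (a + h); lra.
Qed.

Lemma point_le_slab (x y rho : R) : 0 < rho -> 2^-1 < x - rho ->
  ((rho ^+ 2 * g x y)%:E <=
     (2 * 4 `^ p)%:E * slab (x - rho) (x + rho) (y - rho) (y + rho))%E.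
Proof.
move=> rho0 x2.
have hsq z : in_csq x y rho z -> hol f z.
  move=> /andP[/andP[z1 _] _]; apply: hf; exact: lt_le_trans x2 z1.
apply: le_trans (area_estimate p1 rho0 hsq) _.
rewrite le_eqVlt; apply/orP; left; apply/eqP; congr (_ * _)%E.
apply: eq_integral => u; rewrite inE/= in_itv/= => /andP[h1 _].
by rewrite (II_fin (@cg u _ _ (lt_le_trans x2 h1))).
Qed.

(** The Hardy norm bounds the area integral over a strip, hence [f] itself at a
    positive distance from the boundary. *)
Lemma hardy_point_le (x y rho : R) : 0 < rho -> 2^-1 < x - rho ->
  g x y <= 4 * 4 `^ p * M / rho.
Proof.
move=> rho0 x2.
have xr : x - rho < x + rho by lra.
have := point_le_slab y rho0 x2.
have /(lee_wpmul2l (_ : 0 <= (2 * 4 `^ p)%:E)%E) h := slab_le x2 xr (y - rho) (y + rho).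
move=> /le_trans/(_ (h _)); rewrite lee_fin mulr_ge0 ?powR_ge0// => /(_ isT).
rewrite -EFinM lee_fin => h1.
rewrite ler_pdivlMr// -(@ler_pM2l _ rho)//.
have -> : rho * (g x y * rho) = rho ^+ 2 * g x y by ring.
apply: le_trans h1 _; rewrite le_eqVlt; apply/orP; left; apply/eqP; ring.
Qed.

(** [c j ^+ 2] is the bound of the area estimate of radius [eps / 2], taken over
    a slab that contains the squares around all points of the cell [j]; by
    [sum_cells] these slabs overlap at most three times. *)
Lemma line_majorant (eps x0 : R) (n : nat) : 0 < eps ->
  exists c : nat -> R, [/\ forall j, 0 <= c j,
    forall j v, (j < n)%N -> x0 + j%:R * eps <= v <= x0 + j%:R * eps + eps ->
      normc (f ((2^-1 + eps) +i* v)) `^ (p / 2) <= c j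
    & eps * \sum_(j < n) c j ^+ 2 <= 24 * 4 `^ p * M].
Proof.
move=> eps0; pose rho := eps / 2; pose u0 := 2^-1 + eps.
have rho0 : 0 < rho by rewrite /rho; lra.
have a2 : 2^-1 < u0 - rho by rewrite /u0 /rho; lra.
have ab : u0 - rho < u0 + rho by lra.
pose S j := slab (u0 - rho) (u0 + rho) (x0 + j%:R * eps - eps) (x0 + j%:R * eps + 2 * eps).
have S0 j : (0 <= S j)%E by exact: slab_ge0.
have Sfin j : (S j \is a fin_num)%E.
  by rewrite ge0_fin_numE// (le_lt_trans (slab_le a2 ab _ _))// ltry.
pose K := 2 * 4 `^ p / rho ^+ 2.
have K0 : 0 <= K by rewrite divr_ge0 ?mulr_ge0 ?powR_ge0 ?exprn_ge0// ltW.
have KS j : 0 <= K * fine (S j) by rewrite mulr_ge0// fine_ge0.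
exists (fun j => Num.sqrt (K * fine (S j))); split.
- by move=> j; exact: sqrtr_ge0.
- move=> j v jn /andP[v1 v2].
  rewrite -(@ler_pXn2r _ 2) ?nnegrE ?powR_ge0 ?sqrtr_ge0//.
  rewrite sqr_sqrtr// -powR_mulrn ?powR_ge0// -powRrM divfK//.
  have h1 := point_le_slab v rho0 a2.
  have h2 : (slab (u0 - rho) (u0 + rho) (v - rho) (v + rho) <= S j)%E.
    by apply: slab_mono => //; rewrite /rho; lra.
  have : ((rho ^+ 2 * g u0 v)%:E <= (2 * 4 `^ p)%:E * S j)%E.
    by apply: le_trans h1 _; apply: lee_wpmul2l => //; rewrite lee_fin mulr_ge0 ?powR_ge0.
  rewrite -(fineK (Sfin j)) -EFinM lee_fin => h3.
  rewrite -(@ler_pM2l _ (rho ^+ 2)) ?exprn_gt0//; apply: le_trans h3 _.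
  rewrite /K le_eqVlt; apply/orP; left; apply/eqP; field.
  by rewrite gt_eqF.
- under eq_bigr do rewrite sqr_sqrtr//.
  rewrite -mulr_sumr.
  have : (\sum_(j < n) S j <= (3 * M * (u0 + rho - (u0 - rho)))%:E)%E.
    apply: (sum_slab_le a2 ab (c := fun j => x0 + j%:R * eps - eps)
      (d := fun j => x0 + j%:R * eps + 2 * eps)) => u hu.
    exact: sum_cells.
  have -> : (\sum_(j < n) S j)%E = (\sum_(j < n) fine (S j))%:E.
    by rewrite -sumEFin; apply: eq_bigr => j _; rewrite fineK.
  rewrite lee_fin => h.
  have eK : 0 <= eps * K by rewrite mulr_ge0// ltW.
  move: h => /(ler_wpM2l eK); rewrite mulrA => /le_trans; apply.
  rewrite le_eqVlt; apply/orP; left; apply/eqP; rewrite /K /rho; field.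
  by rewrite gt_eqF.
Qed.

End HardyAreas.

Section HarmonicMajorant.
Variable R : realType.
Local Notation lam := (@lebesgue_measure R).

Definition pole (eps x0 : R) (j : nat) : R[i] := 2^-1 +i* node eps x0 j.

Lemma kern_ge0 (eps x0 : R) j y x : 0 < eps -> 0 <= y -> 0 <= kern eps x0 j y x.
Proof.
move=> e0 y0; rewrite /kern divr_ge0 ?addr_ge0 ?sqr_ge0//.
by rewrite !mulr_ge0// ltW.
Qed.

Lemma Re_cauchy_kernel (eps x0 : R) j (s : R[i]) :
  complex.Re ((2 * eps)%:C / (s - pole eps x0 j)) =
  kern eps x0 j (height s) (complex.Im s).
Proof.
case: s => a b; rewrite /kern /height /pole /= !mul0r !subr0.
by rewrite mulrA.
Qed.

Lemma subr_pole_neq0 (eps x0 : R) j (s : R[i]) : halfplane s -> s - pole eps x0 j != 0.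
Proof.
move=> hs; apply/eqP => /(congr1 (@complex.Re R)).
move: hs; rewrite /halfplane/= cReD cReN /=; lra.
Qed.

Definition poisson_sum (eps x0 : R) (c : nat -> R) (n : nat) (y x : R) : R :=
  \sum_(j < n) c j * kern eps x0 j y x.

Lemma ReZ (a : R) (z : R[i]) : complex.Re (a%:C * z) = a * complex.Re z.
Proof. by rewrite cReM /= mul0r subr0. Qed.

Lemma Re_sum (n : nat) (F : nat -> R[i]) :
  complex.Re (\sum_(j < n) F j) = \sum_(j < n) complex.Re (F j).
Proof.
elim: n => [|n IH]; first by rewrite !big_ord0.
by rewrite !big_ord_recr/= cReD IH.
Qed.

Variables (f : R[i] -> R[i]) (p M : R).
Hypothesis p1 : 1 <= p.
Hypothesis hf : forall z, halfplane z -> hol f z.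
Hypothesis fM : forall u : R, 2^-1 < u ->
  (\int[lam]_v (normc (f (u +i* v)) `^ p)%:E <= M%:E)%E.

Let q := p / 2.
Let q0 : 0 < q. Proof. by rewrite /q; have := p1; lra. Qed.

(** Dividing by [damp eta] makes [f] tend to [0] at infinity, at no cost in a
    bounded region when [eta] is small. *)
Definition damp (eta : R) (s : R[i]) : R[i] := 1 + eta%:C * (s - 2^-1%:C).

Lemma damp_ge_height eta s : 0 < eta -> eta * height s <= normc (damp eta s).
Proof.
move=> eta0; apply: le_trans (le_Re_normc _); apply: le_trans (ler_norm _).
by rewrite /damp cReD ReZ cReD cReN /= /height; lra.
Qed.

Lemma damp_ge_Im eta s : 0 < eta -> eta * `|complex.Im s| <= normc (damp eta s).
Proof.
move=> eta0; apply: le_trans (le_Im_normc _).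
rewrite /damp cImD cImM /= mul0r addr0 add0r cImD cImN /= oppr0 addr0.
by rewrite normrM gtr0_norm.
Qed.

Lemma damp_ge1 eta s : 0 < eta -> 0 <= height s -> 1 <= normc (damp eta s).
Proof.
move=> eta0 h0; apply: le_trans (le_Re_normc _); apply: le_trans (ler_norm _).
rewrite /damp cReD ReZ cReD cReN /= lerDl mulr_ge0//; exact: ltW.
Qed.

Lemma hol_damp eta s : hol (damp eta) s.
Proof.
apply: holD; first exact: (@hol_cst R 1 s).
apply: holM; first exact: (@hol_cst R _ s).
by apply: holB; [exact: (@hol_id R s)|exact: (@hol_cst R _ s)].
Qed.

(** The maximum principle on a large rectangle.  On its left side [y = eps] the
    term [c_j kern_j] of the cell alone dominates [|f|^(p/2)]; on the other
    sides the damped function is at most [delta]. *)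
Lemma hardy_majorant (eps delta eta : R) : 0 < eps -> 0 < delta -> 0 < eta ->
  exists K0 : nat, forall K, (K0 <= K)%N -> exists c : nat -> R,
  [/\ forall j, 0 <= c j,
    eps * \sum_(j < 2 ^ K) c j ^+ 2 <= 24 * 4 `^ p * M &
    forall s, eps <= height s <= 2 ^+ K * eps -> `|complex.Im s| <= 2 ^+ K * eps / 2 ->
      normc (f s / damp eta s) `^ q <=
      delta + poisson_sum eps (- (2 ^+ K * eps / 2)) c (2 ^ K) (height s) (complex.Im s)].
Proof.
move=> eps0 delta0 eta0.
pose B := 4 * 4 `^ p * M / (eps / 2); pose b := Num.sqrt B.
have b0 : 0 <= b by exact: sqrtr_ge0.
have fb s : eps <= height s -> normc (f s) `^ q <= b.
  move=> hs; case: s hs => x y hs.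
  have r0 : 0 < eps / 2 by lra.
  have := @hardy_point_le R f p M p1 hf fM x y (eps / 2) r0.
  have -> : (2^-1 < x - eps / 2) = true by move: hs; rewrite /height/=; lra.
  move=> /(_ isT); rewrite -/B => h.
  have B0 : 0 <= B by apply: le_trans h; exact: powR_ge0.
  rewrite -(@ler_pXn2r _ 2) ?nnegrE ?powR_ge0// sqr_sqrtr//.
  by rewrite -powR_mulrn ?powR_ge0// -powRrM /q divfK.
(* [b / L^q <= delta], and the rectangle is so large that [|damp| >= L] on its
   three far sides. *)
pose L := (b / delta + 1) `^ q^-1.
have L1 : 0 < b / delta + 1 by rewrite ltr_wpDl ?divr_ge0// ltW.
have L0 : 0 < L by exact: powR_gt0.
have Lq : L `^ q = b / delta + 1 by rewrite /L -powRrM mulVf ?gt_eqF// powRr1// ltW.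
have [K0 hK0] : exists K0 : nat, 2 * L / (eta * eps) <= K0%:R.
  by exists (Num.truncn (2 * L / (eta * eps))).+1; apply: ltW; exact: truncnS_gt.
exists K0 => K KK; pose X := 2 ^+ K * eps / 2.
have XL : L <= eta * X.
  have : 2 * L / (eta * eps) <= 2 ^+ K.
    apply: le_trans hK0 _; rewrite -natrX ler_nat (leq_trans KK)//.
    by rewrite ltnW// ltn_expl.
  rewrite ler_pdivrMr ?mulr_gt0// /X; lra.
have X0 : 0 < X by rewrite /X divr_gt0// mulr_gt0// exprn_gt0.
have [c [c0 hc sc]] := @line_majorant R f p M p1 hf fM eps (- X) (2 ^ K)%N eps0.
exists c; split => //.
pose G s : R[i] := delta%:C +
  \sum_(j < 2 ^ K) (c j)%:C * ((2 * eps)%:C / (s - pole eps (- X) j)).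
have GE s : complex.Re (G s) =
    delta + poisson_sum eps (- X) c (2 ^ K) (height s) (complex.Im s).
  rewrite /G cReD (Re_sum _ (fun j => (c j)%:C * ((2 * eps)%:C / (s - pole eps (- X) j)))).
  by congr (_ + _); apply: eq_bigr => j _; rewrite ReZ Re_cauchy_kernel.
pose rect := in_rect (2^-1 + eps) (2^-1 + 2 ^+ K * eps) (- X) X.
have rectE s : (eps <= height s <= 2 ^+ K * eps) && (`|complex.Im s| <= X) = rect s.
  by rewrite /rect /in_rect /height ler_norml lerBrDl lerBlDl.
have rect_hp s : rect s -> halfplane s.
  by rewrite -rectE /halfplane/= /height => /andP[/andP[h _] _]; lra.
have rect_h s : rect s -> eps <= height s by rewrite -rectE => /andP[/andP[]].
have ps0 s : rect s -> 0 <= poisson_sum eps (- X) c (2 ^ K) (height s) (complex.Im s).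
  move=> /rect_h hs; apply: sumr_ge0 => j _; rewrite mulr_ge0// kern_ge0//; lra.
have fd s : rect s -> normc (f s / damp eta s) `^ q =
    normc (f s) `^ q / normc (damp eta s) `^ q.
  move=> rs; have d0 : 0 < normc (damp eta s).
    apply: lt_le_trans ltr01 (damp_ge1 eta0 _); have := rect_h _ rs; lra.
  rewrite normcM normcV powRM ?normc_ge0 ?invr_ge0 ?normc_ge0//.
  congr (_ * _); rewrite -(powR_inv1 (normc_ge0 (damp eta s))) -powRrM mulN1r.
  by rewrite powRN.
suff main s : rect s -> normc (f s / damp eta s) `^ q <= complex.Re (G s).
  by move=> s s1 s2; rewrite -GE; apply: main; rewrite -rectE s1.
move=> rs; apply: (@max_principle R (fun s => f s / damp eta s) G q _ _ _ _ q0 _ _ _ _ s rs) => {s rs} s rs.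
- apply: holM; first exact: (hf (rect_hp _ rs)).
  apply: holV; last exact: hol_damp.
  rewrite -normc_eq0 gt_eqF// (lt_le_trans ltr01)// damp_ge1//.
  have := rect_h _ rs; lra.
- apply: holD; first exact: (@hol_cst R _ s).
  apply: (hol_sum (F := fun j s => (c j)%:C * ((2 * eps)%:C / (s - pole eps (- X) j)))) => j _.
  apply: holM; first exact: (@hol_cst R _ s).
  apply: holM; first exact: (@hol_cst R _ s).
  apply: holV; first exact: (subr_pole_neq0 _ _ _ (rect_hp _ rs)).
  by apply: holB; [exact: (@hol_id R s)|exact: (@hol_cst R _ s)].
- by rewrite GE; have := ps0 _ rs; lra.
- move=> bd; rewrite GE.
  have hs := rect_h _ rs; have fs := fb _ hs; have ps := ps0 _ rs.
  have small : L <= normc (damp eta s) -> normc (f s / damp eta s) `^ q <= delta.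
    move=> Ld; rewrite fd// ler_pdivrMr; last by rewrite powR_gt0// (lt_le_trans L0).
    apply: le_trans fs _; apply: (@le_trans _ _ (delta * L `^ q)).
      by rewrite Lq mulrDr mulr1 mulrCA mulfV ?gt_eqF// mulr1; lra.
    by rewrite ler_pM2l//; apply: ge0_ler_powR; rewrite ?nnegrE ?normc_ge0// ltW.
  have [ReE|nRe] := eqVneq (complex.Re s) (2^-1 + eps); last first.
    apply: (@le_trans _ _ delta); last by lra.
    apply: small; move: bd; rewrite (negbTE nRe)/= => /or3P[/eqP e|/eqP e|/eqP e].
    + apply: le_trans XL (le_trans _ (damp_ge_height _ eta0)); rewrite ler_pM2l//.
      by rewrite /height e /X; have : 0 < 2 ^+ K * eps by [rewrite mulr_gt0// exprn_gt0]; lra.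
    + apply: le_trans XL (le_trans _ (damp_ge_Im _ eta0)); rewrite ler_pM2l// e normrN.
      by rewrite gtr0_norm.
    + apply: le_trans XL (le_trans _ (damp_ge_Im _ eta0)); rewrite ler_pM2l// e.
      by rewrite gtr0_norm.
  have [ImX|nIm] := eqVneq (complex.Im s) X.
    apply: (@le_trans _ _ delta); last by lra.
    apply: small; apply: le_trans XL (le_trans _ (damp_ge_Im _ eta0)).
    by rewrite ler_pM2l// ImX gtr0_norm.
  have /andP[_ /andP[Im1 Im2]] := rs.
  have Im3 : complex.Im s < X by rewrite lt_neqAle nIm.
  pose j := Num.truncn ((complex.Im s + X) / eps).
  have t0 : 0 <= (complex.Im s + X) / eps by rewrite divr_ge0 ?(ltW eps0)//; lra.
  have /andP[j1 j2] := truncn_itv t0; rewrite -/j in j1 j2.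
  have Im4 : - X + j%:R * eps <= complex.Im s <= - X + j%:R * eps + eps.
    move: j1 j2; rewrite ler_pdivlMr// ltr_pdivrMr// -natr1 mulrDl mul1r => j1 j2.
    by apply/andP; split; lra.
  have jK : (j < 2 ^ K)%N.
    rewrite -(ltr_nat R) natrX; apply: le_lt_trans j1 _.
    by rewrite ltr_pdivrMr//; move: Im3; rewrite /X; lra.
  have hcs := hc j _ jK Im4.
  have sE : s = (2^-1 + eps) +i* complex.Im s by rewrite -ReE; case: (s).
  have hE : height s = eps by rewrite /height ReE; lra.
  have d1 : 1 <= normc (damp eta s) by rewrite damp_ge1// hE ltW.
  apply: (@le_trans _ _ (c j)).
    rewrite fd// ler_pdivrMr; last by rewrite powR_gt0// (lt_le_trans ltr01).
    rewrite {1}sE; apply: le_trans hcs _; rewrite ler_peMr//.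
    have : 1 `^ q <= normc (damp eta s) `^ q.
      by apply: ge0_ler_powR; rewrite ?nnegrE ?normc_ge0// ltW.
    by rewrite powR1.
  apply: (@le_trans _ _ (c j * kern eps (- X) j (height s) (complex.Im s))).
    rewrite ler_peMr// /kern hE /node ler_pdivlMr; last first.
      by rewrite ltr_wpDr ?sqr_ge0// exprn_gt0.
    rewrite mul1r; move: Im4 => /andP[k1 k2].
    have : `|complex.Im s - (- X + j%:R * eps + eps / 2)| <= eps.
      by rewrite ler_norml; apply/andP; split; lra.
    move=> /(lerXn2r 2); rewrite !nnegrE normr_ge0 (ltW eps0) real_normK ?num_real//.
    by move=> /(_ isT isT); rewrite -(mulrA 2); move: (_ - _) => v; lra.
  rewrite /poisson_sum (bigD1 (Ordinal jK))//=.
  rewrite addrCA lerDl addr_ge0 ?(ltW delta0)//; apply: sumr_ge0 => i _.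
  by rewrite mulr_ge0// kern_ge0// hE ltW.
Qed.

End HarmonicMajorant.

(** * The embedding of the Hardy space *)

Section StepBound.
Context d (T : measurableType d) (R : realType).
Variables (mu : {measure set T -> \bar R}) (S : set T) (F : T -> R).
Hypotheses (mS : measurable S) (mF : measurable_fun S F).
Hypothesis F0 : forall s, S s -> 0 <= F s.

Lemma integral_le_steps (I : finType) (W : I -> set T) (a m : R) (b w : I -> R) :
  0 <= a -> (forall i, 0 <= b i) -> (forall i, measurable (W i)) ->
  (mu S <= m%:E)%E -> (forall i, mu (W i) <= (w i)%:E)%E ->
  (forall s, S s -> exists2 i, W i s & F s <= a + b i) ->
  (\int[mu]_(s in S) (F s)%:E <= (a * m + \sum_i b i * w i)%:E)%E.
Proof.
move=> a0 b0 mW mSm mWw FW.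
apply: (@le_trans _ _ (\int[mu]_(s in S)
    (cst a%:E s + \sum_(i <- index_enum I) (b i)%:E * (\1_(W i) s)%:E))%E).
  apply: ge0_le_integral => //.
  - exact/measurable_EFinP.
  - apply: emeasurable_funD => //; apply: emeasurable_sum => i.
    apply: measurable_funeM; apply/measurable_EFinP; exact: measurable_indic.
  - move=> s Ss; have [i Wi Fi] := FW _ Ss.
    rewrite (_ : (\sum_(i <- _) _)%E = (\sum_(i <- index_enum I) b i * \1_(W i) s)%:E); last first.
      by rewrite -sumEFin; apply: eq_bigr => j _; rewrite EFinM.
    rewrite -EFinD lee_fin; apply: le_trans Fi _; rewrite lerD2l.
    rewrite (bigD1 i)//= indicE mem_set// mulr1 lerDl.
    by apply: sumr_ge0 => j _; rewrite mulr_ge0.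
rewrite ge0_integralD//; first last.
- apply: emeasurable_sum => i.
  apply: measurable_funeM; apply/measurable_EFinP; exact: measurable_indic.
- by move=> s _; apply: sume_ge0 => i _; rewrite mule_ge0 ?lee_fin.
rewrite integral_cst// EFinD; apply: leeD.
  by rewrite EFinM; apply: lee_wpmul2l; rewrite ?lee_fin.
rewrite ge0_integral_sum//; last 2 first.
- move=> i; apply: measurable_funeM; apply/measurable_EFinP; exact: measurable_indic.
- by move=> i s _; rewrite mule_ge0 ?lee_fin.
rewrite -sumEFin; apply: lee_sum => i _.
rewrite ge0_integralZl_EFin//; last by apply/measurable_EFinP; exact: measurable_indic.
rewrite integral_indic// EFinM; apply: lee_wpmul2l; first by rewrite lee_fin.
apply: le_trans (mWw i); apply: le_measure; rewrite ?inE//; exact: measurableI.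
Qed.

End StepBound.

Section HalfplaneEmbedding.
Variable R : realType.
Local Notation lam := (@lebesgue_measure R).

Lemma measurable_normc_powR (f : R[i] -> R[i]) (p : R) : 0 < p ->
  (forall z, halfplane z -> hol f z) ->
  measurable_fun (@halfplane R : set (borelC R)) (fun s => normc (f s) `^ p).
Proof.
move=> p0 hf; apply: (measurability _ (RGenOpens.measurableE R)).
move=> _ [_ [a [b ->] <-]]; apply: open_measurableC.
rewrite openE => s [hs] /= fs.
have cs := continuous_normc_powR p0 (hol_continuous (hf s hs)).
rewrite /interior; apply: filterI.
  have /continuousCR_normcP h := @continuous_Re R s.
  apply/nbhs_normcP; have [d d0 H] := h (complex.Re s - 2^-1) (ltac:(move: hs; rewrite /halfplane/=; lra)).
  exists d => // w /H; rewrite ltr_norml /halfplane/=; lra.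
have : nbhs (normc (f s) `^ p) (`]a, b[%classic : set R).
  by apply: open_nbhs_nbhs; split => //; exact: interval_open.
exact: cs.
Qed.

Lemma wbox_cover (eps : R) (K : nat) (s : R[i]) : 0 < eps ->
  eps <= height s < 2 ^+ K.+1 * eps -> - (2 ^+ K * eps / 2) <= complex.Im s < 2 ^+ K * eps / 2 ->
  exists (k : 'I_K.+1) (i : 'I_(2 ^ (K - k))), wbox eps (- (2 ^+ K * eps / 2)) 0 k i s.
Proof.
move=> eps0 hs /andP[x1 x2]; set X := 2 ^+ K * eps / 2 in x1 x2 *.
have [k kK hk] : exists2 k, (k < K.+1)%N & 2 ^+ k * eps <= height s < 2 ^+ k.+1 * eps.
  elim: K.+1 hs => [|n IH] /andP[h1 h2].
    by move: h2; rewrite expr0 mul1r ltNge h1.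
  have [h3|h3] := ltP (height s) (2 ^+ n * eps); last by exists n => //; rewrite h3.
  by have [|k kn hk] := IH; [rewrite h1|exists k => //; exact: ltnW].
have k0 : 0 < 2 ^+ k * eps by rewrite mulr_gt0// exprn_gt0.
pose i := Num.truncn ((complex.Im s + X) / (2 ^+ k * eps)).
have t0 : 0 <= (complex.Im s + X) / (2 ^+ k * eps) by rewrite divr_ge0 ?(ltW k0)//; lra.
have /andP[j1 j2] := truncn_itv t0; rewrite -/i in j1 j2.
have iK : (i < 2 ^ (K - k))%N.
  rewrite -(ltr_nat R) natrX; apply: le_lt_trans j1 _.
  rewrite ltr_pdivrMr// mulrA -exprD subnK; last by rewrite -ltnS.
  by move: x2; rewrite /X; lra.
exists (Ordinal kK), (Ordinal iK); split => //=.
move: j1 j2; rewrite ler_pdivlMr// ltr_pdivrMr// mul0r addr0 => j1 j2.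
by apply/andP; split; lra.
Qed.

Variable mu : {measure set (borelC R) -> \bar R}.
Variable Cm : R.
Hypothesis Cm0 : 0 < Cm.
Hypothesis carleson_square :
  forall t h : R, 0 < h -> (mu (strip t h h) <= (Cm * h)%:E)%E.
Variables (f : R[i] -> R[i]) (p M : R).
Hypothesis p1 : 1 <= p.
Hypothesis hf : forall z, halfplane z -> hol f z.
Hypothesis fM : forall u : R, 2^-1 < u ->
  (\int[lam]_v (normc (f (u +i* v)) `^ p)%:E <= M%:E)%E.

Let p0 : 0 < p. Proof. by rewrite (lt_le_trans _ p1). Qed.

Definition region (eps Y : R) : set (borelC R) :=
  [set s | eps <= height s <= Y /\ `|complex.Im s| <= Y].

Lemma measurable_region eps Y : measurable (region eps Y).
Proof.
rewrite (_ : region eps Y = [set s | (complex.Re s \in `[2^-1 + eps, 2^-1 + Y])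
    /\ (complex.Im s \in `[- Y, Y])]).
  exact: measurable_ReIm.
by apply/seteqP; split => s /=; rewrite /region/= /height !in_itv/= lerBrDl lerBlDl ler_norml.
Qed.

Definition embedding_cst : R := 32 * 2 `^ p * (128 * 100) * Cm * (24 * 4 `^ p).

Lemma damp_le2 (Y : R) (s : R[i]) : 0 < Y -> 0 <= height s <= Y -> `|complex.Im s| <= Y ->
  normc (damp (2 * Y)^-1 s) <= 2.
Proof.
move=> Y0 /andP[s1 s2] s3.
have e0 : 0 < (2 * Y)^-1 by rewrite invr_gt0 mulr_gt0.
apply: le_trans (le_normcD _ _) _.
rewrite normc1 -lerBrDl.
have -> : (2 : R) - 1 = 1 by lra.
rewrite normcM normcR gtr0_norm//.
rewrite ler_pdivrMl ?mulr_gt0// mulr1; apply: le_trans (normc_le_ReIm _) _.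
have -> : complex.Re (s - 2^-1%:C) = height s by rewrite cReD cReN.
have -> : complex.Im (s - 2^-1%:C) = complex.Im s by rewrite cImD cImN /= subr0.
rewrite ger0_norm//; lra.
Qed.

(** On each box of the region [|f|^p] is at most a constant times [delta^2]
    plus the square of the weighted averages of [hardy_majorant]; the sum over
    the boxes is [whitney_embedding], and [delta] is arbitrary. *)
Lemma integral_region_le (eps Y : R) : 0 < eps -> eps <= Y ->
  (\int[mu]_(s in region eps Y) (normc (f s) `^ p)%:E <= (embedding_cst * M)%:E)%E.
Proof.
move=> eps0 epsY; have Y0 : 0 < Y by lra.
have mreg : measurable_fun (region eps Y) (fun s => normc (f s) `^ p).
  apply: measurable_funS (measurable_normc_powR p0 hf); first exact: measurable_halfplane.
  by move=> s [/andP[h _] _]; move: h; rewrite /height /halfplane/=; lra.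
have [m m0 mum] : exists2 m : R, 0 < m & (mu (region eps Y) <= m%:E)%E.
  exists (Cm * (2 * Y + 1)); first by rewrite mulr_gt0//; lra.
  apply: le_trans (carleson_square (- Y) (_ : 0 < 2 * Y + 1)); last by lra.
  apply: le_measure; rewrite ?inE; [exact: measurable_region|exact: measurable_strip|].
  move=> s [/andP[h1 h2] h3]; move: h3; rewrite ler_norml => /andP[h3 h4].
  by split; apply/andP; split => //; lra.
have P2 : 0 < 2 `^ p :> R by exact: powR_gt0.
apply/lee_addgt0Pr => e e0.
pose delta := Num.sqrt (e / (2 * 2 `^ p * m)).
have d2 : 0 < e / (2 * 2 `^ p * m) by rewrite divr_gt0// !mulr_gt0.
have delta0 : 0 < delta by rewrite sqrtr_gt0.
have dE : delta ^+ 2 = e / (2 * 2 `^ p * m) by rewrite sqr_sqrtr// ltW.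
have eta0 : 0 < (2 * Y)^-1 by rewrite invr_gt0 mulr_gt0.
have [K0 hK0] := hardy_majorant p1 hf fM eps0 delta0 eta0.
have [K KK KY] : exists2 K, (K0 <= K)%N & 2 * Y < 2 ^+ K * eps.
  pose n := (Num.truncn (2 * Y / eps)).+1.
  exists (K0 + n)%N; first exact: leq_addr.
  rewrite -ltr_pdivrMr//; apply: (@lt_le_trans _ _ n%:R); first exact: truncnS_gt.
  by rewrite -natrX ler_nat ltnW// (leq_ltn_trans (leq_addl K0 n))// ltn_expl.
have [c [c0 sc hc]] := hK0 K KK.
pose X := 2 ^+ K * eps / 2.
pose AV (k i : nat) := \sum_(i' < 2 ^ (K - k)) offw R (`|i' - i|)%N * avg c k i'.
pose I := {k : 'I_K.+1 & 'I_(2 ^ (K - k))}.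
pose W (j : I) := wbox eps (- X) 0 (tag j) (tagged j).
have zero : `|0 : R| = 0%:R by rewrite normr0.
have H := @integral_le_steps _ (borelC R) R mu (region eps Y) (fun s => normc (f s) `^ p)
  (measurable_region eps Y) mreg (fun s _ => powR_ge0 _ _) I W (2 * 2 `^ p * delta ^+ 2) m
  (fun j => 32 * 2 `^ p * AV (tag j) (tagged j) ^+ 2)
  (fun j => boxmass mu eps (- X) 0 (tag j) (tagged j)).
apply: le_trans (H _ _ _ mum _ _) _ => {H}.
- apply: mulr_ge0; last exact: sqr_ge0.
  by rewrite mulr_ge0 ?ltW.
- move=> j; apply: mulr_ge0; last exact: sqr_ge0.
  by rewrite mulr_ge0 ?ltW.
- by move=> j; exact: measurable_wbox.
- by move=> j; rewrite (boxmassE carleson_square _ eps0 _ _ zero).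
- move=> s [/andP[s1 s2] s3].
  have [||k [i sW]] := @wbox_cover eps K s eps0.
  + by rewrite s1 exprS -mulrA /=; lra.
  + by move: s3; rewrite ler_norml => /andP[s4 s5]; apply/andP; split; lra.
  exists (Tagged (fun k : 'I_K.+1 => 'I_(2 ^ (K - k))) i) => //=.
  have hs0 : 0 <= height s by lra.
  have := hc s; rewrite s1 => /(_ (ltac:(rewrite /=; lra)) (ltac:(lra))).
  set P := poisson_sum _ _ _ _ _ _ => fs.
  have P0 : 0 <= P by apply: sumr_ge0 => j _; rewrite mulr_ge0// kern_ge0.
  have kK : (k <= K)%N by rewrite -ltnS ltn_ord.
  have PA : P <= 4 * AV k i by exact: sum_kern_le.
  set dm := damp _ s in fs.
  have dm1 : 1 <= normc dm by exact: damp_ge1.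
  have dm2 : normc dm <= 2 by apply: damp_le2; rewrite // hs0.
  have fE : normc (f s) = normc (f s / dm) * normc dm.
    by rewrite -normcM divfK// -normc_eq0 gt_eqF// (lt_le_trans ltr01).
  rewrite fE powRM ?normc_ge0//.
  have e1 : normc (f s / dm) `^ p = (normc (f s / dm) `^ (p / 2)) ^+ 2.
    by rewrite -powR_mulrn ?powR_ge0// -powRrM divfK.
  have e2 : normc (f s / dm) `^ p <= 2 * delta ^+ 2 + 32 * AV k i ^+ 2.
    rewrite e1; apply: (@le_trans _ _ ((delta + 4 * AV k i) ^+ 2)).
      rewrite lerXn2r ?nnegrE ?powR_ge0//; last by lra.
      by rewrite addr_ge0 ?(ltW delta0)//; lra.
    by have := sqr_ge0 (delta - 4 * AV k i); move: (AV k i) (delta) => x y; lra.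
  have e3 : normc dm `^ p <= 2 `^ p by apply: ge0_ler_powR; rewrite ?nnegrE ?normc_ge0//; exact: ltW.
  apply: le_trans (ler_pM _ _ e2 e3) _; rewrite ?powR_ge0//.
  by rewrite le_eqVlt; apply/orP; left; apply/eqP; ring.
rewrite -EFinD lee_fin.
have -> : 2 * 2 `^ p * delta ^+ 2 * m = e.
  by rewrite dE; field; rewrite !gt_eqF//.
rewrite addrC lerD2r.
have := whitney_embedding (- X) Cm0 eps0 carleson_square c K.
rewrite -/AV => emb.
rewrite -(sig_big_dep (J := fun k : 'I_K.+1 => 'I_(2 ^ (K - k))) xpredT (fun _ => xpredT)
  (fun k i => 32 * 2 `^ p * AV k i ^+ 2 * boxmass mu eps (- X) 0 k i))/=.
apply: (@le_trans _ _ (32 * 2 `^ p * ((128 * 100) * Cm * eps * \sum_(j < 2 ^ K) c j ^+ 2))).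
  rewrite -(ler_pM2l (_ : 0 < 32 * 2 `^ p)) in emb; last by rewrite mulr_gt0.
  apply: le_trans emb; rewrite mulr_sumr le_eqVlt; apply/orP; left; apply/eqP.
  apply: eq_bigr => k _; rewrite mulr_sumr; apply: eq_bigr => i _.
  by rewrite -/(AV k i); ring.
have C0 : 0 <= 32 * 2 `^ p * (128 * 100) * Cm.
  by rewrite !mulr_ge0 ?powR_ge0 ?(ltW Cm0)//.
move: sc => /(ler_wpM2l C0) h; apply: le_trans (le_trans h _).
  by rewrite le_eqVlt; apply/orP; left; apply/eqP; ring.
by rewrite /embedding_cst le_eqVlt; apply/orP; left; apply/eqP; ring.
Qed.

(** Monotone convergence along an exhaustion of the half-plane: the bound of
    [integral_region_le] does not depend on the region. *)
Theorem carleson_square_embedding :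
  (\int[mu]_(s in @halfplane R) (normc (f s) `^ p)%:E <= (embedding_cst * M)%:E)%E.
Proof.
pose S (n : nat) := region (n.+1%:R)^-1 n.+1%:R.
have n1 n : 1 <= (n.+1%:R : R) by rewrite ler1n.
have n0 n : 0 < (n.+1%:R : R) by [].
have i1 n : (n.+1%:R : R)^-1 <= 1 by rewrite invf_le1.
have SU : \bigcup_n S n = @halfplane R.
  apply/seteqP; split => s.
    move=> [n _ [/andP[h _] _]]; rewrite /halfplane/=.
    by rewrite -subr_gt0 (lt_le_trans _ h)// invr_gt0.
  rewrite /halfplane/= => hs; have h0 : 0 < height s by rewrite /height; lra.
  pose y := (height s)^-1 + height s + `|complex.Im s|.
  have i0 : 0 < (height s)^-1 by rewrite invr_gt0.
  have a0 : 0 <= `|complex.Im s| by [].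
  exists (Num.truncn y) => //; have : y < (Num.truncn y).+1%:R by exact: truncnS_gt.
  have := n0 (Num.truncn y); rewrite /S /region/=; move: (_.+1%:R : R) => m m0; rewrite /y => hy.
  split; last by lra.
  apply/andP; split; last by lra.
  by rewrite invf_ple ?posrE//; lra.
have ndS : {homo S : n m / (n <= m)%N >-> (n <= m)%O}.
  move=> a b ab; apply/subsetPset => s [/andP[h1 h2] h3].
  have ab' : a.+1%:R <= b.+1%:R :> R by rewrite ler_nat.
  have ba : (b.+1%:R : R)^-1 <= (a.+1%:R)^-1 by rewrite lef_pV2 ?posrE.
  by split; [apply/andP; split; [exact: le_trans h1|exact: le_trans ab']|exact: le_trans ab'].
have mf n : measurable_fun (S n) (fun s : borelC R => (normc (f s) `^ p)%:E).
  apply/measurable_EFinP; apply: measurable_funS (measurable_normc_powR p0 hf).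
    exact: measurable_halfplane.
  by rewrite -SU; exact: bigcup_sup.
have H := @ge0_nondecreasing_set_cvg_integral _ (borelC R) R S
  (fun s => (normc (f s) `^ p)%:E) mu ndS (fun n => measurable_region _ _) mf
  (fun _ s _ => powR_ge0 _ _).
rewrite -SU -(cvg_lim _ H)//; apply: lime_le; first exact: (cvgP _ H).
apply: nearW => n; apply: integral_region_le; first by rewrite invr_gt0.
exact: le_trans (i1 n) (n1 n).
Qed.

End HalfplaneEmbedding.

(** * Sums over primes *)

Section PrimeSums.
Variable R : realType.

(** [q] divides at least [M / q] of the factors of [M!]. *)
Lemma prod_prime_powers_dvd (M : nat) (s : seq nat) : uniq s -> all prime s ->
  (\prod_(q <- s) q ^ (M %/ q) %| M`!)%N.
Proof.
elim: s => [|q s IH]; first by rewrite big_nil dvd1n.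
rewrite /= big_cons => /andP[qs us] /andP[pq ps].
have cop : coprime (q ^ (M %/ q)) (\prod_(r <- s) r ^ (M %/ r)).
  apply: coprimeXl; rewrite prime_coprime//; rewrite Euclid_dvd_prod//.
  rewrite big_has; apply/hasP => -[r rs]; rewrite Euclid_dvdX// => /andP[qr _].
  move: qr; rewrite dvdn_prime2// ?(allP ps)// => /eqP qr.
  by rewrite qr rs in qs.
rewrite Gauss_dvd// IH// andbT pfactor_dvdn ?fact_gt0// logn_fact//.
have [->|M0] := posnP M; first by rewrite div0n.
by rewrite big_nat_recl//= expn1 leq_addr.
Qed.

Lemma fact_leX n : (n`! <= n ^ n)%N.
Proof.
case: n => // n; have -> : (n.+1 ^ n.+1 = \prod_(i < n.+1) n.+1)%N.
  by rewrite prod_nat_const card_ord.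
rewrite fact_prod big_add1 /= big_mkord; apply: leq_prod => i _.
by rewrite ltn_ord.
Qed.

(** Logarithms in [prod_prime_powers_dvd], with [M / q <= 2 (M %/ q)]. *)
Lemma sum_ln_div_prime (M : nat) (s : seq nat) : uniq s -> all prime s ->
  all (fun q => q <= M)%N s -> (0 < M)%N ->
  \sum_(q <- s) ln q%:R / q%:R <= 2 * ln M%:R :> R.
Proof.
move=> us ps sM M0.
have h1 : (\prod_(q <- s) q ^ (M %/ q) <= M ^ M)%N.
  apply: leq_trans (fact_leX M); apply: dvdn_leq; first exact: fact_gt0.
  exact: prod_prime_powers_dvd.
have lnP (u : seq nat) : all prime u ->
    ln (\prod_(q <- u) q ^ (M %/ q))%N%:R = \sum_(q <- u) (M %/ q)%:R * ln q%:R :> R.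
  elim: u => [|q u IH]; first by rewrite !big_nil ln1.
  move=> /= /andP[pq pu]; rewrite !big_cons natrM lnM ?posrE ?ltr0n; last 2 first.
  - by rewrite expn_gt0 prime_gt0.
  - by apply: prodn_gt0 => r; rewrite expn_gt0; case: r.
  by rewrite IH// natrX lnXn ?ltr0n ?prime_gt0// mulr_natl.
have P0 : (0 < \prod_(q <- s) q ^ (M %/ q))%N.
  by apply: prodn_gt0 => r; rewrite expn_gt0; case: r.
have h2 : \sum_(q <- s) (M %/ q)%:R * ln q%:R <= M%:R * ln M%:R :> R.
  rewrite -(lnP s ps) mulr_natl -lnXn ?ltr0n// -natrX.
  by rewrite ler_ln ?posrE ?ltr0n ?ler_nat// expn_gt0 M0.
have M0' : 0 < M%:R :> R by rewrite ltr0n.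
rewrite -(ler_pM2l M0') [leRHS]mulrCA.
apply: (@le_trans _ _ (2 * \sum_(q <- s) (M %/ q)%:R * ln q%:R)); last by rewrite ler_pM2l.
rewrite !mulr_sumr big_seq [leRHS]big_seq; apply: ler_sum => q qs.
have q0 : 0 < q%:R :> R by rewrite ltr0n prime_gt0// (allP ps).
have lq : 0 <= ln q%:R :> R by rewrite ln_ge0// ler1n prime_gt0// (allP ps).
rewrite mulrCA [leRHS]mulrA [leRHS]mulrC ler_wpM2l//.
rewrite ler_pdivrMr// -natrM -natrM ler_nat.
have d1 : (0 < M %/ q)%N by rewrite divn_gt0 ?(allP sM)// prime_gt0// (allP ps).
have := divn_eq M q; have := ltn_pmod M (prime_gt0 (allP ps _ qs)); nia.
Qed.

Definition smooth (s : seq nat) (n : nat) : bool := (0 < n)%N && all (mem s) (primes n).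

Lemma smoothM s q n : (0 < q)%N -> smooth s (q * n) -> smooth s n.
Proof.
move=> q0 /andP[]; rewrite muln_gt0 q0/= => n0 /allP h; apply/andP; split => //.
by apply/allP => r rn; apply: h; rewrite primesM// rn orbT.
Qed.

Lemma smooth_cons_ndvd s q n : prime q -> ~~ (q %| n)%N -> smooth (q :: s) n = smooth s n.
Proof.
move=> pq qn; rewrite /smooth; have [->//|n0] := posnP n.
apply: eq_in_all => r; rewrite mem_primes => /and3P[_ _ rn].
rewrite /= inE; case: eqP => // rq; by rewrite -rq rn in qn.
Qed.

(** Euler's product: the multiples of [q] contribute at most [1 / q] times the
    whole sum. *)
Lemma euler_product_ge (N : nat) (s : seq nat) : uniq s -> all prime s ->
  \sum_(n < N | smooth s n) n%:R^-1 <= \prod_(q <- s) (1 - q%:R^-1)^-1 :> R.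
Proof.
case: N => [_ ps|N].
  rewrite big_ord0 big_seq; apply: prodr_ge0 => q /(allP ps) pq.
  by rewrite invr_ge0 subr_ge0 invf_le1 ?ler1n ?ltr0n prime_gt0.
elim: s => [_ _|q s IH].
  rewrite big_nil (eq_bigl (fun n : 'I_N.+1 => (n : nat) == 1%N)); last first.
    case=> [[|[|n]]] //= _; rewrite /smooth /=.
    have := primes_eq0 n.+2; case: primes => //= x l _.
  case: N => [|N]; first by rewrite big_pred0 => [|[[]]].
  rewrite (big_pred1 (inord 1)); last first.
    by move=> i /=; rewrite -(inj_eq val_inj) /= inordK.
  by rewrite inordK// invr1.
rewrite /= big_cons => /andP[qs us] /andP[pq ps].
have q1 : 1 < q%:R :> R by rewrite ltr1n prime_gt1.
have q0 : 0 < q%:R :> R by lra.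
have qi : q%:R^-1 < 1 :> R by rewrite invf_lt1.
set A := \sum_(n < N.+1 | smooth (q :: s) n) n%:R^-1 : R.
suff hA : A <= \sum_(n < N.+1 | smooth s n) n%:R^-1 + q%:R^-1 * A.
  have := IH us ps; rewrite mulrC ler_pdivlMr ?subr_gt0//; lra.
rewrite {1}/A (bigID (fun n : 'I_N.+1 => (q %| n)%N))/= addrC; apply: lerD.
  rewrite big_mkcond [leRHS]big_mkcond; apply: ler_sum => n _.
  have [qn|qn] := boolP (q %| n)%N; rewrite ?andbF ?andbT/=.
    by case: ifP => // _; rewrite invr_ge0.
  by rewrite smooth_cons_ndvd.
pose h (n : 'I_N.+1) : 'I_N.+1 := inord (q * n).
pose h' (n : 'I_N.+1) : 'I_N.+1 := inord (n %/ q).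
rewrite (reindex_onto h h') => [|n /andP[_ qn]]; last first.
  apply: val_inj; rewrite /h /h' /= inordK inordK ?(leq_ltn_trans (leq_div _ _))//.
    by rewrite mulnC divnK.
  by rewrite mulnC divnK.
rewrite mulr_sumr big_mkcond [leRHS]big_mkcond; apply: ler_sum => n _.
case: ifP => [/andP[/andP[sm _] _]|_]; last by case: ifP => // _; rewrite mulr_ge0 ?invr_ge0.
have hn : h n = (q * n)%N :> nat.
  rewrite /h; have [lt|ge] := ltnP (q * n) N.+1; first by rewrite inordK.
  have e : h n = 0%N :> nat by rewrite /h /inord /insubd insubF// ltnNge ge.
  by move: sm; rewrite e.
by rewrite hn in sm *; rewrite (smoothM (prime_gt0 pq) sm) natrM invfM.
Qed.

Definition primes_between (Q M : nat) : seq nat :=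
  [seq q <- iota 0 M.+1 | prime q && (Q <= q)%N].

Lemma primes_between_uniq Q M : uniq (primes_between Q M).
Proof. by rewrite filter_uniq// iota_uniq. Qed.

Lemma primes_between_prime Q M : all prime (primes_between Q M).
Proof. by apply/allP => q; rewrite mem_filter => /andP[/andP[]]. Qed.

Lemma primes_between_le Q M : all (fun q => q <= M)%N (primes_between Q M).
Proof. by apply/allP => q; rewrite mem_filter mem_iota add0n ltnS => /andP[_]. Qed.

Lemma primes_between_ge Q M : all (fun q => Q <= q)%N (primes_between Q M).
Proof. by apply/allP => q; rewrite mem_filter => /andP[/andP[]]. Qed.

Lemma sum_primes_between (Q M : nat) (F : nat -> R) :
  \sum_(q <- primes_between Q M) F q =
  \sum_(q < M.+1 | prime q && (Q <= q)%N) F q.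
Proof.
rewrite /primes_between big_filter -(big_mkord (fun q => prime q && (Q <= q)%N) F).
by rewrite /index_iota subn0.
Qed.

Lemma sum_inv32_primes (Q M : nat) :
  \sum_(q <- primes_between Q M) (q%:R * Num.sqrt q%:R)^-1 <= 4 :> R.
Proof.
rewrite (sum_primes_between _ _ (fun q => (q%:R * Num.sqrt q%:R)^-1)).
apply: (@le_trans _ _ (\sum_(q < M.+1) (q%:R * Num.sqrt q%:R)^-1)).
  rewrite big_mkcond; apply: ler_sum => q _; case: ifP => // _.
by rewrite big_ord_recl/= mul0r invr0 add0r; exact: sum_inv32_le.
Qed.

Lemma ln_le_harmonic (M : nat) : ln M.+1%:R <= \sum_(n < M.+1 | (0 < n)%N) n%:R^-1 :> R.
Proof.
elim: M => [|M IH]; first by rewrite ln1; apply: sumr_ge0 => n _; rewrite invr_ge0.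
rewrite big_mkcond big_ord_recr -big_mkcond /=.
have M0 : 0 < M.+1%:R :> R by rewrite ltr0n.
have -> : M.+2%:R = M.+1%:R * (1 + M.+1%:R^-1) :> R.
  by rewrite -(natr1 M.+1) mulrDr mulr1 mulfV// gt_eqF.
have i0 : 0 < M.+1%:R^-1 :> R by rewrite invr_gt0.
have i1 : 0 < 1 + M.+1%:R^-1 :> R by rewrite addr_gt0.
rewrite lnM ?posrE//.
by apply: lerD => //; apply: le_ln1Dx; rewrite (lt_trans _ i0)// ltrN10.
Qed.

(** Every [n <= M] is a product of primes up to [M], so Euler's product bounds
    the harmonic sum; the primes below [Q] and the terms [2 q^(-3/2)] in
    [(1 - 1/q)^-1 <= exp (1/q + 2 q^(-3/2))] cost a constant factor. *)
Lemma ln_le_exp_sum_primes (Q M : nat) :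
  ln M.+1%:R <= expR (\sum_(q <- primes_between Q M) q%:R^-1 + Q%:R + 8) :> R.
Proof.
set s := primes_between 0 M.
apply: le_trans (ln_le_harmonic M) _.
have -> : \sum_(n < M.+1 | (0 < n)%N) n%:R^-1 = \sum_(n < M.+1 | smooth s n) n%:R^-1 :> R.
  apply: eq_bigl => n; rewrite /smooth; have [//|n0] := posnP n.
  apply/esym/allP => q; rewrite mem_primes => /and3P[pq _ qn].
  rewrite /= mem_filter pq mem_iota add0n /=.
  by rewrite (leq_ltn_trans (dvdn_leq n0 qn)).
apply: le_trans (euler_product_ge _ (primes_between_uniq 0 M) (primes_between_prime 0 M)) _.
apply: (@le_trans _ _ (\prod_(q <- s) expR (q%:R^-1 + 2 * (q%:R * Num.sqrt q%:R)^-1))).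
  rewrite big_seq [leRHS]big_seq; apply: ler_prod => q /(allP (primes_between_prime 0 M)) pq.
  have q2 : 2 <= q%:R :> R by rewrite (ler_nat _ 2) prime_gt1.
  have q0 : 0 < q%:R :> R by lra.
  have i1 : 1 - q%:R^-1 = (q%:R - 1) / q%:R :> R by field; rewrite gt_eqF.
  apply/andP; split; first by rewrite i1 invr_ge0 divr_ge0//; lra.
  have -> : (1 - q%:R^-1)^-1 = 1 + (q%:R - 1)^-1 :> R.
    by rewrite i1; field; apply/andP; split; rewrite gt_eqF//; lra.
  apply: le_trans (expR_ge1Dx _) _; rewrite ler_expR.
  have sq : Num.sqrt q%:R <= q%:R :> R.
    rewrite -(@ler_pXn2r _ 2) ?nnegrE ?sqrtr_ge0 ?(ltW q0)// sqr_sqrtr ?(ltW q0)//.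
    by rewrite expr2 ler_peMl ?(ltW q0)//; lra.
  have s0 : 0 < Num.sqrt q%:R :> R by rewrite sqrtr_gt0.
  have -> : (q%:R - 1)^-1 = q%:R^-1 + (q%:R * (q%:R - 1))^-1 :> R.
    by field; apply/andP; split; rewrite gt_eqF//; lra.
  rewrite lerD2l -[leRHS]invrK lef_pV2 ?posrE; last 2 first.
  - by rewrite mulr_gt0//; lra.
  - by rewrite invr_gt0 mulr_gt0// invr_gt0 mulr_gt0.
  rewrite invfM invrK mulrCA ler_pM2l//; lra.
rewrite -expR_sum ler_expR big_split/= -mulr_sumr -/s.
have := sum_inv32_primes 0 M; rewrite -/s.
suff : \sum_(q <- s) q%:R^-1 <= \sum_(q <- primes_between Q M) q%:R^-1 + Q%:R :> R by lra.
rewrite /s !(sum_primes_between _ _ (fun q => q%:R^-1)).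
apply: (@le_trans _ _ (\sum_(q < M.+1 | prime q && (Q <= q)%N) q%:R^-1 +
   \sum_(q < M.+1 | (0 < q < Q)%N) 1)).
  rewrite [X in X + _]big_mkcond [X in _ + X]big_mkcond -big_split/= big_mkcond.
  apply: ler_sum => q _; rewrite andbT.
  case: ifP => pq; last by rewrite /= add0r; case: ifP.
  have q0 := prime_gt0 pq; rewrite q0 /=.
  have [qQ|qQ] := leqP Q q; first by rewrite addr0.
  by rewrite add0r invf_le1 ?ler1n ?ltr0n.
rewrite lerD2l; apply: (@le_trans _ _ (minn M.+1 Q)%:R); last by rewrite ler_nat geq_minr.
elim: M.+1 => [|n IH]; first by rewrite big_ord0.
rewrite big_mkcond big_ord_recr -big_mkcond /=.
apply: le_trans (lerD IH (lexx _)) _.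
case: ifP => [/andP[_ nQ]|_].
  by rewrite (minn_idPl (ltnW nQ)) (minn_idPl nQ) natr1.
by rewrite addr0 ler_nat leq_min geq_minr andbT (leq_trans (geq_minl _ _)).
Qed.

End PrimeSums.

(** * Means of products of trigonometric polynomials *)

Section Means.
Variable R : realType.
Implicit Types (F G : R -> R).

Lemma continuous_cos_affine (l psi : R) : continuous (fun t : R => cos (l * t + psi)).
Proof.
move=> t; apply: (@continuous_comp _ _ _ (fun t : R => l * t + psi) (@cos R)); last exact: continuous_cos.
by apply: continuousD; [apply: continuousM; [exact: cst_continuous|exact: cvg_id]|exact: cst_continuous].
Qed.

Lemma II_cos (l psi a b : R) : l != 0 -> a < b ->
  II a b (fun t => cos (l * t + psi)) = (sin (l * b + psi) - sin (l * a + psi)) / l.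
Proof.
move=> l0 ab; pose F t := l^-1 * sin (l * t + psi).
have dF (t : R) : is_derive t 1 F (cos (l * t + psi)).
  have h1 : is_derive t 1 (fun t : R => l * t + psi) l.
    have := is_derive_poly (l *: 'X + psi%:P) t.
    have -> : horner (l *: 'X + psi%:P) = (fun t => l * t + psi).
      by apply/funext => y; rewrite !hornerE.
    by move=> h; apply: (is_derive_eq h); rewrite !derivD derivC derivZ derivX !hornerE /=; ring.
  have h2 := @is_derive1_comp R (@sin R) (fun t => l * t + psi) t _ _ (is_derive_sin _) h1.
  have h3 := @is_deriveZ _ R R _ l^-1 t 1 _ h2.
  apply: (is_derive_eq h3).
  by rewrite /= [_ *: _]mulrCA mulVf// mulr1.
have eF (t : R) : derivable F t 1 by have := dF t; case.
have cF (t : R) : {for t, continuous F}.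
  by apply: differentiable_continuous; apply/derivable1_diffP; exact: eF.
rewrite /II /Rintegral (continuous_FTC2 (F := F))//.
- by rewrite -EFinB /= /F -mulrBr mulrC.
- by apply: continuous_in_subspaceT => t _; exact: continuous_cos_affine.
- split.
  + by move=> t _; exact: eF.
  + exact: cvg_at_right_filter (cF a).
  + exact: cvg_at_left_filter (cF b).
- by move=> t _; rewrite derive1E; by have := dF t; case.
Qed.

(** The denominator [2 T] is cleared. *)
Definition mean_tends F (L : R) : Prop := forall e : R, 0 < e ->
  exists2 T0 : R, 0 < T0 & forall T, T0 <= T -> `|II (- T) T F - 2 * T * L| <= e * T.

Lemma mean_tendsD F G (L M : R) : continuous F -> continuous G ->
  mean_tends F L -> mean_tends G M -> mean_tends (fun t => F t + G t) (L + M).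
Proof.
move=> cF cG hF hG e e0; have e2 : 0 < e / 2 by lra.
have [T1 T10 h1] := hF _ e2; have [T2 T20 h2] := hG _ e2.
exists (Num.max T1 T2) => [|T]; first by rewrite lt_max T10.
rewrite ge_max => /andP[/h1 a1 /h2 a2].
rewrite IID; [|by move=> t _; exact: cF|by move=> t _; exact: cG].
move: a1 a2; rewrite !ler_norml; lra.
Qed.

Lemma mean_tendsZ (k : R) F (L : R) : continuous F ->
  mean_tends F L -> mean_tends (fun t => k * F t) (k * L).
Proof.
move=> cF hF e e0; have e1 : 0 < e / (`|k| + 1) by rewrite divr_gt0// ltr_wpDl.
have [T1 T10 h1] := hF _ e1; exists T1 => // T hT.
rewrite IIZ; last by move=> t _; exact: cF.
have -> : k * II (- T) T F - 2 * T * (k * L) = k * (II (- T) T F - 2 * T * L) by ring.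
have T0 : 0 < T by exact: lt_le_trans T10 hT.
rewrite normrM; apply: (@le_trans _ _ ((`|k| + 1) * (e / (`|k| + 1) * T))).
  by apply: ler_pM => //; [rewrite lerDl|exact: h1].
by rewrite mulrA mulrCA mulfV ?mulr1// gt_eqF// ltr_wpDl.
Qed.

Lemma mean_tends_cos (l psi : R) :
  mean_tends (fun t => cos (l * t + psi)) (if l == 0 then cos psi else 0).
Proof.
move=> e e0; have [->|l0] := eqVneq l 0.
  exists 1 => // T T1.
  rewrite (@eq_II R _ _ _ (fun=> cos psi)); last by move=> t _; rewrite mul0r add0r.
  rewrite II_cst; last by lra.
  have -> : cos psi * (T - - T) - 2 * T * cos psi = 0 by ring.
  by rewrite normr0 mulr_ge0 ?ltW//; lra.
have el : 0 < e * `|l| by rewrite mulr_gt0// normr_gt0.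
exists (2 / (e * `|l|)) => [|T hT]; first by rewrite divr_gt0.
have T0 : 0 < T by apply: lt_le_trans hT; rewrite divr_gt0.
rewrite mulr0 subr0 II_cos//; last by lra.
rewrite normrM normfV ler_pdivrMr ?normr_gt0//.
apply: le_trans (ler_normB _ _) _.
have := sin_max (l * T + psi); have := sin_max (l * - T + psi).
by move: hT; rewrite ler_pdivrMr//; lra.
Qed.

(** The last cosine polynomial is [cos (2 theta)]. *)
Definition euler_majorant (A B D tau : nat -> R) (q : nat) (t : R) : R :=
  A q + B q * cos ((t - tau q) * ln q%:R) + D q * (2 * cos ((t - tau q) * ln q%:R) ^+ 2 - 1).

Lemma continuous_prod_majorant A B D tau (s : seq nat) :
  continuous (fun t => \prod_(q <- s) euler_majorant A B D tau q t).
Proof.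
elim: s => [|q s IH].
  have -> : (fun t => \prod_(q <- [::]) euler_majorant A B D tau q t) = fun=> 1.
    by apply/funext => t; rewrite big_nil.
  exact: cst_continuous.
have -> : (fun t => \prod_(q <- q :: s) euler_majorant A B D tau q t) =
    fun t => euler_majorant A B D tau q t * \prod_(q <- s) euler_majorant A B D tau q t.
  by apply/funext => t; rewrite big_cons.
move=> t; apply: continuousM; last exact: IH.
have cc : {for t, continuous (fun t => cos ((t - tau q) * ln q%:R))}.
  have -> : (fun t => cos ((t - tau q) * ln q%:R)) = fun t => cos (ln q%:R * t + - tau q * ln q%:R).
    by apply/funext => u; congr cos; ring.
  exact: continuous_cos_affine.
have cst c : {for t, continuous (fun _ : R => c : R)} by exact: cst_continuous.
apply: continuousD; first apply: continuousD => //; apply: continuousM => //.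
apply: continuousB => //; apply: continuousM => //; exact: continuousM.
Qed.

(** Multiplying by [cos ((t - tau) ln q)] moves the frequency [ln (a / b)] to
    [ln (a q / b)] and [ln (a / (b q))], never to [0] by unique factorisation. *)
Lemma mean_tends_prod (A B D tau : nat -> R) (s : seq nat) : uniq s -> all prime s ->
  forall (a b : nat) (psi : R), (0 < a)%N -> (0 < b)%N ->
  all (fun q => coprime q a && coprime q b) s ->
  mean_tends (fun t => (\prod_(q <- s) euler_majorant A B D tau q t) *
      cos ((ln a%:R - ln b%:R) * t + psi))
    (if a == b then (\prod_(q <- s) A q) * cos psi else 0).
Proof.
elim: s => [_ _|q s IH /= /andP[qs us] /andP[pq ps]] a b psi a0 b0 cab.
  have -> : (fun t => (\prod_(q <- [::]) euler_majorant A B D tau q t) *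
      cos ((ln a%:R - ln b%:R) * t + psi)) = fun t => cos ((ln a%:R - ln b%:R) * t + psi).
    by apply/funext => t; rewrite big_nil mul1r.
  rewrite big_nil mul1r; have := @mean_tends_cos (ln a%:R - ln b%:R) psi.
  rewrite subr_eq0 (inj_in_eq (@ln_inj R)) ?posrE ?ltr0n//.
  by rewrite eqr_nat.
move: cab => /= /andP[/andP[ca cb] cs].
pose W t := \prod_(q <- s) euler_majorant A B D tau q t.
have cW : continuous W by exact: continuous_prod_majorant.
have q0 : (0 < q)%N by exact: prime_gt0.
have cmul (c : nat) r : r \in s -> coprime r c -> coprime r (c * q).
  move=> rs rc; rewrite coprimeMr rc prime_coprime ?(allP ps _ rs)//=.
  rewrite dvdn_prime2 ?(allP ps _ rs)//; apply/eqP => rq; by move: qs; rewrite -rq rs.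
have csl (c d : nat) : all (fun r => coprime r c && coprime r d) s ->
    all (fun r => coprime r (c * q) && coprime r d) s.
  by move=> h; apply/allP => r rs; have /andP[h1 h2] := allP h r rs; rewrite cmul.
have csr (c d : nat) : all (fun r => coprime r c && coprime r d) s ->
    all (fun r => coprime r c && coprime r (d * q)) s.
  by move=> h; apply/allP => r rs; have /andP[h1 h2] := allP h r rs; rewrite h1 cmul.
have nel (c : nat) : (a * q * c == b)%N = false.
  apply/negP => /eqP e; move: cb; rewrite -e prime_coprime// mulnAC dvdn_mull//.
have ner (c : nat) : (a == b * q * c)%N = false.
  apply/negP => /eqP e; move: ca; rewrite e prime_coprime// mulnAC dvdn_mull//.
have lnq (c : nat) : (0 < c)%N -> ln (c * q)%:R = ln c%:R + ln q%:R :> R.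
  by move=> c0; rewrite natrM lnM ?posrE ?ltr0n.
have H0 := IH us ps a b psi a0 b0 cs.
have aq0 : (0 < a * q)%N by rewrite muln_gt0 a0.
have bq0 : (0 < b * q)%N by rewrite muln_gt0 b0.
have aqq0 : (0 < a * q * q)%N by rewrite muln_gt0 aq0.
have bqq0 : (0 < b * q * q)%N by rewrite muln_gt0 bq0.
pose th := tau q * ln q%:R.
have H1 := IH us ps (a * q)%N b (psi - th) aq0 b0 (csl _ _ cs).
have H2 := IH us ps a (b * q)%N (psi + th) a0 bq0 (csr _ _ cs).
have H3 := IH us ps (a * q * q)%N b (psi - 2 * th) aqq0 b0 (csl _ _ (csl _ _ cs)).
have H4 := IH us ps a (b * q * q)%N (psi + 2 * th) a0 bqq0 (csr _ _ (csr _ _ cs)).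
have n1 := nel 1%N; have n2 := ner 1%N; rewrite muln1 in n1; rewrite muln1 in n2.
rewrite n1 in H1; rewrite n2 in H2; rewrite nel in H3; rewrite ner in H4.
have cc l ph : continuous (fun t => W t * cos (l * t + ph)).
  by move=> t; apply: continuousM; [exact: cW|exact: continuous_cos_affine].
have cD (F G : R -> R) : continuous F -> continuous G -> continuous (fun t => F t + G t).
  by move=> h1 h2 t; apply: continuousD; [exact: h1|exact: h2].
have cZ (k : R) (F : R -> R) : continuous F -> continuous (fun t => k * F t).
  by move=> h1 t; apply: continuousM; [exact: cst_continuous|exact: h1].
have H12 := mean_tendsZ (B q / 2) (cD _ _ (cc _ _) (cc _ _)) (mean_tendsD (cc _ _) (cc _ _) H1 H2).
have H34 := mean_tendsZ (D q / 2) (cD _ _ (cc _ _) (cc _ _)) (mean_tendsD (cc _ _) (cc _ _) H3 H4).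
have H00 := mean_tendsZ (A q) (cc _ _) H0.
have := mean_tendsD (cZ _ _ (cc _ _)) (cD _ _ (cZ _ _ (cD _ _ (cc _ _) (cc _ _))) (cZ _ _ (cD _ _ (cc _ _) (cc _ _))))
  H00 (mean_tendsD (cZ _ _ (cD _ _ (cc _ _) (cc _ _))) (cZ _ _ (cD _ _ (cc _ _) (cc _ _))) H12 H34).
rewrite !addr0 !mulr0 !addr0 big_cons.
have -> : A q * (if a == b then \prod_(q <- s) A q * cos psi else 0) =
    (if a == b then A q * (\prod_(q <- s) A q) * cos psi else 0).
  by case: ifP => _; rewrite ?mulr0// mulrA.
congr (mean_tends _ _); apply/funext => t; rewrite big_cons -/(W t) /euler_majorant.
rewrite !lnq// /th; set x := (t - tau q) * ln q%:R.
set y := (ln a%:R - ln b%:R) * t + psi.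
have -> : (ln a%:R + ln q%:R - ln b%:R) * t + (psi - tau q * ln q%:R) = y + x by rewrite /x /y; ring.
have -> : (ln a%:R - (ln b%:R + ln q%:R)) * t + (psi + tau q * ln q%:R) = y - x by rewrite /x /y; ring.
have -> : (ln a%:R + ln q%:R + ln q%:R - ln b%:R) * t + (psi - 2 * (tau q * ln q%:R)) = y + (x + x) by rewrite /x /y; ring.
have -> : (ln a%:R - (ln b%:R + ln q%:R + ln q%:R)) * t + (psi + 2 * (tau q * ln q%:R)) = y - (x + x) by rewrite /x /y; ring.
clearbody x y; rewrite !(cosD, sinD, cosN, sinN).
have : D q * W t * cos y * (sin x * sin x) = D q * W t * cos y * (1 - cos x ^+ 2).
  by rewrite -(cos2Dsin2 x); ring.
move: (A q) (B q) (D q) (W t) (cos y) (sin y) (cos x) (sin x); clear; move=> *; lra.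
Qed.

End Means.

(** * One Euler factor *)

Section EulerFactor.
Variable R : realType.

Lemma cube_le (x y : R) : 0 <= x -> x <= y -> x ^+ 3 <= y ^+ 3.
Proof. by move=> x0 xy; rewrite lerXn2r// nnegrE ?(le_trans x0). Qed.

(** The left side is [|1 + a e^(i t)|^p] for [a = b / r], [p = 2 r] and
    [c = cos t]; the mean of the right side over [t] is [1 + b^2] up to third
    order, whatever [p] is. *)
Lemma factor_powR_le (b r c : R) : 0 < b -> b <= 64^-1 -> 2^-1 <= r -> `|c| <= 1 ->
  (1 + 2 * (b / r) * c + (b / r) ^+ 2) `^ r <=
  1 + b ^+ 2 + 152 * b ^+ 3 + 2 * b * c + (b ^+ 2 - b ^+ 2 / r) * (2 * c ^+ 2 - 1).
Proof.
move=> b0 b1 r1 c1; set a := b / r.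
have r0 : 0 < r by lra.
have a0 : 0 < a by rewrite divr_gt0.
have ab : a <= 2 * b by rewrite /a ler_pdivrMr// mulrAC ler_peMl ?(ltW b0)//; lra.
have aE : r * a = b by rewrite /a mulrCA mulfV ?mulr1// gt_eqF.
have raa : r * a ^+ 2 = b ^+ 2 / r by rewrite /a; field; rewrite gt_eqF.
have a1 : a <= 32^-1 by lra.
move: c1; rewrite ler_norml => /andP[c1 c2].
have cc : c ^+ 2 <= 1 by nra.
have c20 := sqr_ge0 c.
clearbody a.
set x := 2 * a * c + a ^+ 2.
have aa : a ^+ 2 <= a / 32 by rewrite expr2; nra.
have aa0 : 0 <= a ^+ 2 by exact: sqr_ge0.
have ac1 : a * c <= a by nra.
have ac2 : - a <= a * c by nra.
have x3 : `|x| <= 3 * a by rewrite ler_norml /x; apply/andP; split; lra.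
have x12 : `|x| <= 2^-1 by lra.
have a3 : 0 <= a ^+ 3 by rewrite exprn_ge0// ltW.
have x33 : `|x| ^+ 3 <= 27 * a ^+ 3.
  apply: le_trans (cube_le (normr_ge0 x) x3) _.
  by rewrite le_eqVlt; apply/orP; left; apply/eqP; ring.
(* [a^2 - 2 a^2 c^2 = - a^2 cos (2 t)]: the constant terms of the logarithm
   cancel to second order. *)
have lnx : ln (1 + x) <= 2 * a * c - a ^+ 2 * (2 * c ^+ 2 - 1) + 29 * a ^+ 3.
  have := ln_taylor x12.
  rewrite ler_norml => /andP[_]; rewrite lerBlDr => /le_trans; apply.
  have : x ^+ 2 >= 4 * a ^+ 2 * c ^+ 2 - 4 * a ^+ 3.
    have -> : x ^+ 2 = 4 * a ^+ 2 * c ^+ 2 + 4 * a ^+ 3 * c + a ^+ 4 by rewrite /x; ring.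
    have : 0 <= a ^+ 4 by rewrite exprn_ge0// ltW.
    by have : - a ^+ 3 <= a ^+ 3 * c by [nra]; lra.
  by rewrite /x; lra.
have px : 0 < 1 + x by move: x12; rewrite ler_norml => /andP[]; lra.
have -> : 1 + 2 * a * c + a ^+ 2 = 1 + x by rewrite /x addrA.
rewrite /powR gt_eqF//.
set y := 2 * b * c - b ^+ 2 / r * (2 * c ^+ 2 - 1) + 29 * (b ^+ 2 / r * a).
have ly : r * ln (1 + x) <= y.
  apply: le_trans (ler_wpM2l (ltW r0) lnx) _; rewrite /y -raa -aE.
  by rewrite le_eqVlt; apply/orP; left; apply/eqP; ring.
have br : b ^+ 2 / r <= 2 * b ^+ 2.
  by rewrite ler_pdivrMr// mulrAC ler_peMl ?sqr_ge0//; lra.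
have br0 : 0 <= b ^+ 2 / r by rewrite divr_ge0 ?sqr_ge0// ltW.
have b2 : b ^+ 2 <= b / 64 by rewrite expr2; nra.
have b20 : 0 <= b ^+ 2 by exact: sqr_ge0.
have b30 : 0 <= b ^+ 3 by rewrite exprn_ge0// ltW.
have b3 : b ^+ 3 <= b ^+ 2 / 64 by rewrite exprS; nra.
have bra : b ^+ 2 / r * a <= 4 * b ^+ 3.
  apply: (@le_trans _ _ (2 * b ^+ 2 * (2 * b))).
    by apply: ler_pM => //; exact: ltW.
  by rewrite le_eqVlt; apply/orP; left; apply/eqP; ring.
have bra0 : 0 <= b ^+ 2 / r * a by rewrite mulr_ge0// ltW.
move: (b ^+ 2 / r) br br0 bra bra0 @y ly => B br br0 bra bra0 y ly.
pose u := 2 * b * c; pose v := - (B * (2 * c ^+ 2 - 1)) + 29 * (B * a).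
have bc1 : b * c <= b by nra.
have bc2 : - b <= b * c by nra.
have Bc1 : B * (2 * c ^+ 2 - 1) <= B by nra.
have Bc2 : - B <= B * (2 * c ^+ 2 - 1) by nra.
have v4 : `|v| <= 4 * b ^+ 2 by rewrite ler_norml /v; apply/andP; split; lra.
have u2 : `|u| <= 2 * b by rewrite ler_norml /u; apply/andP; split; lra.
have yuv : y = u + v by rewrite /y /u /v; ring.
have y3 : `|y| <= 3 * b by rewrite yuv (le_trans (ler_normD _ _))//; lra.
have y12 : `|y| <= 2^-1 by lra.
apply: (@le_trans _ _ (expR y)); first by rewrite ler_expR.
apply: le_trans (expR_taylor y12) _.
have y33 : `|y| ^+ 3 <= 27 * b ^+ 3.
  apply: le_trans (cube_le (normr_ge0 y) y3) _.
  by rewrite le_eqVlt; apply/orP; left; apply/eqP; ring.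
have uv : u * v <= 8 * b ^+ 3.
  apply: le_trans (ler_norm _) _; rewrite normrM.
  apply: le_trans (ler_pM _ _ u2 v4) _ => //.
  by rewrite le_eqVlt; apply/orP; left; apply/eqP; ring.
have vv : v ^+ 2 <= 2 * b ^+ 3.
  rewrite -(real_normK (num_real v)); apply: (@le_trans _ _ ((4 * b ^+ 2) ^+ 2)).
    by rewrite lerXn2r ?nnegrE// mulr_ge0.
  have -> : (4 * b ^+ 2) ^+ 2 = 16 * (b * b ^+ 3) by ring.
  by nra.
have uu : u ^+ 2 = 4 * b ^+ 2 * c ^+ 2 by rewrite /u; ring.
have y2 : y ^+ 2 = u ^+ 2 + 2 * (u * v) + v ^+ 2 by rewrite yuv; ring.
rewrite y2 uu /y; lra.
Qed.

(** [ln (1 + z) >= z - z^2]. *)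
Lemma factor_powR_ge (r z : R) : 0 < r -> `|z| <= 2^-1 ->
  expR (2 * r * (z - z ^+ 2)) <= (1 + z) `^ (2 * r).
Proof.
move=> r0 z12; have pz : 0 < 1 + z by move: z12; rewrite ler_norml => /andP[]; lra.
rewrite /powR gt_eqF// ler_expR ler_pM2l ?mulr_gt0//.
have := ln_taylor z12; rewrite ler_norml => /andP[+ _].
have : `|z| ^+ 3 <= z ^+ 2 / 2.
  by rewrite exprS -[in leRHS](real_normK (num_real z)) mulrC ler_wpM2l ?sqr_ge0.
lra.
Qed.

End EulerFactor.

(** * Dirichlet polynomials *)

Section DirichletPolynomials.
Variable R : realType.
Implicit Types (P Q : {poly R[i]}) (s z w : R[i]).

Lemma cexpD z w : cexp (z + w) = cexp z * cexp w.
Proof.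
by rewrite /cexp cReD cImD expRD cosD sinD; apply: complex_eq; rewrite !ReImE /=; ring.
Qed.

Lemma dpowM (m n : nat) s : (0 < m)%N -> (0 < n)%N ->
  dpow (m * n) s = dpow m s * dpow n s.
Proof.
move=> m0 n0; rewrite /dpow -cexpD natrM lnM ?posrE ?ltr0n//.
by congr cexp; rewrite -mulrDr; congr (_ * _); apply: complex_eq; rewrite !ReImE /= ?addr0.
Qed.

Lemma dirichlet_polyE (N : nat) P s : (size P <= N)%N ->
  dirichlet_poly P s = \sum_(i < N) P`_i * dpow i.+1 s.
Proof.
move=> PN; rewrite /dirichlet_poly /dirichlet_sum.
rewrite (big_ord_widen N (fun i => P`_i * dpow i.+1 s) PN) big_mkcond /=.
by apply: eq_bigr => i _; case: ltnP => // h; rewrite nth_default ?mul0r.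
Qed.

Lemma dirichlet_polyD P Q s :
  dirichlet_poly (P + Q) s = dirichlet_poly P s + dirichlet_poly Q s.
Proof.
rewrite (dirichlet_polyE s (size_polyD P Q)).
rewrite (dirichlet_polyE s (leq_maxl (size P) (size Q))).
rewrite (dirichlet_polyE s (leq_maxr (size P) (size Q))) -big_split/=.
by apply: eq_bigr => i _; rewrite coefD mulrDl.
Qed.

Lemma dirichlet_poly0 s : dirichlet_poly 0 s = 0.
Proof. by rewrite (@dirichlet_polyE 0) ?size_poly0// big_ord0. Qed.

Lemma dirichlet_poly_sum (n : nat) (F : nat -> {poly R[i]}) s :
  dirichlet_poly (\sum_(i < n) F i) s = \sum_(i < n) dirichlet_poly (F i) s.
Proof.
elim: n => [|n IH]; first by rewrite !big_ord0 dirichlet_poly0.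
by rewrite !big_ord_recr/= dirichlet_polyD IH.
Qed.

Lemma dirichlet_polyZXn c (k : nat) s : dirichlet_poly (c *: 'X^k) s = c * dpow k.+1 s.
Proof.
rewrite (@dirichlet_polyE k.+1); last by rewrite (leq_trans (size_scale_leq _ _))// size_polyXn.
rewrite big_ord_recr/= big1 => [|i _]; last first.
  by rewrite coefZ coefXn (ltn_eqF (ltn_ord i)) mulr0 mul0r.
by rewrite add0r coefZ coefXn eqxx mulr1.
Qed.

Lemma dirichlet_poly_mul_exists P c (n : nat) : (0 < n)%N ->
  exists Q, forall s, dirichlet_poly Q s = dirichlet_poly P s * (1 + c * dpow n s).
Proof.
move=> n0.
exists (P + \sum_(i < size P) (c * P`_i) *: 'X^((i.+1 * n).-1)) => s.
rewrite dirichlet_polyD (dirichlet_poly_sum _ (fun i => (c * P`_i) *: 'X^((i.+1 * n).-1))).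
rewrite mulrDr mulr1; congr (_ + _); rewrite {2}/dirichlet_poly /dirichlet_sum mulr_suml.
apply: eq_bigr => i _; rewrite dirichlet_polyZXn prednK ?muln_gt0//.
by rewrite dpowM//; ring.
Qed.

Lemma dpow1 s : dpow 1 s = 1.
Proof.
rewrite /dpow ln1 mulr0 /cexp /= expR0 cos0 sin0.
by apply: complex_eq; rewrite /= ?mulr1 ?mulr0 ?mul0r ?subr0 ?addr0.
Qed.

Lemma dirichlet_poly_prod_exists (c : nat -> R[i]) (u : seq nat) : all prime u ->
  exists P, forall s, dirichlet_poly P s = \prod_(q <- u) (1 + c q * dpow q s).
Proof.
elim: u => [_|q u IH /= /andP[pq pu]].
  exists (1 *: 'X^0) => s; by rewrite dirichlet_polyZXn dpow1 mulr1 big_nil.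
have [P hP] := IH pu; have [Q hQ] := dirichlet_poly_mul_exists P (c q) (prime_gt0 pq).
by exists Q => s; rewrite hQ hP big_cons mulrC.
Qed.

Variable p : R.
Hypothesis p1 : 1 <= p.
Let p0 : 0 < p. Proof. by rewrite (lt_le_trans _ p1). Qed.

Lemma dirichlet_poly_norm0 : dirichlet_poly_norm p (0 : {poly R[i]}) = 0.
Proof.
rewrite /dirichlet_poly_norm.
rewrite (_ : (fun T : R => _) = fun=> 0); first exact: lim_cst.
apply/funext => T; rewrite (@eq_Rintegral _ _ _ _ _ (fun=> 0)); last first.
  by move=> t _; rewrite dirichlet_poly0 normc0 powR0// gt_eqF.
by rewrite /Rintegral integral0 /= mulr0 powR0// invr_eq0 gt_eqF.
Qed.

Lemma dirichlet_hardy_poly P :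
  dirichlet_hardy p (dirichlet_poly P) (dirichlet_poly_norm p P).
Proof.
exists (fun=> P), (fun i => P`_i); split.
- move=> e e0; exists 0%N => k l _ _; by rewrite subrr dirichlet_poly_norm0.
- exact: cvg_cst.
- by move=> i; exact: cvg_cst.
- move=> s _; apply: cvg_near_cst; exists (size P) => // n /= hn.
  by rewrite (dirichlet_polyE s hn).
Qed.

(** Only an upper bound of the means is needed, as [lim] is [0] for a family
    without limit. *)
Lemma dirichlet_poly_norm_le P (A T0 : R) : 0 <= A -> 0 < T0 ->
  (forall T, T0 <= T -> II (- T) T (fun t => normc (dirichlet_poly P (0 +i* t)) `^ p) <= 2 * T * A) ->
  dirichlet_poly_norm p P `^ p <= A.
Proof.
move=> A0 T00 h; set N := dirichlet_poly_norm p P.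
suff : 0 <= N <= A `^ p^-1.
  move=> /andP[N0 NA]; apply: (@le_trans _ _ ((A `^ p^-1) `^ p)).
    by apply: ge0_ler_powR; rewrite ?nnegrE ?powR_ge0// ltW.
  by rewrite -powRrM mulVf ?powRr1// gt_eqF.
rewrite /N /dirichlet_poly_norm; set F := (fun T : R => _).
have [cF|nF] := pselect (cvg (F T @[T --> +oo])); last first.
  by rewrite (dvgP nF) /point/= lexx powR_ge0.
apply/andP; split; first by apply: limr_ge => //; apply: nearW => T; exact: powR_ge0.
apply: limr_le => //; exists T0; split; first exact: num_real.
move=> T T0T; apply: ge0_ler_powR; rewrite ?nnegrE ?invr_ge0 ?(ltW p0)//.
  rewrite mulr_ge0 ?invr_ge0 ?mulr_ge0 ?(ltW (lt_trans T00 T0T))//.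
  by apply: Rintegral_ge0 => t _; exact: powR_ge0.
rewrite ler_pdivrMl ?mulr_gt0 ?(lt_trans T00 T0T)//.
exact: (h _ (ltW T0T)).
Qed.

End DirichletPolynomials.

(** * Test functions *)

Section TestFunctions.
Variable R : realType.
Variables (p tau : R).
Hypothesis p1 : 1 <= p.

Let r := p / 2.
Let r12 : 2^-1 <= r. Proof. by rewrite /r; have := p1; lra. Qed.
Let r0 : 0 < r. Proof. by have := r12; lra. Qed.
Let p0 : 0 < p. Proof. by rewrite (lt_le_trans _ p1). Qed.
Let p2r : p = 2 * r. Proof. by rewrite /r; lra. Qed.

Definition invsqrt (q : nat) : R := (Num.sqrt q%:R)^-1.

Let amp (q : nat) : R := invsqrt q / r.

(** [(2 / p) q^(-1/2) q^(i tau)]: its Euler factor is a truncation of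
    [(1 - q^(- 1/2 - s + i tau))^(- 2 / p)], so that the product imitates the
    reproducing kernel at [1/2 + i tau] raised to the power [2 / p]. *)
Definition test_coef (q : nat) : R[i] :=
  (amp q)%:C * cexp (0 +i* (tau * ln q%:R)).

Definition test_term (q : nat) (s : R[i]) : R[i] := test_coef q * dpow q s.

Let decay (q : nat) (s : R[i]) : R := expR (- (complex.Re s * ln q%:R)).
Let angle (q : nat) (y : R) : R := (y - tau) * ln q%:R.

Lemma test_termE q s : test_term q s =
  (amp q * (decay q s * cos (angle q (complex.Im s)))) +i*
  (- (amp q * (decay q s * sin (angle q (complex.Im s))))).
Proof.
rewrite /test_term /test_coef /dpow -mulrA -cexpD /cexp /decay /angle.
case: s => x y; apply: complex_eq; rewrite !ReImE /=.
- rewrite !(mul0r, mulr0, subr0, addr0, add0r) mulNr.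
  by congr (_ * (_ * _)); rewrite -[LHS]cosN; congr cos; ring.
- rewrite !(mul0r, mulr0, subr0, addr0, add0r) mulNr -mulrN -mulrN.
  congr (_ * _); rewrite -mulrN; congr (_ * _); rewrite -sinN; congr sin; ring.
Qed.

Lemma normc_test_factor q s : normc (1 + test_term q s) `^ p =
  (1 + 2 * (amp q * decay q s) * cos (angle q (complex.Im s)) + (amp q * decay q s) ^+ 2) `^ r.
Proof.
have -> : 1 + 2 * (amp q * decay q s) * cos (angle q (complex.Im s)) + (amp q * decay q s) ^+ 2
    = normc (1 + test_term q s) ^+ 2.
  rewrite normc_sqrE test_termE !ReImE /= add0r.
  move: (angle q _) (decay q s) (amp q) => x d a.
  rewrite [RHS](_ : _ = 1 + 2 * (a * d) * cos x + (a * d) ^+ 2 * (cos x ^+ 2 + sin x ^+ 2)).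
    by rewrite cos2Dsin2 mulr1.
  ring.
by rewrite -powR_mulrn ?normc_ge0// -powRrM p2r.
Qed.

Lemma measurable_test_factor q :
  measurable_fun setT (fun s : borelC R => normc (1 + test_term q s) `^ p).
Proof.
under eq_fun do rewrite normc_test_factor.
apply: (@measurableT_comp _ _ _ _ _ _ (fun x : R => x `^ r)); first exact: measurable_powR.
have md : measurable_fun setT (decay q : borelC R -> R).
  apply: (@measurableT_comp _ _ _ _ _ _ expR); first exact: measurable_expR.
  apply: measurableT_comp => //; apply: measurable_funM => //; exact: measurable_Re.
have mc : measurable_fun setT (fun s : borelC R => cos (angle q (complex.Im s))).
  apply: (@measurableT_comp _ _ _ _ _ _ (@cos R)).
    exact: continuous_measurable_fun (@continuous_cos R).
  by apply: measurable_funM => //; apply: measurable_funB => //; exact: measurable_Im.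
apply: measurable_funD.
  apply: measurable_funD => //; apply: measurable_funM => //; apply: measurable_funM => //.
  exact: measurable_funM.
apply: (@measurableT_comp _ _ _ _ _ _ (fun x : R => x ^+ 2)) => //.
exact: measurable_funM.
Qed.

Lemma normc_prod (u : seq nat) (F : nat -> R[i]) :
  normc (\prod_(q <- u) F q) `^ p = \prod_(q <- u) normc (F q) `^ p.
Proof.
elim: u => [|q u IH]; first by rewrite !big_nil normc1 powR1.
by rewrite !big_cons normcM powRM ?normc_ge0// IH.
Qed.

Definition mean_factor (q : nat) : R := 1 + invsqrt q ^+ 2 + 152 * invsqrt q ^+ 3.

Let majorant := euler_majorant mean_factor (fun q => 2 * invsqrt q)
  (fun q => invsqrt q ^+ 2 - invsqrt q ^+ 2 / r) (fun=> tau).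

Lemma cos_abs_le1 (x : R) : `|cos x| <= 1.
Proof. by rewrite ler_norml cos_geN1 cos_le1. Qed.

Lemma invsqrt_gt0 q : (0 < q)%N -> 0 < invsqrt q.
Proof. by move=> q0; rewrite invr_gt0 sqrtr_gt0 ltr0n. Qed.

Lemma invsqrt_sqr q : invsqrt q ^+ 2 = q%:R^-1.
Proof. by rewrite /invsqrt exprVn sqr_sqrtr. Qed.

Lemma invsqrt_cube q : invsqrt q ^+ 3 = (q%:R * Num.sqrt q%:R)^-1.
Proof. by rewrite exprS invsqrt_sqr /invsqrt -invfM mulrC. Qed.

(** Primes start at [64^2] so that [factor_powR_le] applies for every [p]. *)
Lemma invsqrt_le q : (64 * 64 <= q)%N -> invsqrt q <= 64^-1.
Proof.
move=> hq; have q0 : (0 < q)%N by apply: leq_trans hq.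
rewrite lef_pV2 ?posrE ?sqrtr_gt0 ?ltr0n//.
rewrite -(@ler_pXn2r _ 2) ?nnegrE ?sqrtr_ge0// sqr_sqrtr//.
by rewrite expr2 -natrM ler_nat.
Qed.

Lemma test_factor_le q t : (64 * 64 <= q)%N ->
  normc (1 + test_term q (0 +i* t)) `^ p <= majorant q t.
Proof.
move=> hq; have q0 : (0 < q)%N by apply: leq_trans hq.
rewrite normc_test_factor /decay /= mul0r oppr0 expR0 mulr1.
have := factor_powR_le (invsqrt_gt0 q0) (invsqrt_le hq) r12 (cos_abs_le1 (angle q t)).
move/le_trans; apply; rewrite /majorant /euler_majorant /mean_factor -/(angle q t); lra.
Qed.

Lemma continuous_test_factor q :
  continuous (fun t : R => normc (1 + test_term q (0 +i* t)) `^ p).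
Proof.
move=> t; apply/cvgrPdist_lt => e e0.
set F := fun t : R => 1 + 2 * (amp q * 1) * cos (angle q t) + (amp q * 1) ^+ 2.
have FE u : normc (1 + test_term q (0 +i* u)) `^ p = F u `^ r.
  by rewrite normc_test_factor /decay /= mul0r oppr0 expR0.
have F0 u : 0 <= F u.
  have -> : F u = (1 + amp q * cos (angle q u)) ^+ 2 + (amp q * sin (angle q u)) ^+ 2.
    rewrite /F; move: (angle q u) (amp q) => x a.
    rewrite [RHS](_ : _ = 1 + 2 * a * cos x + a ^+ 2 * (cos x ^+ 2 + sin x ^+ 2)); last by ring.
    by rewrite cos2Dsin2 !mulr1.
  by rewrite addr_ge0 ?sqr_ge0.
have cF : {for t, continuous F}.
  apply: continuousD; last exact: cst_continuous.
  apply: continuousD; first exact: cst_continuous.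
  apply: continuousM; first exact: cst_continuous.
  have -> : (fun t => cos (angle q t)) = fun t => cos (ln q%:R * t + - tau * ln q%:R).
    by apply/funext => u; congr cos; rewrite /angle; ring.
  exact: continuous_cos_affine.
have [d d0 H] := powR_nneg_continuous r0 (F0 t) e0.
have /cvgrPdist_lt/(_ d d0) := cF; apply: filterS => u hu.
by rewrite !FE distrC; apply: H => //; rewrite distrC.
Qed.

(** The mean of the product of the majorants is the product of their constant
    terms; the factor [2] leaves room to replace the limit by the values for
    large [T]. *)
Lemma test_norm_le (u : seq nat) (P : {poly R[i]}) : uniq u -> all prime u ->
  all (fun q => 64 * 64 <= q)%N u ->
  (forall s, dirichlet_poly P s = \prod_(q <- u) (1 + test_term q s)) ->
  dirichlet_poly_norm p P `^ p <= 2 * \prod_(q <- u) mean_factor q.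
Proof.
move=> uu pu gu PE; set L := \prod_(q <- u) mean_factor q.
have L0 : 0 < L.
  rewrite /L big_seq; apply: prodr_gt0 => q /(allP pu) pq.
  have i0 := invsqrt_gt0 (prime_gt0 pq).
  by rewrite /mean_factor !addr_gt0// ?mulr_gt0// exprn_gt0.
have L2 : 0 < 2 * L by rewrite mulr_gt0.
have c11 : all (fun q => coprime q 1 && coprime q 1) u.
  by apply/allP => q _; rewrite coprimen1.
have := mean_tends_prod mean_factor (fun q => 2 * invsqrt q)
  (fun q => invsqrt q ^+ 2 - invsqrt q ^+ 2 / r) (fun=> tau) uu pu 0
  (ltn0Sn 0) (ltn0Sn 0) c11 L2.
rewrite eqxx cos0 mulr1 -/L => -[T0 T00 hT].
apply: (@dirichlet_poly_norm_le R p p1 P (2 * L) T0) => // [|T hT0]; first exact: ltW.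
have := hT T hT0; rewrite ler_norml => /andP[_ hI].
have T0' : 0 < T by exact: lt_le_trans hT0.
apply: (@le_trans _ _ (II (- T) T (fun t => (\prod_(q <- u) majorant q t) *
     cos ((ln 1%:R - ln 1%:R) * t + 0)))); last by lra.
have fE t : normc (dirichlet_poly P (0 +i* t)) `^ p =
    \prod_(q <- u) normc (1 + test_term q (0 +i* t)) `^ p.
  by rewrite PE normc_prod.
apply: le_II.
- move=> t _.
  have -> : (fun t => normc (dirichlet_poly P (0 +i* t)) `^ p) =
      fun t => \prod_(q <- u) normc (1 + test_term q (0 +i* t)) `^ p.
    by apply/funext.
  elim: (u) => [|q v IH].
    have -> : (fun t => \prod_(q <- [::]) normc (1 + test_term q (0 +i* t)) `^ p) = fun=> 1.
      by apply/funext => x; rewrite big_nil.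
    exact: cst_continuous.
  have -> : (fun t => \prod_(q <- q :: v) normc (1 + test_term q (0 +i* t)) `^ p) =
     fun t => normc (1 + test_term q (0 +i* t)) `^ p *
       \prod_(q <- v) normc (1 + test_term q (0 +i* t)) `^ p.
    by apply/funext => x; rewrite big_cons.
  by apply: continuousM; [exact: continuous_test_factor|exact: IH].
- move=> t _; apply: continuousM; last exact: continuous_cos_affine.
  exact: continuous_prod_majorant.
- move=> t _; rewrite subrr mul0r addr0 cos0 mulr1 fE.
  rewrite big_seq [leRHS]big_seq; apply: ler_prod => q /(allP gu) hq.
  by rewrite powR_ge0 test_factor_le.
Qed.

Lemma expR_halfln (q : nat) : (0 < q)%N -> expR (- (ln q%:R / 2)) = invsqrt q :> R.
Proof.
move=> q0; have q0' : 0 < q%:R :> R by rewrite ltr0n.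
rewrite expRN /invsqrt; congr (_^-1); apply/eqP.
rewrite -(@eqrXn2 _ 2) ?expR_ge0 ?sqrtr_ge0// sqr_sqrtr ?(ltW q0')//.
by rewrite -expRM_natl mulrCA mulfV ?mulr1 ?lnK ?posrE.
Qed.

Lemma cos_ge1B (x : R) : 0 <= x -> 1 - x <= cos x.
Proof.
move=> x0.
have d (t : R) : is_derive t 1 (fun t : R => cos t + t) (- sin t + 1).
  exact: (@is_deriveD _ R R (@cos R) id t 1 (- sin t) 1 _ _).
have := @le_derive R (fun t => cos t + t) (fun t => - sin t + 1) 0 x x0 (fun t _ => d t).
rewrite cos0 addr0 lerBlDr; apply => t _.
by have := sin_le1 t; lra.
Qed.

(** At [s = 1/2 + y + i x] in the Carleson square the term is
    [(2 / p) / q * e^(- y ln q)] times a unit of argument [(t - x) ln q], where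
    [y ln q] and [(x - t) ln q] are at most [h ln q <= 1]; its real part is
    therefore at least [(2 / p) / q * (1 - 2 h ln q)]. *)
Lemma test_factor_ge (q : nat) (h : R) (s : R[i]) : (64 * 64 <= q)%N ->
  h * ln q%:R <= 1 -> strip tau h h s ->
  expR (2 * q%:R^-1 - 4 * h * (ln q%:R / q%:R) - 4 * (q%:R * Num.sqrt q%:R)^-1)
    <= normc (1 + test_term q s) `^ p.
Proof.
move=> hq hL [/andP[s1 s2] /andP[s3 s4]].
have q0 : (0 < q)%N by apply: leq_trans hq.
have q0' : 0 < q%:R :> R by rewrite ltr0n.
have L0 : 0 <= ln q%:R :> R by rewrite ln_ge0// ler1n.
pose v := height s * ln q%:R; pose th := angle q (complex.Im s).
have v0 : 0 <= v by rewrite mulr_ge0// ltW.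
have vh : v <= h * ln q%:R by rewrite ler_wpM2r// ltW.
have th0 : 0 <= th by rewrite mulr_ge0//; lra.
have thh : th <= h * ln q%:R by rewrite ler_wpM2r//; lra.
pose g := expR (- v) * cos th.
have e1 : 1 - v <= expR (- v) by have := expR_ge1Dx (- v).
have e2 : expR (- v) <= 1 by rewrite -expR0 ler_expR; lra.
have e0 : 0 < expR (- v) by exact: expR_gt0.
have c1 := cos_ge1B th0; have c2 := cos_le1 th.
have c0 : 0 <= cos th by lra.
have g0 : 0 <= g by rewrite mulr_ge0// ltW.
have g1 : g <= 1 by rewrite /g; nra.
have gh : 1 - 2 * (h * ln q%:R) <= g.
  have : (1 - v) * (1 - th) <= g by rewrite /g; nra.
  have : 0 <= v * th by rewrite mulr_ge0.
  lra.
pose z := g / (r * q%:R).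
have zE : amp q * (decay q s * cos th) = z.
  have -> : decay q s = invsqrt q * expR (- v).
    rewrite -expR_halfln// -expRD /decay; congr expR.
    by rewrite /v /height; lra.
  rewrite /amp /z /g (invfM r) -(invsqrt_sqr q); move: r (expR _) => r' e; ring.
have z0 : 0 <= z by rewrite divr_ge0// mulr_ge0// ltW.
have q4096 : 64 * 64 <= q%:R :> R by rewrite -natrM ler_nat.
have zq : z <= 2 / q%:R.
  rewrite /z invfM mulrA ler_wpM2r ?invr_ge0 ?ler0n// ler_pdivrMr//.
  by apply: le_trans g1 _; have := r12; lra.
have z12 : `|z| <= 2^-1.
  rewrite ger0_norm//; apply: le_trans zq _; rewrite ler_pdivrMr//; lra.
have lower : 1 + z <= normc (1 + test_term q s).
  apply: le_trans (le_Re_normc _); apply: le_trans (ler_norm _).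
  by rewrite test_termE cReD /= zE.
apply: (@le_trans _ _ ((1 + z) `^ p)); last first.
  by apply: ge0_ler_powR; rewrite ?nnegrE ?normc_ge0 ?(ltW p0)// addr_ge0.
rewrite p2r; apply: le_trans (factor_powR_ge r0 z12); rewrite ler_expR.
have rz : 2 * r * z = 2 * g / q%:R.
  by rewrite /z; field; rewrite !gt_eqF.
have rzz : 2 * r * z ^+ 2 <= 4 * (q%:R * Num.sqrt q%:R)^-1.
  apply: (@le_trans _ _ (4 / q%:R / q%:R)).
    rewrite expr2 mulrA rz; apply: (@le_trans _ _ (2 / q%:R * (2 / q%:R))).
      apply: ler_pM => //; first by rewrite divr_ge0// ?mulr_ge0// ltW.
      by rewrite ler_pM2r ?invr_gt0//; lra.
    by rewrite le_eqVlt; apply/orP; left; apply/eqP; field; rewrite gt_eqF.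
  rewrite invfM -mulrA ler_pM2l// ler_wpM2l ?invr_ge0 ?(ltW q0')//.
  rewrite lef_pV2 ?posrE ?sqrtr_gt0//.
  rewrite -(@ler_pXn2r _ 2) ?nnegrE ?sqrtr_ge0 ?(ltW q0')// sqr_sqrtr ?(ltW q0')//.
  by rewrite expr2 ler_peMl ?(ltW q0')//; lra.
rewrite mulrBr rz.
have : 2 * (1 - 2 * (h * ln q%:R)) / q%:R <= 2 * g / q%:R.
  by rewrite ler_pM2r ?invr_gt0// ler_pM2l.
have -> : 2 * (1 - 2 * (h * ln q%:R)) / q%:R = 2 * q%:R^-1 - 4 * h * (ln q%:R / q%:R) by ring.
lra.
Qed.

End TestFunctions.

(** * Bounded Carleson squares *)

Section Necessity.
Variable R : realType.
Variables (p : R) (mu : {measure set (borelC R) -> \bar R}) (C : R).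
Hypotheses (p1 : 1 <= p) (C0 : 0 < C).
Hypothesis HC : forall (f : R[i] -> R[i]) (N : R), dirichlet_hardy p f N ->
  (\int[mu]_(s in @halfplane R) (normc (f s) `^ p)%:E <= (C * N `^ p)%:E)%E.

(** The Carleson inequality for one test function, bounded below on [S]. *)
Lemma test_inequality (tau : R) (u : seq nat) (S : set (borelC R)) (B : R) :
  uniq u -> all prime u -> all (fun q => 64 * 64 <= q)%N u ->
  measurable S -> S `<=` @halfplane R -> 0 <= B ->
  (forall s, S s -> B <= \prod_(q <- u) normc (1 + test_term p tau q s) `^ p) ->
  (B%:E * mu S <= (C * (2 * \prod_(q <- u) mean_factor R q))%:E)%E.
Proof.
move=> uu pu gu mS Sh B0 SB.
have [P PE] := dirichlet_poly_prod_exists (test_coef p tau) pu.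
have fE s : normc (dirichlet_poly P s) `^ p = \prod_(q <- u) normc (1 + test_term p tau q s) `^ p.
  by rewrite PE normc_prod.
have mf : measurable_fun setT (fun s : borelC R => (normc (dirichlet_poly P s) `^ p)%:E).
  apply/measurable_EFinP; under eq_fun do rewrite fE.
  by apply: measurable_prod => q _; exact: measurable_test_factor.
have H1 := HC (dirichlet_hardy_poly p1 P).
have H2 := test_norm_le p1 uu pu gu PE.
apply: (@le_trans _ _ (\int[mu]_(s in @halfplane R) (normc (dirichlet_poly P s) `^ p)%:E)%E).
  apply: (@le_trans _ _ (\int[mu]_(s in S) (normc (dirichlet_poly P s) `^ p)%:E)%E).
    rewrite -integral_cst//; apply: ge0_le_integral => //.
    - exact: measurable_funS mf.
    - by move=> s Ss; rewrite lee_fin fE; exact: SB.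
  apply: ge0_subset_integral => //; first exact: measurable_halfplane.
    exact: measurable_funS mf.
  by move=> s _; rewrite lee_fin powR_ge0.
by apply: le_trans H1 _; rewrite lee_fin ler_pM2l.
Qed.

(** The empty product is the constant [1]. *)
Lemma mu_halfplane_le : (mu (@halfplane R) <= (C * 2)%:E)%E.
Proof.
have := @test_inequality 0 [::] (@halfplane R) 1 isT isT isT (@measurable_halfplane R)
  (@subset_refl _ _) ler01.
rewrite !big_nil mul1e mulr1; apply => s _.
by rewrite big_nil.
Qed.

Lemma strip_sub_halfplane (t w h : R) : strip t w h `<=` @halfplane R.
Proof. by move=> s [/andP[s1 _] _]; move: s1; rewrite /height /halfplane/=; lra. Qed.

(** With [M = e^(1/h)] the test function gives
    [exp (2 S) mu Q = O(exp S)], and [exp (- S) = O(1 / ln M) = O(h)]. *)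
Lemma carleson_square_small (t h : R) : 0 < h -> h <= 1 ->
  (mu (strip t h h) <= (C * 2 * expR (64 * 64 + 640) * h)%:E)%E.
Proof.
move=> h0 h1; pose M := Num.truncn (expR h^-1).
have E0 : 0 <= expR h^-1 by exact: expR_ge0.
have /andP[M1 M2] := truncn_itv E0; rewrite -/M in M1 M2.
have i0 : 0 < h^-1 by rewrite invr_gt0.
have Mpos : (0 < M)%N by rewrite truncn_gt0 -expR0 ler_expR ltW.
have hM : h * ln M%:R <= 1.
  rewrite -ler_pdivlMl// mulr1 -(expRK h^-1) ler_ln ?posrE ?ltr0n// expR_gt0//.
pose u := primes_between (64 * 64) M.
have uu : uniq u := primes_between_uniq _ _.
have pu : all prime u := primes_between_prime _ _.
have gu : all (fun q => 64 * 64 <= q)%N u := primes_between_ge _ _.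
have lu : all (fun q => q <= M)%N u := primes_between_le _ _.
pose S : R := \sum_(q <- u) q%:R^-1.
pose S3 : R := \sum_(q <- u) (q%:R * Num.sqrt q%:R)^-1.
have S34 : S3 <= 4 by exact: sum_inv32_primes.
have SL : \sum_(q <- u) ln q%:R / q%:R <= 2 * ln M%:R :> R by exact: sum_ln_div_prime.
have up : \prod_(q <- u) mean_factor R q <= expR (S + 608).
  apply: (@le_trans _ _ (\prod_(q <- u) expR (q%:R^-1 + 152 * (q%:R * Num.sqrt q%:R)^-1))).
    rewrite big_seq [leRHS]big_seq; apply: ler_prod => q /(allP pu) pq.
    have b0 := ltW (invsqrt_gt0 R (prime_gt0 pq)).
    apply/andP; split.
      by rewrite /mean_factor !addr_ge0// ?mulr_ge0// exprn_ge0.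
    rewrite /mean_factor invsqrt_sqr invsqrt_cube -addrA; exact: expR_ge1Dx.
  rewrite -expR_sum ler_expR big_split/= -mulr_sumr -/S -/S3; lra.
have := @test_inequality t u (strip t h h) (expR (2 * S - 24)) uu pu gu (measurable_strip _ _ _)
  (@strip_sub_halfplane t h h) (expR_ge0 _).
have low s : strip t h h s ->
    expR (2 * S - 24) <= \prod_(q <- u) normc (1 + test_term p t q s) `^ p.
  move=> hs.
  apply: (@le_trans _ _ (\prod_(q <- u)
    expR (2 * q%:R^-1 - 4 * h * (ln q%:R / q%:R) - 4 * (q%:R * Num.sqrt q%:R)^-1))).
    rewrite -expR_sum ler_expR !sumrB -!mulr_sumr -/S -/S3.
    have : h * (\sum_(q <- u) ln q%:R / q%:R) <= 2.
      apply: le_trans (ler_wpM2l (ltW h0) SL) _; rewrite mulrCA; lra.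
    lra.
  rewrite big_seq [leRHS]big_seq; apply: ler_prod => q qu.
  rewrite expR_ge0 test_factor_ge ?(allP gu)//=.
  apply: le_trans hM; rewrite ler_pM2l// ler_ln ?posrE ?ltr0n ?ler_nat ?(allP lu _ qu)//.
  exact: prime_gt0 (allP pu _ qu).
move=> /(_ low) H.
have e0 : 0 < expR (2 * S - 24) by exact: expR_gt0.
have hS : expR (- S) <= h * expR (64 * 64 + 8).
  have lnM : h^-1 <= ln M.+1%:R by rewrite -(expRK h^-1) ler_ln ?posrE ?expR_gt0 ?ltr0n// ltW.
  have := le_trans lnM (ln_le_exp_sum_primes R (64 * 64) M); rewrite -/u -/S => h2.
  have -> : expR (- S) = expR (64 * 64 + 8) / expR (S + 64 * 64 + 8).
    by rewrite -expRN -expRD; congr expR; ring.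
  rewrite ler_pdivrMr ?expR_gt0// mulrAC ler_peMl ?expR_ge0//.
  by move: h2; rewrite natrM -div1r ler_pdivrMr// mulrC.
rewrite -(@lee_pmul2l _ (expR (2 * S - 24))%:E) ?lte_fin//.
apply: le_trans H _; rewrite -EFinM lee_fin.
apply: (@le_trans _ _ (C * 2 * expR (S + 608))).
  by rewrite -mulrA ler_pM2l// ler_pM2l.
have -> : S + 608 = (2 * S - 24) + (632 - S) by ring.
rewrite expRD mulrCA ler_pM2l// -!mulrA ler_pM2l// ler_pM2l//.
have -> : expR (64 * 64 + 640) * h = expR 632 * (h * expR (64 * 64 + 8)).
  rewrite mulrCA -expRD mulrC; congr (_ * expR _); ring.
by rewrite expRD ler_pM2l ?expR_gt0.
Qed.

(** For [h > 1] the total mass of the half-plane is bounded by a multiple of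
    [h]. *)
Lemma carleson_square_bound (t h : R) : 0 < h ->
  (mu (strip t h h) <= (C * 2 * expR (64 * 64 + 640) * h)%:E)%E.
Proof.
move=> h0; have [h1|h1] := leP h 1; first exact: carleson_square_small.
apply: le_trans (le_measure mu _ _ (@strip_sub_halfplane t h h)) _.
- by rewrite inE; exact: measurable_strip.
- by rewrite inE; exact: measurable_halfplane.
apply: le_trans mu_halfplane_le _; rewrite lee_fin -mulrA ler_peMr ?mulr_ge0 ?(ltW C0)//.
have := expR_ge1Dx (64 * 64 + 640 : R); move: (expR _) => e he.
by rewrite -[leLHS]mulr1 ler_pM//; lra.
Qed.

End Necessity.

Theorem theorem3 (R : realType) (p : R) (hp : 1 <= p)
    (mu : {measure set (borelC R) -> \bar R}) :
  carleson p (dirichlet_hardy p) mu -> carleson p (hardy_halfplane p) mu.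
Proof.
move=> [C C0 HC]; have p0 : 0 < p by rewrite (lt_le_trans _ hp).
have [Cm Cm0 sq] : exists2 Cm : R, 0 < Cm &
    forall t h : R, 0 < h -> (mu (strip t h h) <= (Cm * h)%:E)%E.
  exists (C * 2 * expR (64 * 64 + 640)); last exact: (carleson_square_bound hp C0 HC).
  by apply: mulr_gt0; [exact: mulr_gt0|exact: expR_gt0].
exists (embedding_cst Cm p) => [|f N [hf hN]].
  by rewrite /embedding_cst !mulr_gt0 ?powR_gt0.
have hf' z : halfplane z -> hol f z by exact: hf.
apply: (carleson_square_embedding Cm0 sq hp hf').
move=> u u2.
have : ((\int[lebesgue_measure]_v (normc (f (u +i* v)) `^ p)%:E) `^ p^-1 <= N%:E)%E.
  by rewrite -hN; apply: ereal_sup_ubound; exists u.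
have I0 : (0 <= \int[lebesgue_measure]_v (normc (f (u +i* v)) `^ p)%:E)%E.
  by apply: integral_ge0 => v _; rewrite lee_fin powR_ge0.
move: I0; case: (\int[lebesgue_measure]_v _)%E => [x|//|//].
- rewrite lee_fin => x0; rewrite poweR_EFin !lee_fin => xN.
  have -> : x = (x `^ p^-1) `^ p by rewrite -powRrM mulVf ?powRr1// gt_eqF.
  have N0 : 0 <= N by apply: le_trans xN; exact: powR_ge0.
  by apply: ge0_ler_powR; rewrite ?nnegrE ?powR_ge0// ltW.
- by rewrite poweRyr ?invr_eq0 ?gt_eqF// leye_eq.
Qed.
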